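(* Let $M_\hbar(2)$ be the $\hbar$-adic quantum Euclidean 4-space, with basis $\{\mathrm{det}_q^k\,T^{(j,j)}_{mm'}\}$ and multiplication map $\mu_\hbar$, let $\mathcal{X}=\mathbb{C}[a,b,c,d]$ be its undeformed limit with basis $\{\mathrm{det}^k\,T'^{(j,j)}_{mm'}\}$, $T'^{(j,j)}_{mm'}=\lim_{\hbar\to0}T^{(j,j)}_{mm'}$, and commutative multiplication $\mu=\lim_{\hbar\to0}\mu_\hbar$, and identify $M_\hbar(2)$ with $\mathcal{X}[[\hbar]]$ as $\mathbb{C}[[\hbar]]$-modules by $\mathrm{det}_q^k\,T^{(j,j)}_{mm'}\leftrightarrow\mathrm{det}^k\,T'^{(j,j)}_{mm'}$. Let $\mathcal{F}_{\mathrm{s}}$ be the standard twist from $\mathcal{U}(\mathrm{su}_2)$ to $\mathcal{U}_\hbar(\mathrm{su}_2)$. Then $\mu_\hbar$ is the deformation of $\mu$ by $\mathcal{F}_{\mathrm{so}_4}:=(\mathcal{F}_{\mathrm{s}})_{13}(\mathcal{F}_{\mathrm{s}})_{24}$: $$\mu_\hbar(x\otimes y)=\mu\big(\mathcal{F}_{\mathrm{so}_4}^{-1}\triangleright[x\otimes y]\big)\qquad\text{for all }x,y\in\mathcal{X}[[\hbar]].$$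
   Context: $\mathcal{U}(\mathrm{su}_2)$ is the complex enveloping algebra generated by $E,H,F$ with $[H,E]=2E$, $[H,F]=-2F$, $[E,F]=H$, canonical Hopf structure $\Delta(g)=g\otimes1+1\otimes g$, $\varepsilon(g)=0$, $S(g)=-g$ on generators, and $*$-structure $E^*=F$, $H^*=H$, $F^*=E$. $\mathcal{U}_\hbar(\mathrm{su}_2)$ is the complex $\hbar$-adic algebra generated by $E,H,F$ with $[H,E]=2E$, $[H,F]=-2F$, $[E,F]=\frac{e^{\hbar H}-e^{-\hbar H}}{e^\hbar-e^{-\hbar}}$, Hopf structure $\Delta'(E)=E\otimes e^{\hbar H}+1\otimes E$, $\Delta'(F)=F\otimes1+e^{-\hbar H}\otimes F$, $\Delta'(H)=H\otimes1+1\otimes H$, $S'(E)=-Ee^{-\hbar H}$, $S'(F)=-e^{\hbar H}F$, $S'(H)=-H$, $\varepsilon'(E)=\varepsilon'(F)=\varepsilon'(H)=0$, and involution $E^{*'}=Fe^{\hbar H}$, $F^{*'}=e^{-\hbar H}E$, $H^{*'}=H$. Put $q=e^\hbar$, $[n]=\frac{q^n-q^{-n}}{q-q^{-1}}$. For $j\in\frac12\mathbb{N}_0$, the spin-$j$ representation $\rho^j_\hbar$ of $\mathcal{U}_\hbar(\mathrm{su}_2)$ acts on the free $\mathbb{C}[[\hbar]]$-module $V^j[[\hbar]]$ with orthonormal basis $|j,m\rangle$, $m=-j,\dots,j$, by $E|j,m\rangle=q^{m+1}\sqrt{[j+m+1][j-m]}\,|j,m+1\rangle$, $F|j,m\rangle=q^{-m}\sqrt{[j+m][j-m+1]}\,|j,m-1\rangle$,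 $H|j,m\rangle=2m|j,m\rangle$. $\rho^j$ is the undeformed ($\hbar=0$) spin-$j$ representation of $\mathcal{U}(\mathrm{su}_2)$ in the same basis, extended $\hbar$-adically. $\alpha:\mathcal{U}_\hbar(\mathrm{su}_2)\to\mathcal{U}(\mathrm{su}_2)[[\hbar]]$ is the $*$-algebra isomorphism with $\alpha=\mathrm{id}+O(\hbar)$, $\alpha(H)=H$ and $\rho_\hbar^j=\rho^j\circ\alpha$ for all $j$; $\Delta_\hbar:=(\alpha\otimes\alpha)\circ\Delta'\circ\alpha^{-1}$. A Drinfeld twist from $\mathcal{U}(\mathrm{su}_2)$ to $\mathcal{U}_\hbar(\mathrm{su}_2)$ is an invertible $\mathcal{F}\in(\mathcal{U}(\mathrm{su}_2)\otimes\mathcal{U}(\mathrm{su}_2))[[\hbar]]$ with $\Delta_\hbar(g)=\mathcal{F}\Delta(g)\mathcal{F}^{-1}$ for all $g$, assumed counital: $(\varepsilon\otimes\mathrm{id})(\mathcal{F})=1=(\mathrm{id}\otimes\varepsilon)(\mathcal{F})$. The $q$-Clebsch-Gordan coefficients $C_q(j_1,m_1;j_2,m_2|j,m)\in\mathbb{R}[[\hbar]]$ are the coefficients, for $|j_1-j_2|\le j\le j_1+j_2$ in integer steps, of the embedding $|j,m\rangle\mapsto\sum_{m_1,m_2}C_q(j_1,m_1;j_2,m_2|j,m)\,|j_1,m_1\rangle\otimes|j_2,m_2\rangle$ which intertwines $\rho^j_\hbar$ with $(\rho_\hbar^{j_1}\otimes\rho_\hbar^{j_2})\circ\Delta'$,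 normalized to form an orthogonal matrix (in the indices $(m_1,m_2)$ and $(j,m)$), with signs fixed so that for $\hbar\to0$ they become the ordinary (undeformed) Clebsch-Gordan coefficients $C(j_1,m_1;j_2,m_2|j,m)$. The standard twist $\mathcal{F}_{\mathrm{s}}$ is the unique Drinfeld twist from $\mathcal{U}(\mathrm{su}_2)$ to $\mathcal{U}_\hbar(\mathrm{su}_2)$ with $\langle j_1,m_1;j_2,m_2|(\rho^{j_1}\otimes\rho^{j_2})(\mathcal{F}_{\mathrm{s}})|j_1,m_1';j_2,m_2'\rangle=\sum_{j,m}C_q(j_1,m_1;j_2,m_2|j,m)\,C(j_1,m_1';j_2,m_2'|j,m)$ for all $j_1,j_2$. $\mathcal{U}_\hbar(\mathrm{so}_4):=\mathcal{U}_\hbar(\mathrm{su}_2)\otimes\mathcal{U}_\hbar(\mathrm{su}_2)$ and $\mathcal{U}(\mathrm{so}_4):=\mathcal{U}(\mathrm{su}_2)\otimes\mathcal{U}(\mathrm{su}_2)$ are tensor product Hopf algebras. Quantum Euclidean 4-space $M_\hbar(2)$ is the $\hbar$-adic algebra generated by $X_{mm'}$, $m,m'\in\{-\frac12,+\frac12\}=\{-,+\}$, written $a=X_{--}$, $b=X_{-+}$, $c=X_{+-}$, $d=X_{++}$, with relations $ab=qba$, $ac=qca$, $bd=qdb$, $cd=qdc$, $bc=cb$, $ad-da=(q-q^{-1})bc$. It is a $\mathcal{U}_\hbar(\mathrm{so}_4)$-module algebra by $(g\otimes g')\triangleright X_{mm'}=\sum_{n,n'}X_{nn'}\,\rho_\hbar^{1/2}(g)^{n}{}_m\,\rho_\hbar^{1/2}(g')^{n'}{}_{m'}$.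 The quantum determinant $\mathrm{det}_q:=ad-qbc$ is central and scalar (invariant). For $j\in\frac12\mathbb{N}_0$ and $m,m'\in\{-j,\dots,j\}$, $T^{(j,j)}_{mm'}$ are the elements determined by $T^{(j,j)}_{jj}=d^{2j}$ and $(g\otimes g')\triangleright T^{(j,j)}_{mm'}=\sum_{n,n'}T^{(j,j)}_{nn'}\,\rho^j_\hbar(g)^n{}_m\,\rho^j_\hbar(g')^{n'}{}_{m'}$. The elements $\mathrm{det}_q^k\,T^{(j,j)}_{mm'}$, $k\in\mathbb{N}_0$, form a ($\hbar$-adic) basis of $M_\hbar(2)$, and the product of $M_\hbar(2)$ is determined by the centrality of $\mathrm{det}_q$ and $$\mu_\hbar\big(T^{(j_1,j_1)}_{m_1m_1'}\otimes T^{(j_2,j_2)}_{m_2m_2'}\big)=\sum_{m,m',j}C_q(j_1,m_1;j_2,m_2|j,m)\,C_q(j_1,m_1';j_2,m_2'|j,m')\,\mathrm{det}_q^{\,j_1+j_2-j}\,T^{(j,j)}_{mm'}.$$ In the limit $\hbar\to0$: $\mathrm{det}=ad-bc$, $T'^{(j,j)}_{jj}=d^{2j}$, and $\mathcal{U}(\mathrm{so}_4)[[\hbar]]$ acts on $\mathcal{X}[[\hbar]]$ by $(g\otimes g')\triangleright(\mathrm{det}^k\,T'^{(j,j)}_{mm'})=\sum_{n,n'}\mathrm{det}^k\,T'^{(j,j)}_{nn'}\,\rho^j(g)^n{}_m\,\rho^j(g')^{n'}{}_{m'}$ (elements of the Lie algebra act as derivations). Subscripts $13$, $24$ denote the tensor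 legs of $\mathcal{U}(\mathrm{su}_2)^{\otimes4}=\mathcal{U}(\mathrm{so}_4)\otimes\mathcal{U}(\mathrm{so}_4)$ in which the twist sits; $(\mathcal{U}(\mathrm{so}_4)\otimes\mathcal{U}(\mathrm{so}_4))[[\hbar]]$ acts on $(\mathcal{X}\otimes\mathcal{X})[[\hbar]]$ with legs 1,2 on the first factor and legs 3,4 on the second. *)

(* Defs.v *)
From HB Require Import structures.
From mathcomp Require Import all_boot all_order all_algebra.
From mathcomp Require Import generic_quotient.
From mathcomp Require Import boolp classical_sets reals.
From mathcomp Require Import complex.
From mathcomp Require Import finmap monalg mpoly.

Set Implicit Arguments.
Unset Strict Implicit.
Unset Printing Implicit Defensive.

Import Order.TTheory GRing.Theory Num.Theory.
Local Open Scope quotient_scope.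
Local Open Scope ring_scope.

(* Unital associative K-algebras, the zero algebra included, given by their
   central structure map.  MathComp's lalgType and algType require 1 != 0,
   which a presented algebra need not satisfy. *)
HB.mixin Record isPzAlgebra (K : pzRingType) A of GRing.PzRing A := {
  scal : K -> A;
  scal1 : scal 1 = 1;
  scalB : {morph scal : c d / c - d};
  scalM : {morph scal : c d / c * d};
  scal_central : forall c x, scal c * x = x * scal c
}.
#[short(type="pzAlgType")]
HB.structure Definition PzAlgebra (K : pzRingType) :=
  {A of GRing.PzRing A & isPzAlgebra K A}.

Section AlgebraInstances.
Variable K : comNzRingType.

Fact regular_scal_central (c : K) (x : K^o) : (c : K^o) * x = x * c.
Proof. exact: mulrC. Qed.
HB.instance Definition _ := isPzAlgebra.Build K K^o (scal := fun c : K => c)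
  erefl (fun _ _ => erefl) (fun _ _ => erefl) regular_scal_central.

Fact mx_scal_central n c (x : 'M[K]_n) : c%:M * x = x * c%:M.
Proof. by rewrite /GRing.mul /= scalar_mxC. Qed.
Fact mx_scalM n : {morph @scalar_mx K n : c d / c * d}.
Proof. by move=> c d; rewrite scalar_mxM. Qed.
HB.instance Definition _ n := isPzAlgebra.Build K 'M[K]_n
  erefl (raddfB (@scalar_mx K n)) (@mx_scalM n) (@mx_scal_central n).

Fact mpoly_scal_central n c (x : (mpoly n K)) :
  mpolyC n c * x = x * mpolyC n c.
Proof. exact: mulrC. Qed.
HB.instance Definition _ n := isPzAlgebra.Build K (mpoly n K)
  (mpolyC1 n K) (raddfB (mpolyC n (R:=K))) (mpolyCM n (R:=K))
  (@mpoly_scal_central n).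

End AlgebraInstances.

Section Inverses.
Variable A : pzRingType.

Definition invertible (x : A) := exists y, x * y = 1 /\ y * x = 1.

Definition inverse (x : A) : A :=
  xget 0 [set y | x * y = 1 /\ y * x = 1]%classic.

(* The [z] with [y * z = x]; only used where such a [z] exists and [y] is not
   a zero divisor. *)
Definition xquot (x y : A) : A := xget 0 [set z | y * z = x]%classic.

End Inverses.

Definition inverse_map (A : zmodType) B (f : A -> B) (y : B) : A :=
  xget 0 [set x | f x = y]%classic.

Record fps (A : Type) := Fps { fps_coef :> nat -> A }.
Notation "{ 'fps' A }" := (fps A) (at level 0, A at level 2,
  format "{ 'fps'  A }") : type_scope.

Lemma fpsP A (x y : {fps A}) : (forall n, x n = y n) -> x = y.
Proof. by case: x y => [x] [y] /= e; congr Fps; apply: funext. Qed.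

HB.instance Definition _ (A : Type) := gen_eqMixin {fps A}.
HB.instance Definition _ (A : Type) := gen_choiceMixin {fps A}.

Definition fps_map A B (f : A -> B) (x : {fps A}) : {fps B} :=
  Fps (fun n => f (x n)).

(* The extension of a biadditive map to power series, bilinear in hbar. *)
Definition fps_bil A B (V : nmodType) (f : A -> B -> V)
    (x : {fps A}) (y : {fps B}) : {fps V} :=
  Fps (fun n => \sum_(k < n.+1) f (x k) (y (n - k)%N)).

Section FpsZmodule.
Variable A : zmodType.

Definition fps_cst (a : A) : {fps A} := Fps (fun n => if n is 0%N then a else 0).
Definition fps_add (x y : {fps A}) := Fps (fun n => x n + y n).
Definition fps_opp (x : {fps A}) := Fps (fun n => - x n).
Fact fps_addA : associative fps_add.
Proof. by move=> x y z; apply: fpsP => n /=; rewrite addrA. Qed.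
Fact fps_addC : commutative fps_add.
Proof. by move=> x y; apply: fpsP => n /=; rewrite addrC. Qed.
Fact fps_add0 : left_id (Fps (fun=> 0)) fps_add.
Proof. by move=> x; apply: fpsP => n /=; rewrite add0r. Qed.
Fact fps_addN : left_inverse (Fps (fun=> 0)) fps_opp fps_add.
Proof. by move=> x; apply: fpsP => n /=; rewrite addNr. Qed.
HB.instance Definition _ :=
  GRing.isZmodule.Build {fps A} fps_addA fps_addC fps_add0 fps_addN.

Lemma fps_coefD (x y : {fps A}) n : (x + y) n = x n + y n. Proof. by []. Qed.
Lemma fps_coefN (x : {fps A}) n : (- x) n = - x n. Proof. by []. Qed.
Lemma fps_coef0 n : (0 : {fps A}) n = 0. Proof. by []. Qed.

End FpsZmodule.

Lemma convolA (V : nmodType) (F : nat -> nat -> nat -> V) n :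
  \sum_(k < n.+1) \sum_(i < k.+1) F i (k - i)%N (n - k)%N =
  \sum_(i < n.+1) \sum_(k < (n - i).+1) F i k (n - i - k)%N.
Proof.
have -> : \sum_(k < n.+1) \sum_(i < k.+1) F i (k - i)%N (n - k)%N =
   \sum_(k < n.+1) \sum_(i < n.+1 | (i <= k)%N) F i (k - i)%N (n - k)%N.
  apply: eq_bigr => k _.
  by rewrite (big_ord_widen n.+1 (fun i => F i (k - i)%N (n - k)%N)) ?ltn_ord.
rewrite (exchange_big_dep predT) //=; apply: eq_bigr => i _.
rewrite -(big_mkord (fun k => (i <= k)%N) (fun k => F i (k - i)%N (n - k)%N)).
rewrite -(big_mkord predT (fun k => F i k (n - i - k)%N)).
rewrite (big_cat_nat (n:=i)) //=; last by rewrite ltnW.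
rewrite big_nat_cond big1 ?add0r; last first.
  by move=> k /andP[/andP[_ ki]]; rewrite leqNgt ki.
rewrite -{1}(add0n (nat_of_ord i)) big_addn subSn -1?ltnS //.
rewrite [LHS]big_mkcond [RHS]big_mkcond.
by apply: eq_bigr => k _; rewrite leq_addl /= addnK subnDA subnAC.
Qed.

Lemma convolC (V : nmodType) (F : nat -> nat -> V) n :
  \sum_(k < n.+1) F k (n - k)%N = \sum_(k < n.+1) F (n - k)%N k.
Proof.
rewrite (reindex_inj rev_ord_inj) /=; apply: eq_bigr => k _.
by rewrite subSS subKn // -ltnS.
Qed.

Section FpsRing.
Variable A : pzRingType.

Definition fps_mul : {fps A} -> {fps A} -> {fps A} := fps_bil *%R.
Fact fps_mulA : associative fps_mul.
Proof.
move=> x y z; apply: fpsP => n /=.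
transitivity (\sum_(i < n.+1) \sum_(k < (n - i).+1)
                x i * y k * z (n - i - k)%N).
  by apply: eq_bigr => i _; rewrite mulr_sumr; apply: eq_bigr => k _; rewrite mulrA.
rewrite -(convolA (fun i j k => x i * y j * z k)).
by apply: eq_bigr => k _; rewrite mulr_suml.
Qed.
Fact fps_mul1 : left_id (fps_cst 1) fps_mul.
Proof.
move=> x; apply: fpsP => n /=; rewrite big_ord_recl /= mul1r subn0 big1 ?addr0 //.
by move=> i _; rewrite mul0r.
Qed.
Fact fps_mulr1 : right_id (fps_cst 1) fps_mul.
Proof.
move=> x; apply: fpsP => n /=.
rewrite (convolC (fun i j => x i * (if j is 0%N then 1 else 0))).
rewrite big_ord_recl /= mulr1 subn0 big1 ?addr0 //.
by move=> i _; rewrite mulr0.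
Qed.
Fact fps_mulDl : left_distributive fps_mul +%R.
Proof.
move=> x y z; apply: fpsP => n /=; rewrite -big_split /=.
by apply: eq_bigr => k _; rewrite mulrDl.
Qed.
Fact fps_mulDr : right_distributive fps_mul +%R.
Proof.
move=> x y z; apply: fpsP => n /=; rewrite -big_split /=.
by apply: eq_bigr => k _; rewrite mulrDr.
Qed.
HB.instance Definition _ := GRing.Zmodule_isPzRing.Build {fps A}
  fps_mulA fps_mul1 fps_mulr1 fps_mulDl fps_mulDr.

Lemma fps_coefM (x y : {fps A}) n :
  (x * y) n = \sum_(k < n.+1) x k * y (n - k)%N.
Proof. by []. Qed.

End FpsRing.

Section FpsComRing.
Variable K : comPzRingType.
Fact fps_mulC : @commutative {fps K} {fps K} *%R.
Proof.
move=> x y; apply: fpsP => n; rewrite !fps_coefM (convolC (fun i j => x i * y j)).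
by apply: eq_bigr => i _; rewrite mulrC.
Qed.
HB.instance Definition _ := GRing.PzRing_hasCommutativeMul.Build {fps K} fps_mulC.
End FpsComRing.

Section FpsModule.
Variables (K : pzRingType) (V : lmodType K).
Definition fps_scale : {fps K} -> {fps V} -> {fps V} := fps_bil *:%R.
Fact fps_scaleA c d x : fps_scale c (fps_scale d x) = fps_scale (c * d) x.
Proof.
apply: fpsP => n /=.
transitivity (\sum_(i < n.+1) \sum_(k < (n - i).+1)
                (c i * d k) *: x (n - i - k)%N).
  by apply: eq_bigr => i _; rewrite scaler_sumr; apply: eq_bigr => k _; rewrite scalerA.
rewrite -(convolA (fun i j k => (c i * d j) *: x k)).
by apply: eq_bigr => k _; rewrite scaler_suml.
Qed.
Fact fps_scale1 : left_id 1 fps_scale.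
Proof.
move=> x; apply: fpsP => n /=; rewrite big_ord_recl /= scale1r subn0 big1 ?addr0 //.
by move=> i _; rewrite scale0r.
Qed.
Fact fps_scaleDr : right_distributive fps_scale +%R.
Proof.
move=> x y z; apply: fpsP => n /=; rewrite -big_split /=.
by apply: eq_bigr => k _; rewrite scalerDr.
Qed.
Fact fps_scaleDl x : {morph fps_scale^~ x : c d / c + d}.
Proof.
move=> y z; apply: fpsP => n /=; rewrite -big_split /=.
by apply: eq_bigr => k _; rewrite scalerDl.
Qed.
HB.instance Definition _ := GRing.Zmodule_isLmodule.Build {fps K} {fps V}
  fps_scaleA fps_scale1 fps_scaleDr fps_scaleDl.
End FpsModule.

Section FpsAlgebra.
Variables (K : comPzRingType) (A : pzAlgType K).
Let sc : {fps K} -> {fps A} := fps_map scal.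
Lemma scal0 : scal 0 = 0 :> A.
Proof. by have := scalB (0 : K) 0 : scal _ = _ :> A; rewrite !subrr. Qed.
Lemma scalN (c : K) : scal (- c) = - scal c :> A.
Proof. by rewrite -sub0r scalB scal0 sub0r. Qed.
Lemma scalD (c d : K) : scal (c + d) = scal c + scal d :> A.
Proof. by rewrite -{1}(opprK d) scalB scalN opprK. Qed.
Fact fps_scal1 : sc 1 = 1.
Proof. by apply: fpsP => -[|n] /=; rewrite ?scal1 ?scal0. Qed.
Fact fps_scalB : {morph sc : c d / c - d}.
Proof. by move=> c d; apply: fpsP => n; rewrite /= scalB. Qed.
Fact fps_scalM : {morph sc : c d / c * d}.
Proof.
move=> c d; apply: fpsP => n; rewrite fps_coefM /=.
rewrite (big_morph (scal : K -> A) scalD scal0).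
by apply: eq_bigr => k _; rewrite scalM.
Qed.
Fact fps_scal_central c x : sc c * x = x * sc c.
Proof.
apply: fpsP => n; rewrite !fps_coefM (convolC (fun i j => sc c i * x j)).
by apply: eq_bigr => k _; rewrite scal_central.
Qed.
HB.instance Definition _ := isPzAlgebra.Build {fps K} {fps A}
  fps_scal1 fps_scalB fps_scalM fps_scal_central.
End FpsAlgebra.

(* [hexp a] is e^(hbar a) and [qexp r] is q^r = e^(hbar r). *)
Definition hexp (K : fieldType) (A : pzAlgType K) (a : A) : {fps A} :=
  Fps (fun n => scal (n`!%:R^-1 : K) * a ^+ n).
Definition qexp (K : fieldType) (r : K) : {fps K} :=
  Fps (fun n => n`!%:R^-1 * r ^+ n).

Definition qint (K : fieldType) (n : nat) : {fps K} :=
  xquot (qexp n%:R - qexp (- n%:R)) (qexp 1 - qexp (-1)).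

Definition fps_sqrt (R : realType) (x : {fps R}) : {fps R} :=
  xget 0 [set y : {fps R} | y * y = x /\ 0 <= y 0%N]%classic.

Record ideal (A : pzRingType) := Ideal {
  in_ideal :> A -> Prop;
  ideal0 : in_ideal 0;
  idealD : forall x y, in_ideal x -> in_ideal y -> in_ideal (x + y);
  idealMl : forall a x, in_ideal x -> in_ideal (a * x);
  idealMr : forall a x, in_ideal x -> in_ideal (x * a)
}.

Inductive generated (A : pzRingType) (S : A -> Prop) : A -> Prop :=
| generated_base x : S x -> generated S x
| generated_0 : generated S 0
| generated_D x y : generated S x -> generated S y -> generated S (x + y)
| generated_Ml a x : generated S x -> generated S (a * x)
| generated_Mr a x : generated S x -> generated S (x * a).

Definition ideal_gen (A : pzRingType) (S : A -> Prop) : ideal A :=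
  Ideal (generated_0 S) (@generated_D _ S) (@generated_Ml _ S) (@generated_Mr _ S).

(* The closure of an ideal in the hbar-adic topology. *)
Section Closure.
Variables (A : pzRingType) (I : ideal {fps A}).
Definition closure_set : {fps A} -> Prop :=
  fun x => forall N, exists2 y, I y & forall n, (n < N)%N -> x n = y n.
Fact closure0 : closure_set 0.
Proof. by move=> N; exists 0; first exact: ideal0. Qed.
Fact closureD x y : closure_set x -> closure_set y -> closure_set (x + y).
Proof.
move=> + + N => /(_ N)[x' Ix ex] /(_ N)[y' Iy ey].
by exists (x' + y'); [exact: idealD | move=> n nN; rewrite !fps_coefD ex ?ey].
Qed.
Fact closureMl a x : closure_set x -> closure_set (a * x).
Proof.
move=> + N => /(_ N)[x' Ix ex]; exists (a * x'); first exact: idealMl.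
move=> n nN; apply: eq_bigr => k _.
by rewrite ex // (leq_ltn_trans (leq_subr _ _)).
Qed.
Fact closureMr a x : closure_set x -> closure_set (x * a).
Proof.
move=> + N => /(_ N)[x' Ix ex]; exists (x' * a); first exact: idealMr.
by move=> n nN; apply: eq_bigr => k _; rewrite ex // (leq_trans (ltn_ord k)).
Qed.
Definition ideal_closure := Ideal closure0 closureD closureMl closureMr.
End Closure.

Section Quotient.
Variables (A : pzRingType) (I : ideal A).

Lemma idealN x : I x -> I (- x).
Proof. by rewrite -mulN1r; exact: idealMl. Qed.

Definition ideal_eqv (x y : A) := `[< I (x - y) >].
Fact ideal_eqv_equiv : equiv_class_of ideal_eqv.
Proof.
split=> [x|x y|y x z].
- by apply/asboolP; rewrite subrr; exact: ideal0.
- by apply/asboolP/asboolP => /idealN; rewrite opprB.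
- by move=> /asboolP xy /asboolP yz; apply/asboolP; rewrite -(subrKA y); exact: idealD.
Qed.
Canonical ideal_equiv := EquivRelPack ideal_eqv_equiv.

Definition quot := {eq_quot ideal_equiv}.
HB.instance Definition _ := Choice.on quot.
HB.instance Definition _ := EqQuotient.on quot.

Lemma quot_idealP (x y : A) : reflect (I (x - y)) (\pi_quot x == \pi_quot y).
Proof. by rewrite eqmodE; exact: asboolP. Qed.
Lemma quot_repr (x : A) : I (repr (\pi_quot x) - x).
Proof. by apply/quot_idealP; rewrite reprK. Qed.

Definition quot_add (x y : quot) : quot := \pi_quot (repr x + repr y).
Definition quot_opp (x : quot) : quot := \pi_quot (- repr x).
Definition quot_mul (x y : quot) : quot := \pi_quot (repr x * repr y).

Lemma pi_quotD x y : \pi_quot (x + y) = quot_add (\pi x) (\pi y).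
Proof.
by apply/esym/eqP/quot_idealP; rewrite opprD addrACA; apply: idealD; exact: quot_repr.
Qed.
Lemma pi_quotN x : \pi_quot (- x) = quot_opp (\pi x).
Proof. by apply/esym/eqP/quot_idealP; rewrite -opprD; exact/idealN/quot_repr. Qed.
Lemma pi_quotM x y : \pi_quot (x * y) = quot_mul (\pi x) (\pi y).
Proof.
apply/esym/eqP/quot_idealP; rewrite -(subrKA (x * repr (\pi_quot y))).
rewrite -mulrBl -mulrBr; apply: idealD.
  exact/idealMr/quot_repr.
exact/idealMl/quot_repr.
Qed.

Fact quot_addA : associative quot_add.
Proof.
elim/quotW=> x; elim/quotW=> y; elim/quotW=> z.
by rewrite -(pi_quotD y z) -(pi_quotD x y) -(pi_quotD x) -(pi_quotD _ z) addrA.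
Qed.
Fact quot_addC : commutative quot_add.
Proof. by elim/quotW=> x; elim/quotW=> y; rewrite -(pi_quotD x y) -(pi_quotD y x) addrC. Qed.
Fact quot_add0 : left_id (\pi_quot 0) quot_add.
Proof. by elim/quotW=> x; rewrite -(pi_quotD 0) add0r. Qed.
Fact quot_addN : left_inverse (\pi_quot 0) quot_opp quot_add.
Proof. by elim/quotW=> x; rewrite -(pi_quotN x) -(pi_quotD (- x)) addNr. Qed.
HB.instance Definition _ :=
  GRing.isZmodule.Build quot quot_addA quot_addC quot_add0 quot_addN.

Fact quot_mulA : associative quot_mul.
Proof.
elim/quotW=> x; elim/quotW=> y; elim/quotW=> z.
by rewrite -(pi_quotM y z) -(pi_quotM x y) -(pi_quotM x) -(pi_quotM _ z) mulrA.
Qed.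
Fact quot_mul1 : left_id (\pi_quot 1) quot_mul.
Proof. by elim/quotW=> x; rewrite -(pi_quotM 1) mul1r. Qed.
Fact quot_mulr1 : right_id (\pi_quot 1) quot_mul.
Proof. by elim/quotW=> x; rewrite -(pi_quotM x) mulr1. Qed.
Fact quot_mulDl : left_distributive quot_mul +%R.
Proof.
elim/quotW=> x; elim/quotW=> y; elim/quotW=> z.
rewrite [X in quot_mul X _](_ : _ = \pi_quot (x + y)); last exact/esym/pi_quotD.
rewrite -(pi_quotM _ z) -(pi_quotM x z) -(pi_quotM y z).
by rewrite -[RHS](pi_quotD (x * z)) mulrDl.
Qed.
Fact quot_mulDr : right_distributive quot_mul +%R.
Proof.
elim/quotW=> x; elim/quotW=> y; elim/quotW=> z.
rewrite [X in quot_mul _ X](_ : _ = \pi_quot (y + z)); last exact/esym/pi_quotD.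
rewrite -(pi_quotM x _) -(pi_quotM x z) -(pi_quotM x y).
by rewrite -[RHS](pi_quotD (x * y)) mulrDr.
Qed.
HB.instance Definition _ := GRing.Zmodule_isPzRing.Build quot
  quot_mulA quot_mul1 quot_mulr1 quot_mulDl quot_mulDr.

Lemma piD x y : \pi_quot (x + y) = \pi_quot x + \pi_quot y.
Proof. exact: pi_quotD. Qed.
Lemma piN x : \pi_quot (- x) = - \pi_quot x.
Proof. exact: pi_quotN. Qed.
Lemma piB x y : \pi_quot (x - y) = \pi_quot x - \pi_quot y.
Proof. by rewrite piD piN. Qed.
Lemma piM x y : \pi_quot (x * y) = \pi_quot x * \pi_quot y.
Proof. exact: pi_quotM. Qed.
Lemma pi1 : \pi_quot 1 = 1. Proof. by []. Qed.
Lemma pi0 : \pi_quot 0 = 0. Proof. by []. Qed.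

End Quotient.

Section QuotientAlgebra.
Variables (K : comPzRingType) (A : pzAlgType K) (I : ideal A).
Let sc (c : K) : quot I := \pi_(quot I) (scal c : A).
Fact quot_scal1 : sc 1 = 1.
Proof. by rewrite /sc scal1. Qed.
Fact quot_scalB : {morph sc : c d / c - d}.
Proof. by move=> c d; rewrite /sc scalB piB. Qed.
Fact quot_scalM : {morph sc : c d / c * d}.
Proof. by move=> c d; rewrite /sc scalM piM. Qed.
Fact quot_scal_central c x : sc c * x = x * sc c.
Proof. by elim/quotW: x => x; rewrite -!piM scal_central. Qed.
HB.instance Definition _ := isPzAlgebra.Build K (quot I)
  quot_scal1 quot_scalB quot_scalM quot_scal_central.

Fact quot_scaleA c d (x : quot I) : sc c * (sc d * x) = sc (c * d) * x.
Proof. by rewrite mulrA quot_scalM. Qed.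
Fact quot_scale1 : left_id 1 (fun c (x : quot I) => sc c * x).
Proof. by move=> x; rewrite quot_scal1 mul1r. Qed.
Fact quot_scaleDr : right_distributive (fun c (x : quot I) => sc c * x) +%R.
Proof. by move=> c x y; rewrite mulrDr. Qed.
Fact quot_scaleDl x : {morph (fun c (x : quot I) => sc c * x)^~ x : c d / c + d}.
Proof. by move=> c d; rewrite /sc scalD piD mulrDl. Qed.
HB.instance Definition _ := GRing.Zmodule_isLmodule.Build K (quot I)
  quot_scaleA quot_scale1 quot_scaleDr quot_scaleDl.
End QuotientAlgebra.

Notation free_alg K G := {malg K[{fmonom G}]}.

Section FreeAlgebra.
Variables (K : comNzRingType) (G : choiceType).
Implicit Types (c : K) (x : free_alg K G).
Let sc c : free_alg K G := c *: 1.
Fact free_scal1 : sc 1 = 1.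
Proof. exact: scale1r. Qed.
Fact free_scalB : {morph sc : c d / c - d}.
Proof. by move=> c d; rewrite /sc scalerBl. Qed.
Fact free_scalM : {morph sc : c d / c * d}.
Proof. by move=> c d; rewrite /sc -scalerAl mul1r scalerA. Qed.
Fact free_scal_central c x : sc c * x = x * sc c.
Proof.
rewrite /sc -(mul_malgC c 1) mulr1 mul_malgC [RHS]fgmulgU -mul_malgC [LHS]fgmulUg.
by apply: eq_bigr => k _; rewrite mul1m mulm1 mulrC.
Qed.
HB.instance Definition _ := isPzAlgebra.Build K (free_alg K G)
  free_scal1 free_scalB free_scalM free_scal_central.
End FreeAlgebra.

Definition letter (K : comNzRingType) (G : choiceType) (g : G) : free_alg K G :=
  << fmu g >>.

Section WordSums.
Variables (K : comNzRingType) (G : choiceType) (V : pzAlgType K).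

(* The additive map on the free algebra sending [c w], for [c] a scalar and [w]
   a word, to [sg c * phi w]; then its hbar-adic extension. *)
Definition wsum (sg : K -> K) (phi : seq G -> V) (p : free_alg K G) : V :=
  \sum_(w <- monalg.msupp p) scal (sg (monalg.mcoeff w p)) * phi w.
Definition hwsum (sg : K -> K) (phi : seq G -> {fps V}) (p : {fps free_alg K G}) :
    {fps V} :=
  Fps (fun n => \sum_(k < n.+1) wsum sg (fun w => phi w (n - k)%N) (p k)).

End WordSums.

Section Presentations.
Variables (K : comNzRingType) (G : choiceType).

Definition presented (S : free_alg K G -> Prop) := quot (ideal_gen S).
HB.instance Definition _ S := EqQuotient.on (presented S).
HB.instance Definition _ S := PzAlgebra.on (presented S).
HB.instance Definition _ S := GRing.Lmodule.on (presented S).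

(* The hbar-adic algebra on the generators [G] subject to the relations [S]. *)
Definition hpresented (S : {fps free_alg K G} -> Prop) :=
  quot (ideal_closure (ideal_gen S)).
HB.instance Definition _ S := EqQuotient.on (hpresented S).
HB.instance Definition _ S := PzAlgebra.on (hpresented S).
HB.instance Definition _ S := GRing.Lmodule.on (hpresented S).

(* The algebra morphism with prescribed values on the generators.  It is
   evaluated on a representative, so it is meaningful only if the values [f]
   satisfy the relations. *)
Definition pres_lift (S : free_alg K G -> Prop) (V : pzAlgType K) (f : G -> V)
    (x : presented S) : V :=
  wsum id (fun w => \prod_(g <- w) f g) (repr x).

Definition hpres_lift (S : {fps free_alg K G} -> Prop) (V : pzAlgType K)
    (f : G -> {fps V}) (x : hpresented S) : {fps V} :=
  hwsum id (fun w => \prod_(g <- w) f g) (repr x).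

Definition hpres_lift_quot (S : {fps free_alg K G} -> Prop) (G' : choiceType)
    (I : ideal {fps free_alg K G'}) (f : G -> quot I) (x : hpresented S) : quot I :=
  \pi_(quot I) (hwsum id (fun w => \prod_(g <- w) repr (f g)) (repr x)).

End Presentations.

(* [l] and [r] are algebra morphisms with commuting images. *)
Inductive tensor_rel (L : pzRingType) (A B F : pzAlgType L)
    (l : A -> F) (r : B -> F) : F -> Prop :=
| tensor_relDl a a' : tensor_rel l r (l (a + a') - (l a + l a'))
| tensor_relDr b b' : tensor_rel l r (r (b + b') - (r b + r b'))
| tensor_relMl a a' : tensor_rel l r (l (a * a') - l a * l a')
| tensor_relMr b b' : tensor_rel l r (r (b * b') - r b * r b')
| tensor_relCl c : tensor_rel l r (l (scal c) - scal c)
| tensor_relCr c : tensor_rel l r (r (scal c) - scal c)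
| tensor_rel_comm a b : tensor_rel l r (l a * r b - r b * l a).

Section WordLegs.
Variables A B : pzRingType.
Definition wleft (w : seq (A + B)) : A :=
  \prod_(s <- w) (if s is inl a then a else 1).
Definition wright (w : seq (A + B)) : B :=
  \prod_(s <- w) (if s is inr b then b else 1).
End WordLegs.

Section Tensor.
Variables (K : comNzRingType) (A B : pzAlgType K).

Definition tens := presented (tensor_rel
  (fun a : A => letter K (inl a : A + B)%type)
  (fun b : B => letter K (inr b : A + B)%type)).
HB.instance Definition _ := EqQuotient.on tens.
HB.instance Definition _ := PzAlgebra.on tens.
HB.instance Definition _ := GRing.Lmodule.on tens.

Definition tensl (a : A) : tens := \pi_tens (letter K (inl a : A + B)%type).
Definition tensr (b : B) : tens := \pi_tens (letter K (inr b : A + B)%type).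
Definition tpure (a : A) (b : B) : tens := tensl a * tensr b.

(* The linear map induced by a bilinear map [f]: [a (x) b |-> f a b]. *)
Definition tlift (V : pzAlgType K) (f : A -> B -> V) (t : tens) : V :=
  wsum id (fun w => f (wleft w) (wright w)) (repr t).

End Tensor.

Definition tmap (K : comNzRingType) (A B A' B' : pzAlgType K)
    (f : A -> A') (g : B -> B') : tens A B -> tens A' B' :=
  tlift (fun a b => tpure (f a) (g b)).

(* Tensor products of hbar-adic algebras are completed. *)
Section CompletedTensor.
Variables (K : fieldType) (A B : pzAlgType {fps K}).

Definition ctens := hpresented (tensor_rel
  (fun a : A => fps_cst (letter K (inl a : A + B)%type))
  (fun b : B => fps_cst (letter K (inr b : A + B)%type))).
HB.instance Definition _ := EqQuotient.on ctens.
HB.instance Definition _ := PzAlgebra.on ctens.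
HB.instance Definition _ := GRing.Lmodule.on ctens.

Definition ctensl (a : A) : ctens :=
  \pi_ctens (fps_cst (letter K (inl a : A + B)%type)).
Definition ctensr (b : B) : ctens :=
  \pi_ctens (fps_cst (letter K (inr b : A + B)%type)).
Definition ctpure (a : A) (b : B) : ctens := ctensl a * ctensr b.

Definition ctlift (V : pzAlgType K) (f : A -> B -> {fps V}) (t : ctens) :
    {fps V} :=
  hwsum id (fun w => f (wleft w) (wright w)) (repr t).

(* e^(hbar a) (x) 1 and 1 (x) e^(hbar b) *)
Definition hexpl (a : A) : ctens := \pi_ctens (hexp (letter K (inl a : A + B)%type)).
Definition hexpr (b : B) : ctens := \pi_ctens (hexp (letter K (inr b : A + B)%type)).

End CompletedTensor.

Definition ctmap (K : fieldType) (A B A' B' : pzAlgType {fps K})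
    (f : A -> A') (g : B -> B') (t : ctens A B) : ctens A' B' :=
  \pi_(ctens A' B') (hwsum id (fun w => fps_cst
    (letter K (inl (f (wleft w)) : A' + B')%type
     * letter K (inr (g (wright w)) : A' + B')%type)) (repr t)).

Definition lie_bracket (A : pzRingType) (x y : A) : A := x * y - y * x.

Variant su2_gen := gE | gH | gF.
HB.instance Definition _ := gen_eqMixin su2_gen.
HB.instance Definition _ := gen_choiceMixin su2_gen.

(* A spin j is given by [n = 2j], and the index m by [i = j + m : 'I_n.+1];
   [spin_m i] is m. *)
Definition spin_m (F : fieldType) (n : nat) (i : 'I_n.+1) : F :=
  i%:R - n%:R / 2.

(* The spins j with |j1 - j2| <= j <= j1 + j2 and j1 + j2 - j integral. *)
Definition cg_range (n1 n2 n : nat) : bool :=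
  [&& (n1 - n2 <= n)%N, (n2 - n1 <= n)%N, (n <= n1 + n2)%N
    & ~~ odd (n1 + n2 + n)].

(* [c n1 n2 n i1 i2 i] stands for C(j1,m1;j2,m2|j,m). *)
Definition cg_family (A : Type) :=
  forall n1 n2 n : nat, 'I_n1.+1 -> 'I_n2.+1 -> 'I_n.+1 -> A.

(* For all j1 and j2, the matrix with rows (m1,m2) and columns (j,m) is
   orthogonal. *)
Definition cg_orthogonal (A : pzRingType) (c : cg_family A) : Prop :=
  forall n1 n2,
    (forall (i1 k1 : 'I_n1.+1) (i2 k2 : 'I_n2.+1),
       \sum_(n < (n1 + n2).+1 | cg_range n1 n2 n) \sum_(i < n.+1)
         c n1 n2 n i1 i2 i * c n1 n2 n k1 k2 i
       = ((i1 == k1) && (i2 == k2))%:R) /\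
    (forall n n' (i : 'I_n.+1) (i' : 'I_n'.+1),
       cg_range n1 n2 n -> cg_range n1 n2 n' ->
       \sum_(i1 < n1.+1) \sum_(i2 < n2.+1)
         c n1 n2 n i1 i2 i * c n1 n2 n' i1 i2 i'
       = ((n == n') && (i == i' :> nat))%:R).

Section Su2.
Variable R : realType.
Local Notation C := R[i].
Local Notation real := (real_complex R).

Definition su2_rel (r : free_alg C su2_gen) : Prop :=
  let E := letter C gE in let H := letter C gH in let F := letter C gF in
  [\/ r = lie_bracket H E - E *+ 2, r = lie_bracket H F + F *+ 2
    | r = lie_bracket E F - H].

Definition U := presented su2_rel.
HB.instance Definition _ := EqQuotient.on U.
HB.instance Definition _ := PzAlgebra.on U.
HB.instance Definition _ := GRing.Lmodule.on U.
Definition U_gen (g : su2_gen) : U := \pi_U (letter C g).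

Definition UU := tens U U.
HB.instance Definition _ := EqQuotient.on UU.
HB.instance Definition _ := PzAlgebra.on UU.
HB.instance Definition _ := GRing.Lmodule.on UU.

Definition U_Delta : U -> UU :=
  pres_lift (fun g => tensl U (U_gen g) + tensr U (U_gen g)).

Definition U_eps : U -> C := pres_lift (V := C^o) (fun=> 0).

Definition adj_gen (g : su2_gen) : su2_gen :=
  match g with gE => gF | gH => gH | gF => gE end.

Definition U_star (x : U) : U :=
  wsum (fun c : C => c^*) (fun w => \prod_(g <- rev w) U_gen (adj_gen g)) (repr x).

Definition suh_rel (r : {fps free_alg C su2_gen}) : Prop :=
  let h := letter C gH in
  let E := fps_cst (letter C gE) in let H := fps_cst h in
  let F := fps_cst (letter C gF) in
  [\/ r = lie_bracket H E - E *+ 2, r = lie_bracket H F + F *+ 2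
    | r = lie_bracket E F - xquot (hexp h - hexp (- h)) (hexp 1 - hexp (-1))].

Definition Uh := hpresented suh_rel.
HB.instance Definition _ := EqQuotient.on Uh.
HB.instance Definition _ := PzAlgebra.on Uh.
HB.instance Definition _ := GRing.Lmodule.on Uh.
Definition Uh_gen (g : su2_gen) : Uh := \pi_Uh (fps_cst (letter C g)).
Definition Uh_expH (c : C) : Uh := \pi_Uh (hexp (scal c * letter C gH)).

Definition UUh := ctens Uh Uh.
HB.instance Definition _ := EqQuotient.on UUh.
HB.instance Definition _ := PzAlgebra.on UUh.
HB.instance Definition _ := GRing.Lmodule.on UUh.

Definition Uh_Delta : Uh -> UUh :=
  hpres_lift_quot (fun g =>
    let E := Uh_gen gE in let H := Uh_gen gH in let F := Uh_gen gF in
    match g with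
    | gE => ctensl Uh E * hexpr Uh H + ctensr Uh E
    | gF => ctensl Uh F + hexpl Uh (- H) * ctensr Uh F
    | gH => ctensl Uh H + ctensr Uh H
    end).

Definition Uh_eps : Uh -> {fps C} := hpres_lift (V := C^o) (fun=> 0).

Definition Uh_star (x : Uh) : Uh :=
  let star_gen g := match g with
    | gE => Uh_gen gF * Uh_expH 1
    | gF => Uh_expH (-1) * Uh_gen gE
    | gH => Uh_gen gH
    end in
  \pi_Uh (hwsum (fun c : C => c^*)
            (fun w => \prod_(g <- rev w) repr (star_gen g)) (repr x)).

(* The limit hbar -> 0 on the generators; the relations specialize. *)
Definition Uh_lim (x : Uh) : U :=
  wsum id (fun w => \prod_(g <- w) U_gen g) (repr x 0%N).

Section Spin.
Variable n : nat.

Definition rho_gen (g : su2_gen) : 'M[C]_n.+1 :=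
  \matrix_(k, i) match g with
  | gE => if k == i.+1 :> nat then real (Num.sqrt (i.+1 * (n - i))%N%:R) else 0
  | gF => if k.+1 == i :> nat then real (Num.sqrt (i * (n - i).+1)%N%:R) else 0
  | gH => if k == i then spin_m C i *+ 2 else 0
  end.

Definition rho : U -> 'M[C]_n.+1 := pres_lift rho_gen.

Definition rhoh_entry (g : su2_gen) (k i : 'I_n.+1) : {fps C} :=
  match g with
  | gE => if k == i.+1 :> nat
          then fps_map real (qexp (spin_m R i + 1)
                             * fps_sqrt (qint R i.+1 * qint R (n - i)%N))
          else 0
  | gF => if k.+1 == i :> nat
          then fps_map real (qexp (- spin_m R i)
                             * fps_sqrt (qint R i * qint R (n - i).+1%N))
          else 0
  | gH => if k == i then fps_cst (spin_m C i *+ 2) else 0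
  end.

Definition rhoh_gen (g : su2_gen) : {fps 'M[C]_n.+1} :=
  Fps (fun d => \matrix_(k, i) rhoh_entry g k i d).

Definition rhoh : Uh -> {fps 'M[C]_n.+1} := hpres_lift rhoh_gen.

(* The matrix element <m_k| rhoh(x) |m_i>. *)
Definition rhoh_coef (x : Uh) (k i : 'I_n.+1) : {fps C} :=
  fps_map (fun M : 'M[C]_n.+1 => M k i) (rhoh x).

End Spin.

(* The matrix element <m1;m2| (rho^j1 (x) rho^j2)(t) |m1';m2'>. *)
Definition rho2_coef n1 n2 (i1 : 'I_n1.+1) (i2 : 'I_n2.+1)
    (k1 : 'I_n1.+1) (k2 : 'I_n2.+1) : UU -> C :=
  tlift (V := C^o) (fun a b => rho n1 a i1 k1 * rho n2 b i2 k2).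
Definition rhoh2_coef n1 n2 (i1 : 'I_n1.+1) (i2 : 'I_n2.+1)
    (k1 : 'I_n1.+1) (k2 : 'I_n2.+1) : UUh -> {fps C} :=
  ctlift (V := C^o) (fun a b => rhoh_coef a i1 k1 * rhoh_coef b i2 k2 : {fps C}).

Record is_alpha (alpha : Uh -> {fps U}) : Prop := IsAlpha {
  alphaD : forall x y, alpha (x + y) = alpha x + alpha y;
  alphaM : forall x y, alpha (x * y) = alpha x * alpha y;
  alpha_scal : forall c : {fps C}, alpha (scal c) = scal c;
  alpha_bij : bijective alpha;
  alpha_star : forall x, alpha (Uh_star x) = fps_map U_star (alpha x);
  alpha_lim : forall x, alpha x 0%N = Uh_lim x;
  alpha_H : alpha (Uh_gen gH) = fps_cst (U_gen gH);
  alpha_rho : forall n x, rhoh n x = fps_map (rho n) (alpha x)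
}.

Definition Delta_alpha (alpha : Uh -> {fps U}) (g : {fps U}) : {fps UU} :=
  ctlift (fun a b => fps_bil (@tpure _ U U) (alpha a) (alpha b))
         (Uh_Delta (inverse_map alpha g)).

Record is_twist (alpha : Uh -> {fps U}) (F : {fps UU}) : Prop := IsTwist {
  twist_inv : invertible F;
  twist_Delta : forall g : {fps U},
    Delta_alpha alpha g = F * fps_map U_Delta g * inverse F;
  twist_counitl : fps_map (tlift (fun a b => scal (U_eps a) * b : U)) F = 1;
  twist_counitr : fps_map (tlift (fun a b => scal (U_eps b) * a : U)) F = 1
}.

(* The sign condition is the Condon-Shortley convention
   C(j1,j1;j2,j-j1|j,j) > 0; the index of m2 = j - j1 is (n + n2 - n1) / 2. *)
Record is_CG (c : cg_family R) : Prop := IsCG {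
  CG_intertwines : forall n1 n2 n (x : U) i1 i2 i, cg_range n1 n2 n ->
    \sum_(k < n.+1) real (c n1 n2 n i1 i2 k) * rho n x k i
    = \sum_(k1 < n1.+1) \sum_(k2 < n2.+1)
        rho2_coef i1 i2 k1 k2 (U_Delta x) * real (c n1 n2 n k1 k2 i);
  CG_orthogonal : cg_orthogonal c;
  CG_sign : forall n1 n2 n (i2 : 'I_n2.+1), cg_range n1 n2 n ->
    i2 = (n + n2 - n1)./2%N :> nat -> 0 < c n1 n2 n ord_max i2 ord_max
}.

Record is_qCG (c : cg_family R) (cq : cg_family {fps R}) : Prop := IsQCG {
  qCG_intertwines : forall n1 n2 n (x : Uh) i1 i2 i, cg_range n1 n2 n ->
    \sum_(k < n.+1) fps_map real (cq n1 n2 n i1 i2 k) * rhoh_coef x k i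
    = \sum_(k1 < n1.+1) \sum_(k2 < n2.+1)
        rhoh2_coef i1 i2 k1 k2 (Uh_Delta x) * fps_map real (cq n1 n2 n k1 k2 i);
  qCG_orthogonal : cg_orthogonal cq;
  qCG_lim : forall n1 n2 n i1 i2 i, cg_range n1 n2 n ->
    cq n1 n2 n i1 i2 i 0%N = c n1 n2 n i1 i2 i
}.

Record is_standard_twist (alpha : Uh -> {fps U}) (c : cg_family R)
    (cq : cg_family {fps R}) (F : {fps UU}) : Prop := IsStandardTwist {
  standard_twist : is_twist alpha F;
  standard_coef : forall n1 n2 (i1 k1 : 'I_n1.+1) (i2 k2 : 'I_n2.+1),
    fps_map (rho2_coef i1 i2 k1 k2) F
    = \sum_(n < (n1 + n2).+1 | cg_range n1 n2 n) \sum_(i < n.+1)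
        fps_map real (cq n1 n2 n i1 i2 i * fps_cst (c n1 n2 n k1 k2 i))
}.

Definition Mh_rel (r : {fps free_alg C ('I_2 * 'I_2)%type}) : Prop :=
  let X (i j : 'I_2) := fps_cst (letter C (i, j)) in
  let a := X 0 0 in let b := X 0 1 in let c := X 1 0 in let d := X 1 1 in
  let q : {fps free_alg C ('I_2 * 'I_2)%type} := scal (qexp (1 : C)) in
  let q' : {fps free_alg C ('I_2 * 'I_2)%type} := scal (qexp (-1 : C)) in
  [\/ [\/ r = a * b - q * (b * a), r = a * c - q * (c * a)
        | r = b * d - q * (d * b)],
      r = c * d - q * (d * c), r = b * c - c * b
    | r = a * d - d * a - (q - q') * (b * c)].

Definition Mh := hpresented Mh_rel.
HB.instance Definition _ := EqQuotient.on Mh.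
HB.instance Definition _ := PzAlgebra.on Mh.
HB.instance Definition _ := GRing.Lmodule.on Mh.
(* The index 0 : 'I_2 is m = -1/2 and 1 : 'I_2 is m = +1/2. *)
Definition Mh_X (i j : 'I_2) : Mh := \pi_Mh (fps_cst (letter C (i, j))).
Definition det_q : Mh :=
  Mh_X 0 0 * Mh_X 1 1 - qexp (1 : C) *: (Mh_X 0 1 * Mh_X 1 0).

(* C[a,b,c,d] with a, b, c, d the variables 0, 1, 2, 3. *)
Definition X0 := mpoly 4 C.
HB.instance Definition _ := GRing.ComAlgebra.on X0.
HB.instance Definition _ := PzAlgebra.on X0.
Definition X0_X (i j : 'I_2) : X0 := 'X_(inord (2 * i + j)%N).
Definition det_0 : X0 := X0_X 0 0 * X0_X 1 1 - X0_X 0 1 * X0_X 1 0.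

(* The limit hbar -> 0, again computed on a representative. *)
Definition Mh_lim (x : Mh) : X0 :=
  wsum id (fun w => \prod_(g <- w) X0_X g.1 g.2) (repr x 0%N).

Record is_module (L : pzRingType) (A : pzAlgType L) (M : lmodType L)
    (act : A -> M -> M) : Prop := IsModule {
  act_linear : forall g, linear (act g);
  act_add : forall g h x, act (g + h) x = act g x + act h x;
  act_scal : forall (c : L) x, act (scal c) x = c *: x;
  act_mul : forall g h x, act (g * h) x = act g (act h x)
}.

Notation so4 := UU.
Notation so4h := UUh.

(* The tensor product coproduct: the two factors of so4h = Uh (x) Uh are sent to
   the legs 1,3 and 2,4 of so4h (x) so4h. *)
Definition so4h_Delta (t : so4h) : ctens so4h so4h :=
  hpres_lift_quot (fun s : (Uh + Uh)%type =>
    match s with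
    | inl g => ctmap (@ctensl _ Uh Uh) (@ctensl _ Uh Uh) (Uh_Delta g)
    | inr g => ctmap (@ctensr _ Uh Uh) (@ctensr _ Uh Uh) (Uh_Delta g)
    end) t.

Definition so4h_eps : so4h -> {fps C} :=
  ctlift (V := C^o) (fun g g' => Uh_eps g * Uh_eps g' : {fps C}).

(* [act2 t x y] is the product of the two factors of [t |> (x (x) y)]; it is
   determined by its values on [t = g (x) h] because linear maps are
   hbar-adically continuous. *)
Record is_Mh_action (act : so4h -> Mh -> Mh) : Prop := IsMhAction {
  Mh_module : is_module act;
  Mh_act_one : forall g, act g 1 = scal (so4h_eps g);
  Mh_act_mul : exists act2 : ctens so4h so4h -> Mh -> Mh -> Mh,
    [/\ forall x y, linear (fun t => act2 t x y),
        forall g h x y, act2 (ctpure g h) x y = act g x * act h y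
      & forall g x y, act g (x * y) = act2 (so4h_Delta g) x y];
  Mh_act_X : forall (g g' : Uh) (i i' : 'I_2),
    act (ctpure g g') (Mh_X i i')
    = \sum_(k < 2) \sum_(k' < 2)
        (rhoh_coef (n := 1) g k i * rhoh_coef (n := 1) g' k' i') *: Mh_X k k'
}.

(* [T n i i'] is T^(j,j)_(m m'). *)
Definition is_T (act : so4h -> Mh -> Mh)
    (T : forall n, 'I_n.+1 -> 'I_n.+1 -> Mh) : Prop :=
  (forall n, T n ord_max ord_max = Mh_X 1 1 ^+ n) /\
  (forall n (g g' : Uh) (i i' : 'I_n.+1),
    act (ctpure g g') (T n i i')
    = \sum_(k < n.+1) \sum_(k' < n.+1)
        (rhoh_coef g k i * rhoh_coef g' k' i') *: T n k k').

Definition T_lim (T : forall n, 'I_n.+1 -> 'I_n.+1 -> Mh) n (i i' : 'I_n.+1) : X0 :=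
  Mh_lim (T n i i').

Record is_so4_action (T : forall n, 'I_n.+1 -> 'I_n.+1 -> Mh)
    (act0 : so4 -> X0 -> X0) : Prop := IsSo4Action {
  so4_module : is_module act0;
  so4_act_T : forall (g g' : U) (k n : nat) (i i' : 'I_n.+1),
    act0 (tpure g g') (det_0 ^+ k * T_lim T i i')
    = \sum_(l < n.+1) \sum_(l' < n.+1)
        (rho n g l i * rho n g' l' i') *: (det_0 ^+ k * T_lim T l l')
}.

Definition is_basis (V : lmodType C) (I : eqType) (b : I -> V) : Prop :=
  (forall (s : seq I) (c : I -> C), uniq s ->
     \sum_(i <- s) c i *: b i = 0 -> forall i, i \in s -> c i = 0) /\
  (forall v, exists (s : seq I) (c : I -> C), v = \sum_(i <- s) c i *: b i).

(* The identification of [Mh] with X0[[hbar]] along the bases. *)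
Record is_identification (T : forall n, 'I_n.+1 -> 'I_n.+1 -> Mh)
    (phi : Mh -> {fps X0}) : Prop := IsIdentification {
  phi_basis : is_basis (fun e : {n : nat & (nat * 'I_n.+1 * 'I_n.+1)%type} =>
    let: (k, i, i') := tagged e in det_0 ^+ k * T_lim T i i');
  phi_linear : linear phi;
  phi_bij : bijective phi;
  phi_T : forall (k n : nat) (i i' : 'I_n.+1),
    phi (det_q ^+ k * T n i i') = fps_cst (det_0 ^+ k * T_lim T i i')
}.

Definition mu_h (phi : Mh -> {fps X0}) (x y : {fps X0}) : {fps X0} :=
  phi (inverse_map phi x * inverse_map phi y).

Definition mu_0 : {fps tens X0 X0} -> {fps X0} :=
  fps_map (tlift (fun x y : X0 => x * y)).

(* Legs 1,2 of so4 (x) so4 act on the first factor, legs 3,4 on the second. *)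
Definition act_tens (act0 : so4 -> X0 -> X0) :
    {fps tens so4 so4} -> {fps tens X0 X0} -> {fps tens X0 X0} :=
  fps_bil (fun p t =>
    tlift (fun g g' => tmap (act0 g) (act0 g') t) p).

(* F_13 F_24 *)
Definition so4_twist (F : {fps UU}) : {fps tens so4 so4} :=
  fps_map (tmap (@tensl _ U U) (@tensl _ U U)) F * fps_map (tmap (@tensr _ U U) (@tensr _ U U)) F.

End Su2.

Notation so4 := UU.
Notation so4h := UUh.

(* Main.v *)
(* Both products are compared on the basis det^k T_{mm'}.

   Let operators L_{ij} on X[[hbar]] be given on the basis by the formula for the
   product X_{ij} (det^k T_{mm'}).  Composites of such operators reduce to single
   sums by the recoupling identity: for a fixed total spin, products of
   Clebsch-Gordan coefficients summed over the intermediate spin do not depend on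
   the bracketing of the three spins, because both sums are the same equivariant
   projection (the 6j-symbols of the primed and unprimed indices cancel).  So the
   L_{ij} satisfy the relations of M_hbar(2), which therefore acts on X[[hbar]]; by
   T_{n+1} = (X T_n)_{n+1} the action of T_{mm'} is again given by the product
   formula, and the orbit map of 1 is the identification.  This gives the product
   formula for mu_hbar, and its constant coefficient gives the one for mu.

   In the representation on a pair of spins F_s is the matrix product of C_q with
   the transpose of C, both orthogonal.  Hence F_s^{-1}, applied in the legs 13 and
   24, turns the coefficients C C of mu into the coefficients C_q C_q of mu_hbar. *)

From HB Require Import structures.
Require Import Defs.
From mathcomp Require Import all_boot all_order all_algebra.
From mathcomp Require Import generic_quotient.
From mathcomp Require Import boolp classical_sets reals.
From mathcomp Require Import complex.
From mathcomp Require Import finmap monalg.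
From mathcomp Require mpoly.
From mathcomp Require Import ring zify.

Set Implicit Arguments.
Unset Strict Implicit.
Unset Printing Implicit Defensive.

Import Order.TTheory GRing.Theory Num.Theory.
Local Open Scope quotient_scope.
Local Open Scope ring_scope.

(** The maps of the setting are evaluated on chosen representatives, so linearity and
    multiplicativity have to be earned by checking relations. For [Uh] and its coproduct this is
    done in matrices over C[[hbar]]: there q - q^-1, which is no unit, can still be cancelled, and
    the coproduct is only ever seen through pairs of spin representations. Linear maps into a
    separated module are automatically hbar-adically continuous, hence determined by words, pure
    tensors or basis vectors.

    Equivariance is exploited through weights and the lowering operator: a matrix that preserves
    weights and commutes with the lowering matrices is zero or a scalar, since the lowering
    coefficients are units of C[[hbar]]. The group-like factor in the coproduct of F becomes a
    function of the weight, so coassociativity becomes additivity of weights.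

    The product of [Mh] is known only through its relations, while [phi] is merely a linear
    bijection; hence the detour over an action. The relations come down to the coupling of two spins
    1/2, where the singlet produces the determinant. *)

Section Slin.
Variables (K : pzRingType).
Implicit Types A B D : pzAlgType K.

(** Linearity is phrased through the structure map [scal], because a [pzAlgType] carries no scaling
    operation of its own. *)
Definition slin A B (f : A -> B) :=
  forall c x y, f (scal c * x + y) = scal c * f x + f y.

Definition ahom A B (f : A -> B) :=
  [/\ slin f, {morph f : x y / x * y} & f 1 = 1].

Section Theory.
Variables (A B : pzAlgType K) (f : A -> B).
Hypothesis f_lin : slin f.

Lemma slinD : {morph f : x y / x + y}.
Proof. by move=> x y; have := f_lin 1 x y; rewrite !scal1 !mul1r. Qed.
Lemma slin0 : f 0 = 0.
Proof. by apply: (@addrI _ (f 0)); rewrite -slinD !addr0. Qed.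
Lemma slinZ c x : f (scal c * x) = scal c * f x.
Proof. by have := f_lin c x 0; rewrite !addr0 slin0 addr0. Qed.
Lemma slinN : {morph f : x / - x}.
Proof.
by move=> x; apply: (@addrI _ (f x)); rewrite -slinD !subrr slin0.
Qed.
Lemma slinB : {morph f : x y / x - y}.
Proof. by move=> x y; rewrite slinD slinN. Qed.
Lemma slin_sum I (r : seq I) (P : pred I) (F : I -> A) :
  f (\sum_(i <- r | P i) F i) = \sum_(i <- r | P i) f (F i).
Proof. exact: (big_morph f slinD slin0). Qed.
End Theory.

Lemma slinP A B (f : A -> B) :
  {morph f : x y / x + y} -> (forall c x, f (scal c * x) = scal c * f x) -> slin f.
Proof. by move=> fD fZ c x y; rewrite fD fZ. Qed.

Lemma slin_comp A B D (f : A -> B) (g : B -> D) :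
  slin f -> slin g -> slin (g \o f).
Proof. by move=> f_lin g_lin c x y /=; rewrite f_lin g_lin. Qed.

Lemma slin_scal A B (f : A -> B) c : slin f -> slin (fun x => scal c * f x).
Proof.
move=> f_lin d x y; rewrite f_lin mulrDr !mulrA; congr (_ * _ + _).
by rewrite scal_central.
Qed.

Lemma slin_mulr A (a : A) : slin (fun x => x * a).
Proof. by move=> c x y; rewrite mulrDl mulrA. Qed.
Lemma slin_mull A (a : A) : slin (fun x => a * x).
Proof. by move=> c x y; rewrite mulrDr mulrA -scal_central mulrA. Qed.
Lemma slin_id A : slin (fun x : A => x). Proof. by []. Qed.

Lemma ahom_comp A B D (f : A -> B) (g : B -> D) :
  ahom f -> ahom g -> ahom (g \o f).
Proof.
move=> [f_lin fM f1] [g_lin gM g1]; split; first exact: slin_comp.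
  by move=> x y /=; rewrite fM gM.
by rewrite /= f1.
Qed.

Lemma ahom_scal A B (f : A -> B) c : ahom f -> f (scal c) = scal c.
Proof. by case=> f_lin _ f1; rewrite -[scal c]mulr1 slinZ // f1 mulr1. Qed.

Lemma ahom_prod A B (f : A -> B) I (r : seq I) (F : I -> A) : ahom f ->
  f (\prod_(i <- r) F i) = \prod_(i <- r) f (F i).
Proof. by case=> _ fM f1; exact: (big_morph f fM f1). Qed.

End Slin.

Lemma slin_eqD (K : pzRingType) (A B : pzAlgType K) (f g : A -> B) :
  slin f -> slin g -> slin (fun x => f x - g x).
Proof.
by move=> fl gl c x y; rewrite fl gl mulrBr opprD addrACA.
Qed.

(** * The hbar-adic topology and automatic continuity of linear maps *)

Section FpsTopology.
Variable K : comPzRingType.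

(** The formal parameter hbar itself. *)
Definition fps_h : {fps K} := Fps (fun n => (n == 1%N)%:R).
Definition fps_shift (A : Type) N (x : {fps A}) : {fps A} := Fps (fun n => x (n + N)%N).

Lemma fps_cst0 (A : zmodType) : fps_cst (0 : A) = 0.
Proof. by apply: fpsP => -[]. Qed.
Lemma fps_cstD (A : zmodType) : {morph @fps_cst A : x y / x + y}.
Proof. by move=> x y; apply: fpsP => -[|n]; rewrite fps_coefD //= addr0. Qed.
Lemma fps_cstN (A : zmodType) : {morph @fps_cst A : x / - x}.
Proof. by move=> x; apply: fpsP => -[|n]; rewrite fps_coefN //= oppr0. Qed.
Lemma fps_cst_sum (A : zmodType) I (r : seq I) (P : pred I) (F : I -> A) :
  fps_cst (\sum_(i <- r | P i) F i) = \sum_(i <- r | P i) fps_cst (F i).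
Proof. exact: (big_morph (@fps_cst A) (@fps_cstD A) (fps_cst0 A)). Qed.
Lemma fps_coef_sum (A : zmodType) I (r : seq I) (P : pred I) (F : I -> {fps A}) n :
  (\sum_(i <- r | P i) F i) n = \sum_(i <- r | P i) F i n.
Proof. by rewrite (big_morph (fun x : {fps A} => x n) (id1 := 0) (op1 := +%R)). Qed.

Lemma fps_coef_cstM (A : pzRingType) (a : A) (x : {fps A}) n : (fps_cst a * x) n = a * x n.
Proof.
rewrite fps_coefM big_ord_recl /= subn0 big1 ?addr0 // => i _.
by rewrite mul0r.
Qed.
Lemma fps_coefM_cst (A : pzRingType) (a : A) (x : {fps A}) n : (x * fps_cst a) n = x n * a.
Proof.
rewrite fps_coefM (convolC (fun i j => x i * fps_cst a j)).
rewrite big_ord_recl /= subn0 big1 ?addr0 // => i _.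
by rewrite mulr0.
Qed.
Lemma fps_cstM (A : pzRingType) : {morph @fps_cst A : x y / x * y}.
Proof.
move=> x y; apply: fpsP => n; rewrite fps_coef_cstM.
by case: n => [|n] //=; rewrite mulr0.
Qed.
Lemma fps_cst_prod (A : pzRingType) I (r : seq I) (F : I -> A) :
  fps_cst (\prod_(i <- r) F i) = \prod_(i <- r) fps_cst (F i).
Proof. exact: (big_morph (@fps_cst A) (@fps_cstM A) erefl). Qed.

Lemma fps_scal_cst (A : pzAlgType K) c : scal (fps_cst c) = fps_cst (scal c) :> {fps A}.
Proof. by apply: fpsP => -[|n] //=; rewrite scal0. Qed.

Lemma fps_scalE (A : pzAlgType K) (c : {fps K}) (x : {fps A}) n :
  (scal c * x) n = \sum_(k < n.+1) scal (c k) * x (n - k)%N.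
Proof. by []. Qed.

Lemma fps_coef_h (A : pzAlgType K) (x : {fps A}) n :
  (scal fps_h * x) n = if n is m.+1 then x m else 0.
Proof.
rewrite fps_scalE big_ord_recl /= scal0 mul0r add0r.
case: n => [|n]; first by rewrite big_ord0.
rewrite big_ord_recl /= scal1 mul1r subSS subn0 big1 ?addr0 // => i _.
by rewrite /= scal0 mul0r.
Qed.

Lemma fps_coef_hX (A : pzAlgType K) (x : {fps A}) N n :
  (scal (fps_h ^+ N) * x) n = if (n < N)%N then 0 else x (n - N)%N.
Proof.
elim: N n => [|N IHN] n; first by rewrite expr0 scal1 mul1r subn0.
rewrite exprS scalM -mulrA fps_coef_h.
by case: n => [|n] //; rewrite IHN ltnS subSS.
Qed.

(** Taylor expansion with remainder. A linear map pulls hbar^N out of the remainder, so modulo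
    hbar^N it depends on finitely many constants only. *)
Lemma fps_split (A : pzAlgType K) (x : {fps A}) N :
  x = \sum_(k < N) scal (fps_h ^+ k) * fps_cst (x k)
      + scal (fps_h ^+ N) * fps_shift N x.
Proof.
apply: fpsP => n; rewrite fps_coefD fps_coef_sum fps_coef_hX.
case: ltnP => nN; last first.
  rewrite big1 ?add0r; last first.
    move=> k _; rewrite fps_coef_hX; case: ltnP => // kn.
    rewrite -(subnSK (leq_trans (ltn_ord k) nN)) //.
  by rewrite /= subnK.
rewrite addr0 (bigD1 (Ordinal nN)) // fps_coef_hX ltnn subnn big1 => [|k /eqP kn].
  by rewrite /= addr0.
rewrite fps_coef_hX; case: ltnP => // kn'.
case: (leqP n k) => [nk|kn2]; last by rewrite -(subnSK kn2).
by case: kn; apply: val_inj; apply/eqP; rewrite /= eqn_leq nk kn'.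
Qed.

(** The hbar-adic topology on [W] is Hausdorff: the intersection of all hbar^N W is zero. *)
Definition separated (W : pzAlgType {fps K}) :=
  forall w : W, (forall N, exists w', w = scal (fps_h ^+ N) * w') -> w = 0.

Lemma separated_fps (A : pzAlgType K) : separated {fps A}.
Proof.
move=> w wP; apply: fpsP => n; have [w' ->] := wP n.+1.
by rewrite fps_coef_hX ltnSn.
Qed.

(** By [fps_split] the value at [x] is hbar^N times the value at the remainder, for every N.
    Continuity is thus a consequence of linearity over power series. *)
Lemma slin_fps0 (A : pzAlgType K) (W : pzAlgType {fps K}) (f : {fps A} -> W) :
  separated W -> slin f -> (forall a, f (fps_cst a) = 0) -> forall x, f x = 0.
Proof.
move=> W_sep f_lin f0 x; apply: W_sep => N.
exists (f (fps_shift N x)); rewrite {1}(fps_split x N) slinD // slinZ //.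
rewrite slin_sum // big1 ?add0r // => k _.
by rewrite slinZ // f0 mulr0.
Qed.

Lemma slin_fps_eq (A : pzAlgType K) (W : pzAlgType {fps K}) (f g : {fps A} -> W) :
  separated W -> slin f -> slin g -> (forall a, f (fps_cst a) = g (fps_cst a)) ->
  f =1 g.
Proof.
move=> W_sep f_lin g_lin fg x; apply/eqP; rewrite -subr_eq0; apply/eqP.
apply: (slin_fps0 (f := fun x => f x - g x)) => //; first exact: slin_eqD.
by move=> a; rewrite fg subrr.
Qed.

Lemma slin_coef (A B : pzAlgType K) (f : {fps A} -> {fps B}) x n :
  slin f -> f x n = \sum_(k < n.+1) f (fps_cst (x k)) (n - k)%N.
Proof.
move=> f_lin; rewrite {1}(fps_split x n.+1) slinD // slinZ // fps_coefD.
rewrite fps_coef_hX ltnSn addr0 slin_sum // fps_coef_sum.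
apply: eq_bigr => k _; rewrite slinZ // fps_coef_hX ltnNge -ltnS ltn_ord //=.
Qed.

(** An element of the closure differs from one of [I] by hbar^N times a series, so its value is
    divisible by every power of hbar. *)
Lemma slin_closure (A : pzAlgType K) (W : pzAlgType {fps K}) (I : ideal {fps A})
    (f : {fps A} -> W) :
  separated W -> slin f -> (forall x, I x -> f x = 0) ->
  forall x, ideal_closure I x -> f x = 0.
Proof.
move=> W_sep f_lin fI x Ix; apply: W_sep => N; have [y Iy xy] := Ix N.
exists (f (fps_shift N (x - y))); rewrite -slinZ // -[LHS]subr0 -(fI y) //.
rewrite -slinB //; congr f; rewrite {1}(fps_split (x - y) N) big1 ?add0r //.
by move=> k _; rewrite fps_coefD fps_coefN xy // subrr fps_cst0 mulr0.
Qed.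

Lemma slin_fps_map (A B : pzAlgType K) (f : A -> B) : slin f -> slin (fps_map f).
Proof.
move=> f_lin; apply: slinP => [x y|c x]; apply: fpsP => n.
  by rewrite fps_coefD; exact: slinD.
rewrite [LHS]/= fps_scalE [in LHS]slin_sum //; apply: eq_bigr => k _.
by rewrite slinZ.
Qed.

Lemma ahom_fps_map (A B : pzAlgType K) (f : A -> B) : ahom f -> ahom (fps_map f).
Proof.
case=> f_lin fM f1; split; first exact: slin_fps_map.
  move=> x y; apply: fpsP => n; rewrite fps_coefM [LHS]/= [in LHS]slin_sum //.
  by apply: eq_bigr => k _; rewrite fM.
by apply: fpsP => -[|n] //=; rewrite slin0.
Qed.

Lemma fps_map_cst (A B : zmodType) (f : A -> B) a : f 0 = 0 ->
  fps_map f (fps_cst a) = fps_cst (f a).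
Proof. by move=> f0; apply: fpsP => -[]. Qed.

End FpsTopology.

(** * Presented algebras and tensor products *)

Section Words.
Variables (K : comNzRingType) (G : choiceType).
Local Notation free := (free_alg K G).
Implicit Types (s : seq G) (p : free).

Definition word s : free := \prod_(g <- s) letter K g.

Lemma word_cat s1 s2 : word (s1 ++ s2) = word s1 * word s2.
Proof. exact: big_cat. Qed.

Lemma word1 g : word [:: g] = letter K g.
Proof. exact: big_seq1. Qed.

Lemma malg_word (m : {fmonom G}) : << m >> = word m :> free.
Proof.
case: m => s; rewrite /word; elim: s => [|g s IHs].
  by rewrite big_nil -fmoneE.
rewrite big_cons -IHs; apply/esym; rewrite [LHS]fgmulUU mulr1; congr << _ *g _ >>.
by rewrite fmuE [LHS]fmmulE.
Qed.

Lemma free_scalE (c : K) p : scal c * p = c *: p.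
Proof. by rewrite -scalerAl mul1r. Qed.

Lemma free_wordE p : p = \sum_(m <- msupp p) scal p@_m * word m.
Proof.
rewrite {1}[p]monalgE; apply: eq_bigr => m _; rewrite free_scalE -malg_word.
by apply/malgP => k; rewrite mcoeffZ !mcoeffU mulr_natr.
Qed.

Section Wsum.
Variables (V : pzAlgType K) (phi : seq G -> V).

Lemma wsumEw (d : {fset {fmonom G}}) p : (msupp p `<=` d)%fset ->
  wsum id phi p = \sum_(m <- d) scal p@_m * phi m.
Proof.
move=> pd; rewrite /wsum (big_fset_incl _ pd) // => m _ mp.
by rewrite (mcoeff_outdom mp) scal0 mul0r.
Qed.

Lemma wsum_slin : slin (wsum id phi).
Proof.
move=> c p r.
(* A common finite support lets the three sums run over the same words; the added terms have
   coefficient zero. *)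
pose d := (msupp (scal c * p + r) `|` msupp p `|` msupp r)%fset.
rewrite (@wsumEw d) ?(@wsumEw d p) ?(@wsumEw d r); first last.
- by rewrite /d -fsetUA fsubsetUl.
- by rewrite /d fsetUAC fsubsetUr.
- by rewrite /d fsubsetUr.
rewrite mulr_sumr -big_split /=; apply: eq_bigr => m _.
by rewrite free_scalE mcoeffD mcoeffZ scalD scalM mulrDl mulrA.
Qed.

Lemma wsum_word s : wsum id phi (word s) = phi s.
Proof.
have -> : word s = << FMonom s >> :> free by rewrite malg_word.
rewrite /wsum msuppU oner_eq0 big_seq_fset1 mcoeffUU scal1.
exact: mul1r.
Qed.

End Wsum.

Lemma slin_free0 (V : pzAlgType K) (f : free -> V) :
  slin f -> (forall s, f (word s) = 0) -> forall p, f p = 0.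
Proof.
move=> f_lin f0 p; rewrite [p]free_wordE slin_sum // big1 // => m _.
by rewrite slinZ // f0 mulr0.
Qed.

Lemma slin_free_eq (V : pzAlgType K) (f g : free -> V) :
  slin f -> slin g -> (forall s, f (word s) = g (word s)) -> f =1 g.
Proof.
move=> fl gl fg p; apply/eqP; rewrite -subr_eq0; apply/eqP.
apply: (slin_free0 (f := fun p => f p - g p)); first exact: slin_eqD.
by move=> s; rewrite fg subrr.
Qed.

Definition hword s : {fps free} := fps_cst (word s).

Lemma hword_cat s1 s2 : hword (s1 ++ s2) = hword s1 * hword s2.
Proof. by rewrite /hword word_cat fps_cstM. Qed.
Lemma hword_prod s : hword s = \prod_(g <- s) fps_cst (letter K g).
Proof. exact: fps_cst_prod. Qed.

Lemma slin_hfree0 (W : pzAlgType {fps K}) (f : {fps free} -> W) :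
  separated W -> slin f -> (forall s, f (hword s) = 0) -> forall x, f x = 0.
Proof.
move=> W_sep f_lin f0; apply: slin_fps0 => // p.
rewrite [p]free_wordE fps_cst_sum slin_sum // big1 // => m _.
by rewrite fps_cstM -fps_scal_cst slinZ // f0 mulr0.
Qed.

Lemma slin_hfree_eq (W : pzAlgType {fps K}) (f g : {fps free} -> W) :
  separated W -> slin f -> slin g -> (forall s, f (hword s) = g (hword s)) ->
  f =1 g.
Proof.
move=> W_sep fl gl fg x; apply/eqP; rewrite -subr_eq0; apply/eqP.
apply: (slin_hfree0 (f := fun x => f x - g x)) => //; first exact: slin_eqD.
by move=> s; rewrite fg subrr.
Qed.

Section Hwsum.
Variables (V : pzAlgType K) (phi : seq G -> {fps V}).

Lemma hwsum_slin : slin (hwsum id phi).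
Proof.
apply: slinP => [x y|c x]; apply: fpsP => n.
  rewrite fps_coefD -big_split; apply: eq_bigr => k _.
  by rewrite fps_coefD slinD //; exact: wsum_slin.
rewrite fps_scalE.
transitivity (\sum_(k < n.+1) \sum_(i < k.+1)
    scal (c i) * wsum id (fun w => phi w (n - k)%N) (x (k - i)%N)).
  apply: eq_bigr => k _; rewrite fps_scalE slin_sum; last exact: wsum_slin.
  by apply: eq_bigr => i _; rewrite slinZ //; exact: wsum_slin.
rewrite (convolA (fun i j k => scal (c i) * wsum id (fun w => phi w k) (x j))).
by apply: eq_bigr => i _; rewrite mulr_sumr.
Qed.

Lemma hwsum_word s : hwsum id phi (hword s) = phi s.
Proof.
apply: fpsP => n; rewrite [LHS]/= big_ord_recl big1 => [|i _].
  by rewrite subn0 wsum_word addr0.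
by apply: slin0; exact: wsum_slin.
Qed.

End Hwsum.

End Words.

Section IdealLifts.
Variables (A : pzRingType) (S : A -> Prop).

Lemma ideal_gen0 (W : zmodType) (f : A -> W) :
  {morph f : x y / x + y} -> (forall a b r, S r -> f (a * r * b) = 0) ->
  forall x, ideal_gen S x -> f x = 0.
Proof.
move=> fD fS x Sx.
have f0 : f 0 = 0 by apply: (@addrI _ (f 0)); rewrite -fD !addr0.
(* Since [f] is only additive, the induction over the generated two-sided ideal has to carry
   arbitrary factors on both sides. *)
suff: forall a b, f (a * x * b) = 0 by move/(_ 1 1); rewrite mul1r mulr1.
elim: Sx => [r Sr||y z _ IHy _ IHz|c y _ IHy|c y _ IHy] a b //.
- exact: fS.
- by rewrite mulr0 mul0r.
- by rewrite mulrDr mulrDl fD IHy IHz addr0.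
- by rewrite mulrA IHy.
- by rewrite mulrA -mulrA IHy.
Qed.

End IdealLifts.

Section PresentedLift.
Variables (K : comNzRingType) (G : choiceType).

Section Plain.
Variables (S : free_alg K G -> Prop) (V : pzAlgType K).
Local Notation P := (presented S).

(** This is what makes a map given on representatives well defined: the chosen representative
    differs from [x] by an element of the ideal, and by linearity the two factors around a relation
    may be taken to be words. *)
Lemma repr_presented (f : free_alg K G -> V) x : slin f ->
  (forall s t r, S r -> f (word K s * r * word K t) = 0) -> f (repr (\pi_P x)) = f x.
Proof.
move=> fl fS; apply/eqP; rewrite -subr_eq0 -slinB //; apply/eqP.
apply: (ideal_gen0 (S := S) (f := f)) (@quot_repr _ (ideal_gen S) x).
  exact: slinD.
move=> a b r Sr.
apply: (slin_free0 (f := fun a => f (a * r * b)) _ _ a) => [|s].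
  exact: slin_comp (slin_comp (slin_mulr r) (slin_mulr b)) fl.
apply: (slin_free0 (f := fun b => f (word K s * r * b)) _ _ b) => [|t].
  exact: slin_comp (slin_mull _) fl.
exact: fS.
Qed.

Lemma presented_slin0 (f : P -> V) : slin f ->
  (forall s, f (\pi_P (word K s)) = 0) -> forall x, f x = 0.
Proof.
move=> fl f0; elim/quotW => x.
apply: (slin_free0 (f := f \o \pi_P)) => // c y z /=.
by rewrite piD piM fl.
Qed.

End Plain.

Section Adic.
Variables (S : {fps free_alg K G} -> Prop) (W : pzAlgType {fps K}).
Hypothesis W_sep : separated W.
Local Notation P := (hpresented S).

(** The ideal of an hbar-adic presentation is closed up; separatedness of the target carries the
    vanishing over to the closure. *)
Lemma closure_gen0 (f : {fps free_alg K G} -> W) x : slin f ->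
  (forall s t r, S r -> f (hword K s * r * hword K t) = 0) ->
  ideal_closure (ideal_gen S) x -> f x = 0.
Proof.
move=> fl fS; apply: slin_closure => // {}x; apply: (ideal_gen0 (S := S)).
  exact: slinD.
move=> a b r Sr.
apply: (slin_hfree0 W_sep (f := fun a => f (a * r * b)) _ _ a) => [|s].
  exact: slin_comp (slin_comp (slin_mulr r) (slin_mulr b)) fl.
apply: (slin_hfree0 W_sep (f := fun b => f (hword K s * r * b)) _ _ b) => [|t].
  exact: slin_comp (slin_mull _) fl.
exact: fS.
Qed.

Lemma repr_hpresented (f : {fps free_alg K G} -> W) x : slin f ->
  (forall s t r, S r -> f (hword K s * r * hword K t) = 0) ->
  f (repr (\pi_P x)) = f x.
Proof.
move=> fl fS; apply/eqP; rewrite -subr_eq0 -slinB //; apply/eqP.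
apply: closure_gen0 => //.
exact: (@quot_repr _ (ideal_closure (ideal_gen S)) x).
Qed.

Lemma hpresented_slin0 (f : P -> W) : slin f ->
  (forall s, f (\pi_P (hword K s)) = 0) -> forall x, f x = 0.
Proof.
move=> fl f0; elim/quotW => x.
apply: (slin_hfree0 W_sep (f := f \o \pi_P)) => // c y z /=.
by rewrite piD piM fl.
Qed.

Lemma pi_hpresented_ahom : ahom (fun x => \pi_P x : P).
Proof. by split=> [c x y|x y|//]; rewrite ?piD piM. Qed.

End Adic.

Lemma pi_presented_ahom (S : free_alg K G -> Prop) :
  ahom (fun x => \pi_(presented S) x : presented S).
Proof. by split=> [c x y|x y|//]; rewrite ?piD piM. Qed.

End PresentedLift.

Section Legs.
Variables A B : pzRingType.
Implicit Types (s t : seq (A + B)).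

Lemma wleft_cat s t : wleft (s ++ t) = wleft s * wleft t.
Proof. exact: big_cat. Qed.
Lemma wright_cat s t : wright (s ++ t) = wright s * wright t.
Proof. exact: big_cat. Qed.
Lemma wleft_inl a s : wleft (inl a :: s) = a * wleft s.
Proof. exact: big_cons. Qed.
Lemma wleft_inr b s : wleft (inr b :: s) = wleft s.
Proof. by rewrite /wleft big_cons mul1r. Qed.
Lemma wright_inl a s : wright (inl a :: s) = wright s.
Proof. by rewrite /wright big_cons mul1r. Qed.
Lemma wright_inr b s : wright (inr b :: s) = b * wright s.
Proof. exact: big_cons. Qed.
Lemma wleft_nil : wleft ([::] : seq (A + B)) = 1.
Proof. exact: big_nil. Qed.
Lemma wright_nil : wright ([::] : seq (A + B)) = 1.
Proof. exact: big_nil. Qed.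
Definition legsE := (wleft_cat, wright_cat, wleft_inl, wleft_inr, wright_inl,
  wright_inr, wleft_nil, wright_nil, mulr1, mul1r).
End Legs.

Section TensorWords.
Variables (L : comPzRingType) (A B R V : pzAlgType L).
Variable W : seq (A + B) -> R.
Hypothesis W_cat : forall s t, W (s ++ t) = W s * W t.
Local Notation l := (fun a : A => W [:: inl a]).
Local Notation r := (fun b : B => W [:: inr b]).

(** Between two words [s] and [t], a tensor relation changes the products of the left and of the
    right letters only in ways that a bilinear [f] does not see; the commutation relation changes
    neither product. [W] is kept abstract to cover both plain words and words as constant power
    series. *)
Lemma tensor_rel_kill (f : A -> B -> V) (Phi : R -> V) s t x :
  (forall b, slin (f^~ b)) -> (forall a, slin (f a)) -> slin Phi ->
  (forall u, Phi (W u) = f (wleft u) (wright u)) ->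
  tensor_rel l r x -> Phi (W s * x * W t) = 0.
Proof.
move=> fl fr Pl PW rx.
pose M x := Phi (W s * x * W t).
have M_lin : slin M.
  by move=> c y z; rewrite /M -Pl mulrDr mulrDl !mulrA (scal_central c).
have MW u : M (W u) = f (wleft s * wleft u * wleft t) (wright s * wright u * wright t).
  by rewrite /M -!W_cat PW !legsE.
have M1 : M 1 = f (wleft s * wleft t) (wright s * wright t).
  by rewrite /M mulr1 -W_cat PW !legsE.
rewrite -/(M x); case: {x}rx => [a a'|b b'|a a'|b b'|c|c|a b];
  rewrite (slinB M_lin) ?(slinD M_lin) -?W_cat ?MW ?legsE.
- by rewrite mulrDr mulrDl (slinD (fl _)) subrr.
- by rewrite mulrDr mulrDl (slinD (fr _)) subrr.
- by rewrite subrr.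
- by rewrite subrr.
- rewrite -[scal c in X in _ - X]mulr1 (slinZ M_lin) M1.
  by rewrite -scal_central -mulrA (slinZ (fl _)) subrr.
- rewrite -[scal c in X in _ - X]mulr1 (slinZ M_lin) M1.
  by rewrite -scal_central -mulrA (slinZ (fr _)) subrr.
- by rewrite subrr.
Qed.
End TensorWords.

Lemma ahomI (K : pzRingType) (A B : pzAlgType K) (f : A -> B) :
  {morph f : x y / x + y} -> {morph f : x y / x * y} ->
  (forall c, f (scal c) = scal c) -> ahom f.
Proof.
move=> fD fM fC; split=> //; first by move=> c x y; rewrite fD fM fC.
by rewrite -(scal1 (s := A)) fC scal1.
Qed.

Lemma mulr_comm4 (R : pzRingType) (a b a' b' : R) :
  a' * b = b * a' -> a * b * (a' * b') = a * a' * (b * b').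
Proof. by move=> ab; rewrite -mulrA (mulrA b) -ab !mulrA. Qed.

Section CommutingLegs.
Variables (L : pzRingType) (A B Q : pzAlgType L) (l : A -> Q) (r : B -> Q).
Hypotheses (lh : ahom l) (rh : ahom r).
Hypothesis comm : forall a b, l a * r b = r b * l a.

Lemma legs1 : l 1 * r 1 = 1.
Proof. by have [_ _ ->] := lh; have [_ _ ->] := rh; rewrite mulr1. Qed.

Lemma legsM a a' b b' : l a * r b * (l a' * r b') = l (a * a') * r (b * b').
Proof.
have [_ -> _] := lh; have [_ -> _] := rh; exact: mulr_comm4.
Qed.

Lemma legs_prod (s : seq (A + B)) :
  \prod_(x <- s) (match x with inl a => l a | inr b => r b end)
  = l (wleft s) * r (wright s).
Proof.
elim: s => [|[a|b] s IHs]; first by rewrite big_nil !legsE legs1.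
  by rewrite big_cons IHs !legsE; have [_ -> _] := lh; rewrite mulrA.
rewrite big_cons IHs !legsE; have [_ -> _] := rh.
by rewrite mulrA -comm mulrA.
Qed.

Lemma slin_legl b : slin (fun a => l a * r b).
Proof. by have [lL _ _] := lh; exact: slin_comp lL (slin_mulr _). Qed.
Lemma slin_legr a : slin (fun b => l a * r b).
Proof. by have [rL _ _] := rh; exact: slin_comp rL (slin_mull _). Qed.
End CommutingLegs.

Section Tens.
Variables (K : comNzRingType) (A B : pzAlgType K).
Local Notation T := (tens A B).
Local Notation W := (word K (G := (A + B)%type)).

Lemma tens_relP x :
  tensor_rel (fun a : A => letter K (inl a : A + B)%type)
    (fun b : B => letter K (inr b : A + B)%type) x ->
  tensor_rel (fun a : A => W [:: inl a]) (fun b : B => W [:: inr b]) x.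
Proof.
have -> : (fun a : A => letter K (inl a : A + B)%type) = (fun a => W [:: inl a]).
  by apply: funext => a; rewrite word1.
by have -> : (fun b : B => letter K (inr b : A + B)%type) = (fun b => W [:: inr b]);
  first by apply: funext => b; rewrite word1.
Qed.

Lemma tens_rel_eq x y :
  tensor_rel (fun a : A => letter K (inl a : A + B)%type)
    (fun b : B => letter K (inr b : A + B)%type) (x - y) -> \pi_T x = \pi_T y.
Proof. by move=> rx; apply/eqP/quot_idealP; exact: generated_base. Qed.

Lemma tensl_ahom : ahom (@tensl _ A B).
Proof.
have lD : {morph @tensl _ A B : a a' / a + a'}.
  move=> a a'; rewrite /tensl -piD; apply: tens_rel_eq.
  exact: tensor_relDl.
have lM : {morph @tensl _ A B : a a' / a * a'}.
  move=> a a'; rewrite /tensl -piM; apply: tens_rel_eq.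
  exact: tensor_relMl.
have lC c : tensl B (scal c : A) = scal c.
  by apply: tens_rel_eq; exact: tensor_relCl.
exact: ahomI.
Qed.

Lemma tensr_ahom : ahom (@tensr _ A B).
Proof.
have rD : {morph @tensr _ A B : a a' / a + a'}.
  move=> a a'; rewrite /tensr -piD; apply: tens_rel_eq.
  exact: tensor_relDr.
have rM : {morph @tensr _ A B : a a' / a * a'}.
  move=> a a'; rewrite /tensr -piM; apply: tens_rel_eq.
  exact: tensor_relMr.
have rC c : tensr A (scal c : B) = scal c.
  by apply: tens_rel_eq; exact: tensor_relCr.
exact: ahomI.
Qed.

Lemma tens_comm a b : tensl B a * tensr A b = tensr A b * tensl B a.
Proof.
rewrite /tensl /tensr -!piM; apply: tens_rel_eq.
exact: tensor_rel_comm.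
Qed.

Lemma tpureM (a a' : A) (b b' : B) :
  tpure a b * tpure a' b' = tpure (a * a') (b * b').
Proof. exact: (legsM tensl_ahom tensr_ahom tens_comm). Qed.

Lemma tpure11 : tpure (1 : A) (1 : B) = 1.
Proof. exact: (legs1 tensl_ahom tensr_ahom). Qed.

(** Commuting all left letters to the front. Hence pure tensors span, and linear maps on [tens A B]
    can be compared on them. *)
Lemma pi_tens_word s : \pi_T (W s) = tpure (wleft s) (wright s).
Proof.
rewrite -[RHS](legs_prod tensl_ahom tensr_ahom tens_comm).
rewrite /word (ahom_prod _ _ (pi_presented_ahom _)).
by apply: eq_bigr => -[a|b] _.
Qed.

Lemma slin_tpurel (b : B) : slin (fun a : A => tpure a b).
Proof. exact: slin_legl tensl_ahom b. Qed.
Lemma slin_tpurer (a : A) : slin (fun b : B => tpure a b).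
Proof. exact: slin_legr tensr_ahom a. Qed.

Section Lift.
Variable V : pzAlgType K.

Lemma tens_slin0 (f : T -> V) : slin f -> (forall a b, f (tpure a b) = 0) ->
  forall t, f t = 0.
Proof. by move=> fl f0; apply: presented_slin0 => // s; rewrite pi_tens_word. Qed.

Lemma tens_slin_eq (f g : T -> V) : slin f -> slin g ->
  (forall a b, f (tpure a b) = g (tpure a b)) -> f =1 g.
Proof.
move=> fl gl fg t; apply/eqP; rewrite -subr_eq0; apply/eqP.
apply: (tens_slin0 (f := fun t => f t - g t)); first exact: slin_eqD.
by move=> a b; rewrite fg subrr.
Qed.

Variable f : A -> B -> V.
Hypotheses (fl : forall b, slin (f^~ b)) (fr : forall a, slin (f a)).

Lemma tlift_pi x :
  tlift f (\pi_T x) = wsum id (fun w => f (wleft w) (wright w)) x.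
Proof.
apply: (repr_presented (f := wsum id (fun w => f (wleft w) (wright w)))).
  exact: wsum_slin.
move=> s t r rr; apply: (@tensor_rel_kill K A B (free_alg K (A + B)%type) V W
  (@word_cat K _) f (wsum id (fun w => f (wleft w) (wright w))) s t r fl fr).
- exact: wsum_slin.
- by move=> u; rewrite wsum_word.
- exact: tens_relP.
Qed.

Lemma tlift_slin : slin (tlift f).
Proof.
move=> c; elim/quotW=> x; elim/quotW=> y.
have -> : scal c * \pi_T x + \pi_T y = \pi_T (scal c * x + y) by rewrite piD piM.
by rewrite !tlift_pi wsum_slin.
Qed.

Lemma tlift_pure a b : tlift f (tpure a b) = f a b.
Proof.
have -> : tpure a b = \pi_T (W [:: inl a; inr b]) by rewrite pi_tens_word !legsE.
by rewrite tlift_pi wsum_word !legsE.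
Qed.

End Lift.
End Tens.

Lemma tens_ahom (K : comNzRingType) (A B V : pzAlgType K) (f : tens A B -> V) :
  slin f -> (forall a b a' b', f (tpure (a * a') (b * b')) = f (tpure a b) * f (tpure a' b')) ->
  f 1 = 1 -> ahom f.
Proof.
move=> fl fM f1; split=> // x y.
apply: (tens_slin_eq (f := fun x => f (x * y)) (g := fun x => f x * f y)) => [||a b].
- exact: slin_comp (slin_mulr _) fl.
- exact: slin_comp fl (slin_mulr _).
apply: (tens_slin_eq (f := fun y => f (tpure a b * y))
  (g := fun y => f (tpure a b) * f y)) => //.
- exact: slin_comp (slin_mull _) fl.
- exact: slin_comp fl (slin_mull _).
move=> a' b'; exact: etrans (congr1 f (tpureM a a' b b')) (fM a b a' b').
Qed.

Section Tmap.
Variables (K : comNzRingType) (A B A' B' : pzAlgType K).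
Variables (f : A -> A') (g : B -> B').

Lemma tmap_slin : slin f -> slin g -> slin (tmap f g).
Proof.
move=> fl gl; apply: tlift_slin => [b|a].
  exact: slin_comp fl (slin_tpurel _).
exact: slin_comp gl (slin_tpurer _).
Qed.

Lemma tmap_pure a b : slin f -> slin g -> tmap f g (tpure a b) = tpure (f a) (g b).
Proof.
move=> fl gl; apply: tlift_pure => [b'|a'].
  exact: slin_comp fl (slin_tpurel _).
exact: slin_comp gl (slin_tpurer _).
Qed.

Lemma tmap_ahom : ahom f -> ahom g -> ahom (tmap f g).
Proof.
move=> [fl fM f1] [gl gM g1]; apply: tens_ahom => [|a b a' b'|].
- exact: tmap_slin.
- have E x y := @tmap_pure x y fl gl.
  apply: etrans (E _ _) _; rewrite fM gM.
  exact: etrans (esym (tpureM _ _ _ _)) (esym (congr2 *%R (E a b) (E a' b'))).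
- rewrite -(tpure11 A B) (@tmap_pure 1 1 fl gl) f1 g1; exact: tpure11.
Qed.
End Tmap.

Section Ctens.
Variables (K : fieldType) (A B : pzAlgType {fps K}).
Local Notation T := (ctens A B).
Local Notation W := (hword K (G := (A + B)%type)).

Lemma ctens_relP x :
  tensor_rel (fun a : A => fps_cst (letter K (inl a : A + B)%type))
    (fun b : B => fps_cst (letter K (inr b : A + B)%type)) x ->
  tensor_rel (fun a : A => W [:: inl a]) (fun b : B => W [:: inr b]) x.
Proof.
have -> : (fun a : A => fps_cst (letter K (inl a : A + B)%type)) = (fun a => W [:: inl a]).
  by apply: funext => a; rewrite /hword word1.
by have -> : (fun b : B => fps_cst (letter K (inr b : A + B)%type)) = (fun b => W [:: inr b]);
  first by apply: funext => b; rewrite /hword word1.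
Qed.

Lemma ctens_rel_eq x y :
  tensor_rel (fun a : A => fps_cst (letter K (inl a : A + B)%type))
    (fun b : B => fps_cst (letter K (inr b : A + B)%type)) (x - y) -> \pi_T x = \pi_T y.
Proof.
move=> rx; apply/eqP/quot_idealP => N; exists (x - y) => //.
exact: generated_base.
Qed.

Lemma ctensl_ahom : ahom (@ctensl _ A B).
Proof.
have lD : {morph @ctensl _ A B : a a' / a + a'}.
  move=> a a'; rewrite /ctensl -piD; apply: ctens_rel_eq.
  exact: tensor_relDl.
have lM : {morph @ctensl _ A B : a a' / a * a'}.
  move=> a a'; rewrite /ctensl -piM; apply: ctens_rel_eq.
  exact: tensor_relMl.
have lC c : ctensl B (scal c : A) = scal c.
  by apply: ctens_rel_eq; exact: tensor_relCl.
exact: ahomI.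
Qed.

Lemma ctensr_ahom : ahom (@ctensr _ A B).
Proof.
have rD : {morph @ctensr _ A B : a a' / a + a'}.
  move=> a a'; rewrite /ctensr -piD; apply: ctens_rel_eq.
  exact: tensor_relDr.
have rM : {morph @ctensr _ A B : a a' / a * a'}.
  move=> a a'; rewrite /ctensr -piM; apply: ctens_rel_eq.
  exact: tensor_relMr.
have rC c : ctensr A (scal c : B) = scal c.
  by apply: ctens_rel_eq; exact: tensor_relCr.
exact: ahomI.
Qed.

Lemma ctens_comm a b : ctensl B a * ctensr A b = ctensr A b * ctensl B a.
Proof.
rewrite /ctensl /ctensr -!piM; apply: ctens_rel_eq.
exact: tensor_rel_comm.
Qed.

Lemma ctpureM (a a' : A) (b b' : B) :
  ctpure a b * ctpure a' b' = ctpure (a * a') (b * b').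
Proof. exact: (legsM ctensl_ahom ctensr_ahom ctens_comm). Qed.

Lemma ctpure11 : ctpure (1 : A) (1 : B) = 1.
Proof. exact: (legs1 ctensl_ahom ctensr_ahom). Qed.

Lemma ctensl_pure (a : A) : ctensl B a = ctpure a (1 : B).
Proof.
have [_ _ r1] := ctensr_ahom.
exact: esym (etrans (congr1 (fun z => ctensl B a * z) r1) (mulr1 _)).
Qed.
Lemma ctensr_pure (b : B) : ctensr A b = ctpure (1 : A) b.
Proof.
have [_ _ l1] := ctensl_ahom.
exact: esym (etrans (congr1 (fun z => z * ctensr A b) l1) (mul1r _)).
Qed.

Lemma pi_ctens_word s : \pi_T (W s) = ctpure (wleft s) (wright s).
Proof.
rewrite -[RHS](legs_prod ctensl_ahom ctensr_ahom ctens_comm).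
rewrite hword_prod (ahom_prod _ _ (pi_hpresented_ahom _)).
by apply: eq_bigr => -[a|b] _.
Qed.

Lemma slin_ctpurel (b : B) : slin (fun a : A => ctpure a b).
Proof. exact: slin_legl ctensl_ahom b. Qed.
Lemma slin_ctpurer (a : A) : slin (fun b : B => ctpure a b).
Proof. exact: slin_legr ctensr_ahom a. Qed.

Section Hom.
Variable (V : pzAlgType {fps K}).
Hypothesis V_sep : separated V.

Lemma ctens_slin0 (f : T -> V) : slin f -> (forall a b, f (ctpure a b) = 0) ->
  forall t, f t = 0.
Proof. by move=> fl f0; apply: hpresented_slin0 => // s; rewrite pi_ctens_word. Qed.

Lemma ctens_slin_eq (f g : T -> V) : slin f -> slin g ->
  (forall a b, f (ctpure a b) = g (ctpure a b)) -> f =1 g.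
Proof.
move=> fl gl fg t; apply/eqP; rewrite -subr_eq0; apply/eqP.
apply: (ctens_slin0 (f := fun t => f t - g t)); first exact: slin_eqD.
by move=> a b; rewrite fg subrr.
Qed.

Lemma ctens_ahom (f : T -> V) : slin f ->
  (forall a b a' b',
     f (ctpure (a * a') (b * b')) = f (ctpure a b) * f (ctpure a' b')) ->
  f 1 = 1 -> ahom f.
Proof.
move=> fl fM f1; split=> // x y.
apply: (ctens_slin_eq (f := fun x => f (x * y)) (g := fun x => f x * f y)) => [||a b].
- exact: slin_comp (slin_mulr _) fl.
- exact: slin_comp fl (slin_mulr _).
apply: (ctens_slin_eq (f := fun y => f (ctpure a b * y))
  (g := fun y => f (ctpure a b) * f y)) => //.
- exact: slin_comp (slin_mull _) fl.
- exact: slin_comp fl (slin_mull _).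
move=> a' b'; exact: etrans (congr1 f (ctpureM a a' b b')) (fM a b a' b').
Qed.

(** [Phi] is a free parameter so that this serves [ctlift], which lands in power series, as well as
    [ctmap] followed by a linear map. *)
Lemma ctens_factor (f : A -> B -> V) (Phi : {fps free_alg K (A + B)%type} -> V) x :
  (forall b, slin (f^~ b)) -> (forall a, slin (f a)) -> slin Phi ->
  (forall u, Phi (W u) = f (wleft u) (wright u)) ->
  Phi (repr (\pi_T x)) = Phi x.
Proof.
move=> fl fr Pl PW; apply: (repr_hpresented V_sep) => // s t r rr.

exact: (@tensor_rel_kill {fps K} A B {fps free_alg K (A + B)%type} V W
  (@hword_cat K _) f Phi s t r fl fr Pl PW (ctens_relP rr)).
Qed.

End Hom.

Section Lift.
Variables (V : pzAlgType K) (f : A -> B -> {fps V}).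
Hypotheses (fl : forall b, slin (f^~ b)) (fr : forall a, slin (f a)).

Lemma ctlift_pi x :
  ctlift f (\pi_T x) = hwsum id (fun w => f (wleft w) (wright w)) x.
Proof.
apply: (ctens_factor _ (f := f)
  (Phi := hwsum id (fun w => f (wleft w) (wright w)))) => //.
- exact: separated_fps.
- exact: hwsum_slin.
- by move=> u; rewrite hwsum_word.
Qed.

Lemma ctlift_slin : slin (ctlift f).
Proof.
move=> c; elim/quotW=> x; elim/quotW=> y.
have -> : scal c * \pi_T x + \pi_T y = \pi_T (scal c * x + y) by rewrite piD piM.
by rewrite !ctlift_pi hwsum_slin.
Qed.

Lemma ctlift_pure a b : ctlift f (ctpure a b) = f a b.
Proof.
have -> : ctpure a b = \pi_T (W [:: inl a; inr b]) by rewrite pi_ctens_word !legsE.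
by rewrite ctlift_pi hwsum_word !legsE.
Qed.

End Lift.
End Ctens.

(** * Matrices over power series *)

(** Matrices as functions on a finite index type: product index sets need no renumbering in
    Kronecker products, and the coefficients only have to form a [comPzRingType], the structure that
    [{fps F}] carries here. *)
Definition fmx (K : Type) (I : finType) := I -> I -> K.

Section FmxRing.
Variables (K : comPzRingType) (I : finType).
Local Notation M := (fmx K I).
Implicit Types x y z : M.

HB.instance Definition _ := gen_eqMixin M.
HB.instance Definition _ := gen_choiceMixin M.

Lemma fmxP x y : (forall i k, x i k = y i k) -> x = y.
Proof. by move=> e; apply: funext => i; apply: funext => k. Qed.

Definition fmx_add x y : M := fun i k => x i k + y i k.
Definition fmx_opp x : M := fun i k => - x i k.
Definition fmx_mul x y : M := fun i k => \sum_j x i j * y j k.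
Definition fmx_one : M := fun i k => (i == k)%:R.
Definition fmx_scal (c : K) : M := fun i k => c * (i == k)%:R.

Fact fmx_addA : associative fmx_add.
Proof. by move=> x y z; apply: fmxP => i k; exact: addrA. Qed.
Fact fmx_addC : commutative fmx_add.
Proof. by move=> x y; apply: fmxP => i k; exact: addrC. Qed.
Fact fmx_add0 : left_id (fun _ _ => 0 : K) fmx_add.
Proof. by move=> x; apply: fmxP => i k; exact: add0r. Qed.
Fact fmx_addN : left_inverse (fun _ _ => 0 : K) fmx_opp fmx_add.
Proof. by move=> x; apply: fmxP => i k; exact: addNr. Qed.
HB.instance Definition _ :=
  GRing.isZmodule.Build M fmx_addA fmx_addC fmx_add0 fmx_addN.

Lemma sum_deltal (F : I -> K) i : \sum_j (i == j)%:R * F j = F i.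
Proof.
rewrite (bigD1 i) //= eqxx mul1r big1 ?addr0 // => j ji.
by rewrite eq_sym (negPf ji) mul0r.
Qed.
Lemma sum_deltar (F : I -> K) i : \sum_j F j * (j == i)%:R = F i.
Proof.
by rewrite -[RHS]sum_deltal; apply: eq_bigr => j _; rewrite mulrC eq_sym.
Qed.

Fact fmx_mulA : associative fmx_mul.
Proof.
move=> x y z; apply: fmxP => i k; rewrite /fmx_mul.
transitivity (\sum_j \sum_l x i j * y j l * z l k).
  by apply: eq_bigr => j _; rewrite mulr_sumr; apply: eq_bigr => l _; rewrite mulrA.
by rewrite exchange_big; apply: eq_bigr => l _; rewrite mulr_suml.
Qed.
Fact fmx_mul1 : left_id fmx_one fmx_mul.
Proof. by move=> x; apply: fmxP => i k; exact: sum_deltal. Qed.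
Fact fmx_mulr1 : right_id fmx_one fmx_mul.
Proof. by move=> x; apply: fmxP => i k; exact: sum_deltar. Qed.
Fact fmx_mulDl : left_distributive fmx_mul +%R.
Proof.
move=> x y z; apply: fmxP => i k; rewrite -[RHS]big_split /=.
by apply: eq_bigr => j _; rewrite -mulrDl.
Qed.
Fact fmx_mulDr : right_distributive fmx_mul +%R.
Proof.
move=> x y z; apply: fmxP => i k; rewrite -[RHS]big_split /=.
by apply: eq_bigr => j _; rewrite -mulrDr.
Qed.
HB.instance Definition _ := GRing.Zmodule_isPzRing.Build M
  fmx_mulA fmx_mul1 fmx_mulr1 fmx_mulDl fmx_mulDr.

Lemma fmx_scalMl c x i k : fmx_mul (fmx_scal c) x i k = c * x i k.
Proof.
rewrite -(sum_deltal (fun j => x j k)) mulr_sumr.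
by apply: eq_bigr => j _; rewrite /fmx_scal mulrA.
Qed.

Fact fmx_scal1 : fmx_scal 1 = 1.
Proof. by apply: fmxP => i k; exact: mul1r. Qed.
Fact fmx_scalB : {morph fmx_scal : c d / c - d}.
Proof. by move=> c d; apply: fmxP => i k; exact: mulrBl. Qed.
Fact fmx_scalM : {morph fmx_scal : c d / c * d}.
Proof. by move=> c d; apply: fmxP => i k; rewrite [RHS]fmx_scalMl; exact: esym (mulrA _ _ _). Qed.
Fact fmx_scal_central c x : fmx_scal c * x = x * fmx_scal c.
Proof.
apply: fmxP => i k; rewrite [LHS]fmx_scalMl -(sum_deltar (x i)) mulr_sumr.
by apply: eq_bigr => j _; rewrite /fmx_scal mulrCA.
Qed.
HB.instance Definition _ := isPzAlgebra.Build K M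
  fmx_scal1 fmx_scalB fmx_scalM fmx_scal_central.

Lemma fmxDE x y i k : (x + y) i k = x i k + y i k. Proof. by []. Qed.
Lemma fmxNE x i k : (- x) i k = - x i k. Proof. by []. Qed.
Lemma fmxME x y i k : (x * y) i k = \sum_j x i j * y j k. Proof. by []. Qed.
Lemma fmx1E i k : (1 : M) i k = (i == k)%:R. Proof. by []. Qed.
Lemma fmxZE c x i k : (scal c * x) i k = c * x i k.
Proof. exact: fmx_scalMl. Qed.

Definition fmx_diag (d : I -> K) : M := fun i k => d i * (i == k)%:R.

Lemma fmx_diagMl d x i k : (fmx_diag d * x) i k = d i * x i k.
Proof.
rewrite fmxME -(sum_deltal (fun j => x j k)) mulr_sumr.
by apply: eq_bigr => j _; rewrite mulrA.
Qed.
Lemma fmx_diagMr d x i k : (x * fmx_diag d) i k = x i k * d k.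
Proof.
rewrite fmxME -(sum_deltar (fun j => x i j * d j)).
by apply: eq_bigr => j _; rewrite mulrA.
Qed.
Lemma fmx_diagM d d' : fmx_diag d * fmx_diag d' = fmx_diag (fun i => d i * d' i).
Proof. by apply: fmxP => i k; rewrite fmx_diagMl mulrA. Qed.
Lemma fmx_diagB d d' : fmx_diag d - fmx_diag d' = fmx_diag (fun i => d i - d' i).
Proof. by apply: fmxP => i k; rewrite /fmx_diag mulrBl. Qed.

End FmxRing.

Section Kron.
Variables (K : comPzRingType) (I J : finType).

Definition kron (x : fmx K I) (y : fmx K J) : fmx K (I * J)%type :=
  fun i k => x i.1 k.1 * y i.2 k.2.

Lemma kronM x x' y y' : kron x y * kron x' y' = kron (x * x') (y * y').
Proof.
apply: fmxP => i k; rewrite fmxME /kron !fmxME mulr_suml.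
rewrite (eq_bigr (fun j : I * J => (fun a b => x i.1 a * x' a k.1 * (y i.2 b * y' b k.2)) j.1 j.2)).
  rewrite -(pair_bigA _ (fun a b => x i.1 a * x' a k.1 * (y i.2 b * y' b k.2))) /=.
  by apply: eq_bigr => a _; rewrite mulr_sumr.
by move=> j _; rewrite mulrACA.
Qed.

Lemma kron11 : kron 1 1 = 1.
Proof.
by apply: fmxP => -[a b] [a' b']; rewrite /kron !fmx1E xpair_eqE /= -mulnb natrM.
Qed.

Lemma kron_slinl y : slin (fun x => kron x y).
Proof.
by move=> c x x'; apply: fmxP => i k; rewrite fmxDE fmxZE /kron fmxDE fmxZE mulrDl mulrA.
Qed.
Lemma kron_slinr x : slin (kron x).
Proof.
move=> c y y'; apply: fmxP => i k; rewrite fmxDE fmxZE /kron fmxDE fmxZE mulrDr.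
by rewrite mulrCA.
Qed.
Lemma kronl_ahom : ahom (fun x => kron x 1).
Proof.
split; [exact: kron_slinl| |exact: kron11] => x y.
by rewrite kronM mulr1.
Qed.
Lemma kronr_ahom : ahom (kron 1).
Proof.
split; [exact: kron_slinr| |exact: kron11] => x y.
by rewrite kronM mulr1.
Qed.

End Kron.

Section FmxFps.
Variable F : comNzRingType.
Local Notation K := {fps F}.

Lemma fps_scal_regular (c : K) : scal c = c :> {fps F^o}.
Proof. exact: fpsP. Qed.

Lemma separated_fmx (I : finType) : separated (fmx K I : pzAlgType K).
Proof.
move=> w wP; apply: fmxP => i k.
apply: (@separated_fps F F^o) => N; have [w' ->] := wP N.
by exists (w' i k); rewrite fmxZE fps_scal_regular.
Qed.

Lemma slin_entry (I : finType) i k :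
  slin (B := {fps F^o}) (fun x : fmx K I => x i k).
Proof. by move=> c x y; rewrite fmxDE fmxZE fps_scal_regular. Qed.

Lemma slin_fmx (A : pzAlgType K) (I : finType) (f : A -> fmx K I) :
  (forall i k, slin (B := {fps F^o}) (fun a => f a i k)) -> slin f.
Proof.
move=> fl c x y; apply: fmxP => i k; rewrite fmxDE fmxZE.
by rewrite (fl i k) fps_scal_regular.
Qed.

Definition mx_fmx n (M : 'M[F]_n) : fmx F 'I_n := fun i k => M i k.

Lemma mx_fmx_ahom n : ahom (@mx_fmx n).
Proof.
apply: ahomI => [x y|x y|c]; apply: fmxP => i k.
- by rewrite /mx_fmx mxE.
- by rewrite /mx_fmx mxE.
by rewrite /mx_fmx mxE -mulr_natr.
Qed.

Definition fps_fmx (I : finType) (x : {fps fmx F I}) : fmx K I :=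
  fun i k => fps_map (fun M => M i k) x.

Lemma fps_fmx_ahom (I : finType) : ahom (@fps_fmx I).
Proof.
apply: ahomI => [x y|x y|c]; apply: fmxP => i k; apply: fpsP => n.
- by [].
- rewrite fmxME fps_coef_sum [LHS]/=.
  rewrite (big_morph (fun M : fmx F I => M i k) (id1 := 0) (op1 := +%R)) //.
  by rewrite exchange_big.
- change (c n * (i == k)%:R = (c * (i == k)%:R) n).
  by case: (i == k); rewrite ?mulr1 // !mulr0.
Qed.

End FmxFps.

Section CtensRep.
Variables (F : fieldType) (A B : pzAlgType {fps F}) (I J : finType).
Variables (f : A -> fmx {fps F} I) (g : B -> fmx {fps F} J).
Hypotheses (fh : ahom f) (gh : ahom g).

(** The tensor product of two representations, formed entry by entry because [ctlift] takes its
    values in power series. *)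
Definition ctens_rep (t : ctens A B) : fmx {fps F} (I * J)%type := fun i k =>
  ctlift (V := F^o) (fun a b => f a i.1 k.1 * g b i.2 k.2) t.

Lemma ctens_rep_bil i k :
  (forall b, slin (B := {fps F^o}) (fun a => f a i.1 k.1 * g b i.2 k.2)) /\
  (forall a, slin (B := {fps F^o}) (fun b => f a i.1 k.1 * g b i.2 k.2)).
Proof.
have [fl _ _] := fh; have [gl _ _] := gh.
split=> z.
  exact: slin_comp (slin_comp fl (kron_slinl (g z))) (slin_entry i k).
exact: slin_comp (slin_comp gl (kron_slinr (f z))) (slin_entry i k).
Qed.

Lemma ctens_rep_pure a b : ctens_rep (ctpure a b) = kron (f a) (g b).
Proof.
by apply: fmxP => i k; have [l r] := ctens_rep_bil i k; rewrite /ctens_rep (ctlift_pure l r).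
Qed.

Lemma ctens_rep_ahom : ahom ctens_rep.
Proof.
have [fl fM f1] := fh; have [gl gM g1] := gh.
apply: ctens_ahom => [|| a b a' b'|].
- exact: separated_fmx.
- by apply: slin_fmx => i k; have [l r] := ctens_rep_bil i k; exact: ctlift_slin l r.
- apply: etrans (ctens_rep_pure _ _) _; rewrite fM gM.
  apply: etrans (esym (kronM _ _ _ _)) _.
  exact: esym (congr2 *%R (ctens_rep_pure a b) (ctens_rep_pure a' b')).
- rewrite -(ctpure11 A B) (ctens_rep_pure 1 1) f1 g1.
  exact: kron11.
Qed.
End CtensRep.

Section TensRep.
Variables (F : comNzRingType) (A B : pzAlgType F) (I J : finType).
Variables (f : A -> fmx F I) (g : B -> fmx F J).
Hypotheses (fh : ahom f) (gh : ahom g).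

Definition tens_rep (t : tens A B) : fmx F (I * J)%type := fun i k =>
  tlift (V := F^o) (fun a b => f a i.1 k.1 * g b i.2 k.2) t.

Lemma slin_entry0 (L : finType) i k :
  slin (B := F^o) (fun x : fmx F L => x i k).
Proof. by move=> c x y; rewrite fmxDE fmxZE. Qed.

Lemma tens_rep_bil i k :
  (forall b, slin (B := F^o) (fun a => f a i.1 k.1 * g b i.2 k.2)) /\
  (forall a, slin (B := F^o) (fun b => f a i.1 k.1 * g b i.2 k.2)).
Proof.
have [fl _ _] := fh; have [gl _ _] := gh.
split=> z.
  exact: slin_comp (slin_comp fl (kron_slinl (g z))) (slin_entry0 i k).
exact: slin_comp (slin_comp gl (kron_slinr (f z))) (slin_entry0 i k).
Qed.

Lemma tens_rep_pure a b : tens_rep (tpure a b) = kron (f a) (g b).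
Proof.
by apply: fmxP => i k; have [l r] := tens_rep_bil i k; rewrite /tens_rep (tlift_pure l r).
Qed.

Lemma tens_rep_ahom : ahom tens_rep.
Proof.
have [fl fM f1] := fh; have [gl gM g1] := gh.
apply: tens_ahom => [|a b a' b'|].
- move=> c x y; apply: fmxP => i k; have [l r] := tens_rep_bil i k.
  by rewrite fmxDE fmxZE; exact: (tlift_slin l r).
- apply: etrans (tens_rep_pure _ _) _; rewrite fM gM.
  apply: etrans (esym (kronM _ _ _ _)) _.
  exact: esym (congr2 *%R (tens_rep_pure a b) (tens_rep_pure a' b')).
- rewrite -(tpure11 A B) (tens_rep_pure 1 1) f1 g1.
  exact: kron11.
Qed.
End TensRep.

(** * q-numbers *)

(** The lists of the first n values are built by plain recursion and extend each other, so their
    last entries form the sequence. It solves for the coefficients of inverses and square roots of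
    power series. *)
Lemma course_of_values T (t0 : T) (G : nat -> (nat -> T) -> T) :
  (forall n f g, (forall k, (k < n)%N -> f k = g k) -> G n f = G n g) ->
  exists f, forall n, f n = G n f.
Proof.
move=> Gext.
pose s := fix s n := if n is m.+1 then rcons (s m) (G m (nth t0 (s m))) else [::].
have size_s n : size (s n) = n by elim: n => //= n IHn; rewrite size_rcons IHn.
have nth_s n k j : (k < n)%N -> nth t0 (s (n + j)%N) k = nth t0 (s n) k.
  move=> kn; elim: j => [|j IHj]; first by rewrite addn0.
  by rewrite addnS /= nth_rcons size_s ltn_addr.
exists (fun n => nth t0 (s n.+1) n) => n.
rewrite /= nth_rcons size_s ltnn eqxx; apply: Gext => k kn.
by rewrite -(subnKC kn) nth_s.
Qed.

Section FpsUnits.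
Variable F : fieldType.
Implicit Types x y : {fps F}.

Lemma fps_unit x : x 0%N != 0 -> exists y, x * y = 1.
Proof.
(* The coefficient of hbar^n in x y = 1, solved for the n-th coefficient of y. *)
move=> x0; pose G n (y : nat -> F) :=
  ((n == 0%N)%:R - \sum_(k < n) x k.+1 * y (n - k.+1)%N) / x 0%N.
have [n f g fg|f fE] := @course_of_values F 0 G.
  by rewrite /G; congr ((_ - _) / _); apply: eq_bigr => k _; rewrite fg // ltn_subLR ?ltn_ord // addSn ltnS leq_addl.
exists (Fps f); apply: fpsP => n; rewrite fps_coefM big_ord_recl subn0 /=.
rewrite fE {1}/G mulrC divfK // subrK.
by case: n.
Qed.

Lemma fps_cancel (A : pzAlgType F) (x : {fps F}) (y z : {fps A}) :
  x 0%N != 0 -> scal x * y = scal x * z -> y = z.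
Proof.
move=> /fps_unit[x' xx'] e; rewrite -[y]mul1r -[z]mul1r -(scal1 (s := {fps A})).
by rewrite -xx' mulrC scalM -!mulrA e.
Qed.

End FpsUnits.

Section Qexp.
Variable F : numFieldType.

Lemma natr_fact_neq0 n : n`!%:R != 0 :> F.
Proof. by rewrite pnatr_eq0 -lt0n fact_gt0. Qed.

Lemma qexp0 : qexp (0 : F) = 1.
Proof.
by apply: fpsP => -[|n] /=; rewrite ?expr0 ?exprS ?mul0r ?mulr0 // fact0 invr1 mulr1.
Qed.

Lemma qexpD (a b : F) : qexp (a + b) = qexp a * qexp b.
Proof.
apply: fpsP => n; rewrite fps_coefM (convolC (fun i j => qexp a i * qexp b j)) /=.
rewrite exprDn mulr_sumr; apply: eq_bigr => k _.
have kn : (k <= n)%N by rewrite -ltnS.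
have bE : 'C(n, k)%:R = n`!%:R / (k`!%:R * (n - k)`!%:R) :> F.
  by rewrite -(bin_fact kn) !natrM mulfK // mulf_neq0 ?natr_fact_neq0.
rewrite -[_ *+ 'C(n, k)]mulr_natr bE; have := natr_fact_neq0 n; have := natr_fact_neq0 k.
have := natr_fact_neq0 (n - k); move: (n`!%:R) (k`!%:R) ((n - k)`!%:R) (a ^+ (n - k)) (b ^+ k) => u v w x y.
by move=> w0 v0 u0; field; rewrite w0 v0 u0.
Qed.

Definition qq : {fps F} := qexp 1 - qexp (-1).

Lemma qq_coef0 : qq 0%N = 0.
Proof. by rewrite fps_coefD fps_coefN /= !expr0 subrr. Qed.
Lemma qq_coef1 : qq 1%N = 2.
Proof. by rewrite fps_coefD fps_coefN /= !expr1 invr1 !mul1r opprK. Qed.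

Lemma fps_divh (A : pzAlgType F) (x : {fps A}) :
  x 0%N = 0 -> x = scal (@fps_h F) * fps_shift 1 x.
Proof.
by move=> x0; apply: fpsP => -[|n]; rewrite fps_coef_h //= addn1.
Qed.

Lemma fps_h_cancel (A : pzAlgType F) (x y : {fps A}) :
  scal (@fps_h F) * x = scal (@fps_h F) * y -> x = y.
Proof.
move=> e; apply: fpsP => n.
by have := congr1 (fun z : {fps A} => z n.+1) e; rewrite !fps_coef_h.
Qed.

(** The quotient (q - q^-1) / hbar. Its constant term is 2, so q - q^-1 is hbar times a unit: not
    invertible, but cancellable. *)
Definition qu : {fps F} := fps_shift 1 qq.

Lemma qqE : qq = @fps_h F * qu.
Proof.
have := @fps_divh F^o qq qq_coef0.
by rewrite fps_scal_regular.
Qed.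

Lemma qu0 : qu 0%N != 0.
Proof. by rewrite -[qu 0%N]/(qq 1%N) qq_coef1 pnatr_eq0. Qed.

Lemma qq_cancel (A : pzAlgType F) (x y : {fps A}) :
  scal qq * x = scal qq * y -> x = y.
Proof.
rewrite qqE scalM -!mulrA => /fps_h_cancel; exact: fps_cancel qu0.
Qed.

Lemma qq_cancel0 (x y : {fps F}) : qq * x = qq * y -> x = y.
Proof. by move=> e; apply: (@qq_cancel F^o); rewrite fps_scal_regular. Qed.

Lemma hexp_scal (A : pzAlgType F) (c : F) : hexp (scal c : A) = scal (qexp c).
Proof.
apply: fpsP => n /=; rewrite scalM; congr (_ * _).
elim: n => [|n IHn]; first by rewrite !expr0 scal1.
by rewrite !exprS scalM IHn.
Qed.

Lemma hexp_qq (A : pzAlgType F) : hexp (1 : A) - hexp (-1) = scal qq.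
Proof. by rewrite /qq scalB -!hexp_scal scalN scal1. Qed.

Lemma xquot_qq (A : pzAlgType F) (x : {fps A}) :
  x 0%N = 0 -> scal qq * xquot x (scal qq) = x.
Proof.
move=> x0; have [u' uu'] := fps_unit qu0.
(* A quotient exists: [x] has no constant term, so hbar can be divided off, and the remaining factor
   [qu] of [qq] has the inverse [u']. *)
rewrite /xquot; case: xgetP => [y -> //|/(_ (scal u' * fps_shift 1 x))[]] /=.
rewrite mulrA -scalM qqE -mulrA uu' mulr1.
by rewrite -fps_divh.
Qed.

Lemma xquot_hexp (A : pzAlgType F) (x : {fps A}) : x 0%N = 0 ->
  scal qq * xquot x (hexp (1 : A) - hexp (-1)) = x.
Proof. by move=> x0; rewrite hexp_qq xquot_qq. Qed.

Lemma hexpB_coef0 (A : pzAlgType F) (a : A) : (hexp a - hexp (- a)) 0%N = 0.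
Proof.
by rewrite fps_coefD fps_coefN /= fact0 invr1 scal1 !mulr1 subrr.
Qed.

Lemma qqM_qint n : qq * qint F n = qexp n%:R - qexp (- n%:R).
Proof.
have := @xquot_qq F^o (qexp n%:R - qexp (- n%:R)).
rewrite fps_scal_regular => -> //.
by rewrite fps_coefD fps_coefN /= !expr0 subrr.
Qed.

(** Comparison of the coefficients of hbar in (q - q^-1) [n] = q^n - q^-n, which are 2 [n]_0 and 2
    n. *)
Lemma qint_coef0 n : qint F n 0%N = n%:R.
Proof.
have := congr1 (fun z : {fps F} => z 1%N) (qqM_qint n).
have -> : (qq * qint F n) 1%N = qq 0%N * qint F n 1%N + qq 1%N * qint F n 0%N.
  by rewrite fps_coefM !big_ord_recl big_ord0 addr0.
rewrite qq_coef0 mul0r add0r qq_coef1.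
rewrite fps_coefD fps_coefN /= invr1 !expr1 !mul1r opprK -mulr2n.
by rewrite -[n%:R *+ 2]mulr_natl; apply: mulfI; rewrite pnatr_eq0.
Qed.

Lemma qint0 : qint F 0 = 0.
Proof. by apply: qq_cancel0; rewrite qqM_qint oppr0 subrr mulr0. Qed.

(* [i][n-i+1] - [i+1][n-i] = [2i-n] *)
Lemma qint_bracket (n i : nat) : (i <= n)%N ->
  qq * (qint F i * qint F (n - i).+1 - qint F i.+1 * qint F (n - i))
  = qexp (i%:R *+ 2 - n%:R) - qexp (- (i%:R *+ 2 - n%:R)).
Proof.
(* A second factor [qq] turns every q-integer into a difference of exponentials. *)
move=> ni; apply: qq_cancel0.
have -> : qq * (qq * (qint F i * qint F (n - i).+1 - qint F i.+1 * qint F (n - i)))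
  = (qq * qint F i) * (qq * qint F (n - i).+1)
    - (qq * qint F i.+1) * (qq * qint F (n - i)) by ring.
have e1 : (n - i).+1%:R = n%:R - i%:R + 1 :> F by rewrite -natr1 natrB.
have e2 : i.+1%:R = i%:R + 1 :> F by rewrite -natr1.
have e3 : (n - i)%:R = n%:R - i%:R :> F by rewrite natrB.
rewrite !qqM_qint /qq e1 e2 e3.
have -> : i%:R *+ 2 - n%:R = i%:R + (i%:R - n%:R) :> F by ring.
rewrite !opprD !opprK.
have -> : - i%:R + (- i%:R + n%:R) = - i%:R + (n%:R - i%:R) :> F by ring.
rewrite !qexpD.
ring.
Qed.

End Qexp.

Section QexpMap.
Variables (F G : numFieldType) (f : {rmorphism F -> G}).

Lemma fps_map_qexp (a : F) : fps_map f (qexp a) = qexp (f a).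
Proof. by apply: fpsP => n; rewrite /= rmorphM rmorphXn fmorphV rmorph_nat. Qed.

Lemma fps_map_rmorphD : {morph fps_map f : x y / x + y}.
Proof. by move=> x y; apply: fpsP => n; exact: rmorphD. Qed.
Lemma fps_map_rmorphN : {morph fps_map f : x / - x}.
Proof. by move=> x; apply: fpsP => n; exact: rmorphN. Qed.
Lemma fps_map_rmorph0 : fps_map f 0 = 0.
Proof. by apply: fpsP => n; exact: rmorph0. Qed.
Lemma fps_map_rmorphM : {morph fps_map f : x y / x * y}.
Proof.
move=> x y; apply: fpsP => n; rewrite fps_coefM [LHS]/= rmorph_sum.
by apply: eq_bigr => k _; rewrite rmorphM.
Qed.
Lemma fps_map_rmorph1 : fps_map f 1 = 1.
Proof. by apply: fpsP => -[|n] /=; rewrite ?rmorph1 ?rmorph0. Qed.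
Lemma fps_map_rmorph_sum I (r : seq I) (P : pred I) (E : I -> {fps F}) :
  fps_map f (\sum_(i <- r | P i) E i) = \sum_(i <- r | P i) fps_map f (E i).
Proof. exact: (big_morph _ fps_map_rmorphD fps_map_rmorph0). Qed.
Lemma fps_map_rmorph_nat (b : nat) : fps_map f b%:R = b%:R.
Proof.
elim: b => [|b IHb]; first exact: fps_map_rmorph0.
by rewrite -natr1 fps_map_rmorphD IHb fps_map_rmorph1 natr1.
Qed.

Lemma fps_map_qint n : fps_map f (qint F n) = qint G n.
Proof.
apply: qq_cancel0; rewrite qqM_qint.
have -> : qq G = fps_map f (qq F).
  rewrite /qq fps_map_rmorphD fps_map_rmorphN !fps_map_qexp.
  by rewrite rmorphN rmorph1.
rewrite -fps_map_rmorphM qqM_qint fps_map_rmorphD fps_map_rmorphN !fps_map_qexp.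
by rewrite rmorphN rmorph_nat.
Qed.
End QexpMap.

Section FpsSqrt.
Variable R : realType.

(** [fps_sqrt] picks some root with nonnegative constant term. A root exists by solving for one
    coefficient after the other, and the sign condition forces the constant term to be the real
    square root. *)
Lemma fps_sqrtP (x : {fps R}) : 0 < x 0%N ->
  fps_sqrt x * fps_sqrt x = x /\ fps_sqrt x 0%N = Num.sqrt (x 0%N).
Proof.
move=> x0; pose r := Num.sqrt (x 0%N).
have r0 : r != 0 by rewrite lt0r_neq0 // sqrtr_gt0.
have rr : r * r = x 0%N by rewrite -expr2 sqr_sqrtr // ltW.
(* In the coefficient of hbar^(m+1) of y y the unknown y_(m+1) occurs twice, both times with the
   factor r. *)
pose G n (y : nat -> R) := if n is m.+1 then
  (x m.+1 - \sum_(k < m) y k.+1 * y (m - k)%N) / (r *+ 2) else r.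
have [[|n] f g fg //|f fE] := @course_of_values R 0 G.
  rewrite /G; congr ((_ - _) / _); apply: eq_bigr => k _.
  by rewrite !fg ?ltnS ?leq_subr // ltn_ord.
have f0 : f 0%N = r by rewrite fE.
suff H : exists2 y, y * y = x & 0 <= y 0%N.
  have [y yy y0] := H; rewrite /fps_sqrt; case: xgetP => [z _ [zz z0]|/(_ y)[]//].
  split=> //.
  have := congr1 (fun z : {fps R} => z 0%N) zz.
  rewrite fps_coefM big_ord_recl big_ord0 addr0 /= => zz0.
  by rewrite /r -zz0 -expr2 sqrtr_sqr ger0_norm.
exists (Fps f); last by rewrite /= f0 sqrtr_ge0.
apply: fpsP => -[|n]; rewrite fps_coefM big_ord_recl /= subn0.
  by rewrite big_ord0 addr0 f0.
rewrite big_ord_recr /= subSS subnn f0 fE /G.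
rewrite (eq_bigr (fun k : 'I_n => f k.+1 * f (n - k)%N)); last first.
  by move=> k _; rewrite ?/bump ?leq0n ?add1n ?subSS.
set s := \sum_(k < n) _; rewrite addrC.
by field; rewrite r0.
Qed.

Lemma fps_sqrt0 : fps_sqrt (0 : {fps R}) = 0.
Proof.
rewrite /fps_sqrt; case: xgetP => [y _ [yy _]|//].
apply: fpsP => m; suff: forall k, (k <= m)%N -> y k = 0 by apply.
elim: m => [|m IHm] k.
  rewrite leqn0 => /eqP->; have := congr1 (fun z : {fps R} => z 0%N) yy.
  by rewrite fps_coefM big_ord_recl big_ord0 addr0 /= => /eqP; rewrite mulf_eq0 orbb => /eqP.
rewrite leq_eqVlt => /orP[/eqP->|/IHm //].
(* Once the coefficients up to m vanish, this even coefficient of y y is the square of y_(m+1). *)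
have := congr1 (fun z : {fps R} => z (m.+1 + m.+1)%N) yy.
have mm : (m.+1 < (m.+1 + m.+1).+1)%N by rewrite ltnS leq_addl.
rewrite fps_coefM (bigD1 (Ordinal mm)) //= addnK big1 ?addr0.
  by move=> /eqP; rewrite mulf_eq0 orbb => /eqP.
move=> i /eqP im; have [lim|] := leqP i m; first by rewrite IHm // mul0r.
rewrite leq_eqVlt => /orP[/eqP e|mi]; first by case: im; apply: val_inj.
have im' : (m.+1 + m.+1 - i <= m)%N by rewrite leq_subLR addnC (leq_trans _ (leq_add (leqnn m) mi)) // !addnS addSn.
by rewrite [y (_ - _)%N]IHm // mulr0.
Qed.

End FpsSqrt.

Section ProductLifts.
Variables (K : comNzRingType) (G : choiceType) (V : pzAlgType K).

Lemma wsum_prod_ahom (f : G -> V) :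
  ahom (wsum id (fun w : seq G => \prod_(g <- w) f g)).
Proof.
set Phi := wsum id _; have Pl : slin Phi by exact: wsum_slin.
split=> // [x y|]; last first.
  by rewrite (_ : 1 = word K [::]) /Phi ?wsum_word ?big_nil // /word big_nil.
apply: (slin_free_eq (f := fun x => Phi (x * y)) (g := fun x => Phi x * Phi y)) => [||s].
- exact: slin_comp (slin_mulr _) Pl.
- exact: slin_comp Pl (slin_mulr _).
apply: (slin_free_eq (f := fun y => Phi (word K s * y)) (g := fun y => Phi (word K s) * Phi y)) => [||t].
- exact: slin_comp (slin_mull _) Pl.
- exact: slin_comp Pl (slin_mull _).
by rewrite -word_cat /Phi !wsum_word big_cat.
Qed.

Lemma hwsum_prod_ahom (f : G -> {fps V}) :
  ahom (hwsum id (fun w : seq G => \prod_(g <- w) f g)).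
Proof.
set Phi := hwsum id _; have Pl : slin Phi by exact: hwsum_slin.
have V_sep := @separated_fps K V.
split=> // [x y|]; last first.
  by rewrite (_ : 1 = hword K [::]) /Phi ?hwsum_word ?big_nil // /hword /word big_nil.
apply: (slin_hfree_eq V_sep (f := fun x => Phi (x * y)) (g := fun x => Phi x * Phi y)) => [||s].
- exact: slin_comp (slin_mulr _) Pl.
- exact: slin_comp Pl (slin_mulr _).
apply: (slin_hfree_eq V_sep (f := fun y => Phi (hword K s * y)) (g := fun y => Phi (hword K s) * Phi y)) => [||t].
- exact: slin_comp (slin_mull _) Pl.
- exact: slin_comp Pl (slin_mull _).
by rewrite -hword_cat /Phi !hwsum_word big_cat.
Qed.

Lemma wsum_letter (f : G -> V) g :
  wsum id (fun w : seq G => \prod_(g <- w) f g) (letter K g) = f g.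
Proof. by rewrite -word1 wsum_word big_seq1. Qed.

Lemma hwsum_letter (f : G -> {fps V}) g :
  hwsum id (fun w : seq G => \prod_(g <- w) f g) (fps_cst (letter K g)) = f g.
Proof. by rewrite -word1 hwsum_word big_seq1. Qed.

End ProductLifts.

Section AhomTheory.
Variables (K : pzRingType) (A B : pzAlgType K) (f : A -> B).
Hypothesis fh : ahom f.

Lemma ahomMn x n : f (x *+ n) = f x *+ n.
Proof.
have [fl _ _] := fh; elim: n => [|n IHn]; first by rewrite !mulr0n slin0.
by rewrite !mulrS slinD // IHn.
Qed.
Lemma ahomX x n : f (x ^+ n) = f x ^+ n.
Proof.
have [_ fM f1] := fh; elim: n => [|n IHn]; first by rewrite !expr0.
by rewrite !exprS fM IHn.
Qed.
Lemma ahom_bracket x y : f (lie_bracket x y) = lie_bracket (f x) (f y).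
Proof. by have [fl fM _] := fh; rewrite /lie_bracket slinB // !fM. Qed.
End AhomTheory.

Lemma ideal_gen_ahom0 (K : pzRingType) (A B : pzAlgType K) (S : A -> Prop) (f : A -> B) :
  ahom f -> (forall r, S r -> f r = 0) -> forall a b r, S r -> f (a * r * b) = 0.
Proof. by move=> [_ fM _] f0 a b r Sr; rewrite !fM (f0 _ Sr) mulr0 mul0r. Qed.

Section PresLift.
Variables (K : comNzRingType) (G : choiceType) (S : free_alg K G -> Prop).
Variables (V : pzAlgType K) (f : G -> V).
Hypothesis fS : forall r, S r -> wsum id (fun w : seq G => \prod_(g <- w) f g) r = 0.
Local Notation P := (presented S).

Lemma pres_lift_pi x :
  pres_lift f (\pi_P x) = wsum id (fun w : seq G => \prod_(g <- w) f g) x.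
Proof.
have h := wsum_prod_ahom f; have [hl _ _] := h.
apply: (repr_presented (f := wsum id (fun w => \prod_(g <- w) f g))) => //.
by move=> s t r Sr; exact: ideal_gen_ahom0 h fS _ _ _ Sr.
Qed.

Lemma pres_lift_ahom : ahom (pres_lift f : P -> V).
Proof.
have [hl hM h1] := wsum_prod_ahom f.
split=> [c|x|]; last by rewrite -[1]/(\pi_P 1) pres_lift_pi.
  elim/quotW=> x; elim/quotW=> y.
  have -> : scal c * \pi_P x + \pi_P y = \pi_P (scal c * x + y) by rewrite piD piM.
  by rewrite !pres_lift_pi.
elim/quotW: x => x; elim/quotW => y.
have -> : \pi_P x * \pi_P y = \pi_P (x * y) by rewrite piM.
by rewrite !pres_lift_pi.
Qed.
End PresLift.

Lemma hpresented_ahom (K : comNzRingType) (G : choiceType)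
    (S : {fps free_alg K G} -> Prop) (V : pzAlgType {fps K})
    (f : hpresented S -> V) (Phi : {fps free_alg K G} -> V) :
  ahom Phi -> (forall x, f (\pi_(hpresented S) x) = Phi x) -> ahom f.
Proof.
move=> [hl hM h1] fP; split=> [c|x|]; last by rewrite -[1]/(\pi_(hpresented S) 1) fP.
  elim/quotW=> x; elim/quotW=> y.
  have -> : scal c * \pi_(hpresented S) x + \pi_(hpresented S) y
      = \pi_(hpresented S) (scal c * x + y) by rewrite piD piM.
  by rewrite !fP.
elim/quotW: x => x; elim/quotW => y.
have -> : \pi_(hpresented S) x * \pi_(hpresented S) y = \pi_(hpresented S) (x * y).
  by rewrite piM.
by rewrite !fP.
Qed.

Section CtensLift.
Variables (F : fieldType) (G : choiceType) (S : {fps free_alg F G} -> Prop).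
Variables (A B : pzAlgType {fps F}) (f : G -> ctens A B).
Local Notation T := (ctens A B).

Lemma pi_ctens_ahom : ahom (fun x => \pi_T x : T).
Proof. exact: pi_hpresented_ahom. Qed.

Definition ctens_word (x : {fps free_alg F G}) : T :=
  \pi_T (hwsum id (fun w : seq G => \prod_(g <- w) repr (f g)) x).

Lemma ctens_word_ahom : ahom ctens_word.
Proof. exact: ahom_comp (hwsum_prod_ahom _) pi_ctens_ahom. Qed.

Lemma ctens_word_letter g : ctens_word (fps_cst (letter F g)) = f g.
Proof. by rewrite /ctens_word hwsum_letter reprK. Qed.

Definition ctens_lift (x : hpresented S) : T := ctens_word (repr x).

Lemma ctens_liftE x : hpres_lift_quot f x = ctens_lift x.
Proof. by []. Qed.

Variables (V : pzAlgType {fps F}) (h : T -> V).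
Hypotheses (V_sep : separated V) (hh : ahom h).
Hypothesis hS : forall r, S r -> h (ctens_word r) = 0.

(** The lift to a completed tensor product is examined after composition with a homomorphism [h], so
    that the relations [S] have to be checked only in the target of [h], in practice a matrix
    algebra. *)
Lemma ctens_lift_pi x : h (ctens_lift (\pi_(hpresented S) x)) = h (ctens_word x).
Proof.
have wh := ahom_comp ctens_word_ahom hh; have [wl _ _] := wh.
have kS s t r : S r -> (h \o ctens_word) (hword F s * r * hword F t) = 0.
  exact: ideal_gen_ahom0 wh hS _ _ _.
have e := @repr_hpresented F G S V V_sep (h \o ctens_word) x wl kS.
exact: e.
Qed.

Lemma ctens_lift_ahom : ahom (fun x : hpresented S => h (ctens_lift x)).
Proof.
exact: hpresented_ahom (ahom_comp ctens_word_ahom hh) ctens_lift_pi.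
Qed.

Lemma ctens_lift_letter g :
  h (ctens_lift (\pi_(hpresented S) (fps_cst (letter F g)))) = h (f g).
Proof. by rewrite ctens_lift_pi ctens_word_letter. Qed.
End CtensLift.

Lemma fmx_diagE (K : comPzRingType) (I : finType) (d : I -> K) i k :
  fmx_diag d i k = d k * (i == k)%:R.
Proof. by rewrite /fmx_diag; case: eqP => [->//|_]; rewrite !mulr0. Qed.

Lemma fmx_diagZ (K : comPzRingType) (I : finType) c (d : I -> K) :
  scal c * fmx_diag d = fmx_diag (fun i => c * d i).
Proof. by apply: fmxP => i k; rewrite fmxZE /fmx_diag mulrA. Qed.

Lemma eq_fmx_diag (K : comPzRingType) (I : finType) (d d' : I -> K) :
  d =1 d' -> fmx_diag d = fmx_diag d'.
Proof. by move=> /funext->. Qed.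

Section Ladder.
Variables (K : comPzRingType) (n : nat) (e f h : nat -> K).
Local Notation M := (fmx K 'I_n.+1).

(** The first index is the row; the coefficient belongs to the column, that is, to the basis vector
    acted on. The same holds for [ladder_down]. *)
Definition ladder_up : M := fun k i => if k == i.+1 :> nat then e i else 0.
Definition ladder_down : M := fun k i => if k.+1 == i :> nat then f i else 0.

(** The hypotheses say that the ladder ends at both sides; at i = 0 the value [e i.-1] is a dummy,
    killed by [f 0 = 0]. *)
Lemma ladder_bracket : f 0%N = 0 -> e n = 0 ->
  lie_bracket ladder_up ladder_down
  = fmx_diag (fun i : 'I_n.+1 => e i.-1 * f i - f i.+1 * e i).
Proof.
move=> f0 en; apply: fmxP => k i; rewrite /lie_bracket fmxDE fmxNE !fmxME fmx_diagE mulrBl.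
congr (_ - _).
  case: i => [[|i] ilt] /=.
    rewrite f0 mulr0 mul0r big1 // => j _.
    by rewrite /ladder_down /= mulr0.
  rewrite (bigD1 (Ordinal (ltnW ilt))) //= big1 ?addr0.
    rewrite /ladder_up /ladder_down /= eqxx -val_eqE /=.
    by case: eqP => _; rewrite ?mulr1 ?mul0r ?mulr0.
  move=> j /eqP ji; rewrite /ladder_down /=; case: eqP => [[]e1|_]; last by rewrite mulr0.
  by case: ji; apply: val_inj.
have [ilt|] := ltnP i n.
  have ilt' : (i.+1 < n.+1)%N by [].
  rewrite (bigD1 (Ordinal ilt')) //= big1 ?addr0.
    rewrite /ladder_up /ladder_down /= eqxx -val_eqE /= eqSS.
    by case: eqP => _; rewrite ?mulr1 ?mul0r ?mulr0.
  move=> j /eqP ji; rewrite /ladder_up; case: eqP => [e1|_]; last by rewrite mulr0.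
  by case: ji; apply: val_inj.
move=> ni; have -> : nat_of_ord i = n.
  by apply/eqP; rewrite eqn_leq ni -ltnS ltn_ord.
rewrite en mulr0 mul0r big1 // => j _.
rewrite /ladder_up; case: eqP => [e1|_]; last by rewrite mulr0.
by move: (ltn_ord j); rewrite e1 ltnS ltnNge ni.
Qed.

Lemma ladder_weight_up : (forall i, (i < n)%N -> h i.+1 = h i + 2) ->
  lie_bracket (fmx_diag (fun i : 'I_n.+1 => h i)) ladder_up = ladder_up *+ 2.
Proof.
move=> hS; apply: fmxP => k i; rewrite /lie_bracket fmxDE fmxNE fmx_diagMl fmx_diagMr mulr2n fmxDE.
rewrite /ladder_up; case: eqP => [e1|_]; last by rewrite mul0r mulr0 subrr addr0.
by rewrite e1 hS; [ring | rewrite -ltnS -e1 ltn_ord].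
Qed.

Lemma ladder_weight_down : (forall i, (i < n)%N -> h i.+1 = h i + 2) ->
  lie_bracket (fmx_diag (fun i : 'I_n.+1 => h i)) ladder_down = - (ladder_down *+ 2).
Proof.
move=> hS; apply: fmxP => k i; rewrite /lie_bracket fmxDE !fmxNE fmx_diagMl fmx_diagMr mulr2n fmxDE.
rewrite /ladder_down; case: eqP => [e1|_]; last by rewrite mul0r mulr0 subrr addr0 oppr0.
by rewrite -e1 hS; [ring | rewrite -ltnS e1 ltn_ord].
Qed.
End Ladder.

Section HexpRep.
Variables (F : numFieldType) (A : pzAlgType F) (I : finType).
Variable Phi : {fps A} -> fmx {fps F} I.
Hypothesis Ph : ahom Phi.

(** Every coefficient of [hexp a], taken as a constant, has a constant diagonal image. So in the
    coefficient of hbar^n of the image, by [slin_coef], only the n-th coefficient of [hexp a]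
    contributes. *)
Lemma hexp_diag (a : A) (d : I -> F) :
  Phi (fps_cst a) = fmx_diag (fun i => fps_cst (d i)) ->
  Phi (hexp a) = fmx_diag (fun i => qexp (d i)).
Proof.
move=> Pa; have [Pl _ _] := Ph; apply: fmxP => i k; apply: fpsP => n.
pose f x := Phi x i k.
have fl : slin (B := {fps F^o}) f by exact: slin_comp Pl (slin_entry i k).
have Pd j : (fmx_diag (fun i => fps_cst (d i))) ^+ j
    = fmx_diag (fun i => fps_cst (d i ^+ j)).
  elim: j => [|j IHj]; first by apply: fmxP => x y; rewrite /fmx_diag mul1r.
  rewrite exprS IHj fmx_diagM; apply: fmxP => x y.
  by rewrite /fmx_diag exprS fps_cstM.
have fc j : f (fps_cst (hexp a j)) = fps_cst (j`!%:R^-1 * d i ^+ j) * (i == k)%:R.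
  have -> : fps_cst (hexp a j) = scal (fps_cst (j`!%:R^-1 : F)) * fps_cst a ^+ j.
    rewrite fps_scal_cst /= fps_cstM; congr (_ * _).
    elim: j => [|j IHj]; first by rewrite !expr0.
    by rewrite !exprS fps_cstM IHj.
  rewrite /f slinZ // fmxZE (ahomX Ph) Pa Pd /fmx_diag mulrA.
  by rewrite -fps_cstM.
have dE (c : {fps F}) m : (c * (i == k)%:R) m = c m * (i == k)%:R.
  by case: (i == k); rewrite ?mulr1 // !mulr0.
rewrite [RHS]dE -[LHS]/(f (hexp a) n) (slin_coef _ _ fl) (bigD1 ord_max) // big1.
  by rewrite [LHS]addr0 subnn fc dE.
move=> j /eqP jn; rewrite fc dE.
case jE: (n - j)%N => [|m]; last by rewrite mul0r.
case: jn; apply: val_inj; apply/eqP.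
by rewrite /= eqn_leq -ltnS ltn_ord -subn_eq0 jE.
Qed.
Lemma hexp_quot (h : A) (d : I -> F) :
  Phi (fps_cst h) = fmx_diag (fun i => fps_cst (d i)) ->
  scal (qq F) * Phi (xquot (hexp h - hexp (- h)) (hexp 1 - hexp (-1)))
  = fmx_diag (fun i => qexp (d i)) - fmx_diag (fun i => qexp (- d i)).
Proof.
move=> Pa; have [Pl _ _] := Ph.
rewrite -(slinZ Pl) (xquot_hexp (hexpB_coef0 h)) (slinB Pl) (hexp_diag Pa).
rewrite (hexp_diag (d := fun i => - d i)) // fps_cstN (slinN Pl) Pa.
by apply: fmxP => x y; rewrite fmxNE /fmx_diag fps_cstN mulNr.
Qed.

Lemma fmx_qq_cancel (x y : fmx {fps F} I) :
  scal (qq F) * x = scal (qq F) * y -> x = y.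
Proof.
move=> e; apply: fmxP => i k; apply: qq_cancel0.
by rewrite -!fmxZE e.
Qed.
End HexpRep.

(** * Spin representations *)

Section SuhKill.
Variables (R : realType) (I : finType).
Local Notation C := R[i].
Local Notation K := {fps C}.
Local Notation free := (free_alg C su2_gen).
Variable Phi : {fps free} -> fmx K I.
Hypothesis Ph : ahom Phi.
Local Notation E := (Phi (fps_cst (letter C gE))).
Local Notation H := (Phi (fps_cst (letter C gH))).
Local Notation F := (Phi (fps_cst (letter C gF))).
Variable d : I -> C.
Hypothesis HE : H = fmx_diag (fun i => fps_cst (d i)).
Hypotheses (rHE : lie_bracket H E = E *+ 2) (rHF : lie_bracket H F = - (F *+ 2)).
Hypothesis rEF : scal (qq C) * lie_bracket E F
  = fmx_diag (fun i => qexp (d i)) - fmx_diag (fun i => qexp (- d i)).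

(** The relation for [E,F] contains a quotient by q - q^-1; it is required in [rEF] after
    multiplication by this factor, which can be cancelled in matrices over power series. *)
Lemma suh_kill r : suh_rel r -> Phi r = 0.
Proof.
have [Pl _ _] := Ph.
case=> ->.
- by rewrite (slinB Pl) (ahom_bracket Ph) (ahomMn Ph) rHE subrr.
- by rewrite (slinD Pl) (ahom_bracket Ph) (ahomMn Ph) rHF addNr.
rewrite (slinB Pl) (ahom_bracket Ph); apply/eqP; rewrite subr_eq0; apply/eqP.
by apply: fmx_qq_cancel; rewrite (hexp_quot Ph HE).
Qed.

End SuhKill.

Section Spin.
Variables (R : realType) (n : nat).
Local Notation C := R[i].
Local Notation K := {fps C}.
Local Notation real := (real_complex R).

(** The eigenvalue 2m of H on the basis vector with index i = j + m, where n = 2j. *)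
Definition wt (n i : nat) : C := i%:R *+ 2 - n%:R.

Lemma wtE (i : 'I_n.+1) : spin_m C i *+ 2 = wt n i.
Proof.
rewrite /spin_m /wt mulrnBl; congr (_ - _).
by rewrite -[n%:R / 2 *+ 2]mulr_natr divfK // pnatr_eq0.
Qed.

Lemma wtS i : wt n i.+1 = wt n i + 2.
Proof. by rewrite /wt -natr1 mulrnDl addrAC. Qed.

Definition rup (i : nat) : C := real (Num.sqrt (i.+1 * (n - i))%N%:R).
Definition rdn (i : nat) : C := real (Num.sqrt (i * (n - i).+1)%N%:R).

Lemma sqrt_natM m : real (Num.sqrt m%:R) * real (Num.sqrt m%:R) = m%:R.
Proof. by rewrite -rmorphM -expr2 sqr_sqrtr ?ler0n // rmorph_nat. Qed.

Lemma rdn0 : rdn 0 = 0.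
Proof. by rewrite /rdn mul0n sqrtr0 rmorph0. Qed.

Lemma rho_genE g : mx_fmx (rho_gen R n g) = match g with
  | gE => ladder_up rup
  | gF => ladder_down rdn
  | gH => fmx_diag (fun i : 'I_n.+1 => wt n i)
  end.
Proof.
apply: fmxP => k i; rewrite /mx_fmx mxE; case: g => //.
rewrite /fmx_diag; case: eqP => [->|_]; rewrite ?mulr0 // mulr1.
exact: wtE.
Qed.

Lemma rho_rel0 r : su2_rel r ->
  wsum id (fun w : seq su2_gen => \prod_(g <- w) rho_gen R n g) r = 0.
Proof.
have Ph := wsum_prod_ahom (rho_gen R n).
set Phi := wsum _ _ in Ph *; have [Pl _ _] := Ph.
have Pg g : Phi (letter C g) = rho_gen R n g by exact: wsum_letter.
have mh := @mx_fmx_ahom C n.+1; have [ml _ _] := mh.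
have inj x : mx_fmx x = 0 -> x = 0 :> 'M_n.+1.
  by move=> e; apply/matrixP => k i; rewrite mxE -[LHS]/(mx_fmx x k i) e.
case=> ->; apply: inj.
- rewrite (slinB Pl) (ahom_bracket Ph) (ahomMn Ph) !Pg (slinB ml) (ahom_bracket mh).
  rewrite (ahomMn mh) !rho_genE ladder_weight_up ?subrr // => i _.
  exact: wtS.
- rewrite (slinD Pl) (ahom_bracket Ph) (ahomMn Ph) !Pg (slinD ml) (ahom_bracket mh).
  rewrite (ahomMn mh) !rho_genE ladder_weight_down ?addNr // => i _.
  exact: wtS.
rewrite (slinB Pl) (ahom_bracket Ph) !Pg (slinB ml) (ahom_bracket mh) !rho_genE.
rewrite ladder_bracket; first last.
- by rewrite /rup subnn muln0 sqrtr0 rmorph0.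
- exact: rdn0.
apply/eqP; rewrite subr_eq0; apply/eqP; apply: fmxP => k i.
rewrite /fmx_diag; congr (_ * _).
have kn : (k <= n)%N by rewrite -ltnS.
(* Raising and lowering between neighbours carry the same square root. What remains is k(n-k+1) -
   (k+1)(n-k) = 2k - n, the undeformed form of [qint_bracket]. *)
have -> : rup k.-1 * rdn k = (k * (n - k).+1)%N%:R.
  have [k0|k0] := posnP k; first by rewrite k0 rdn0 mulr0 mul0n.
  by rewrite /rup /rdn prednK // -subSn // -subSS -[k.-1.+1]/(_.+1) prednK // sqrt_natM.
have -> : rdn k.+1 * rup k = (k.+1 * (n - k))%N%:R.
  rewrite /rup /rdn; have [kn'|nk] := ltnP k n; first by rewrite subnSK // sqrt_natM.
  by have /eqP -> : (n - k == 0)%N; rewrite ?subn_eq0 // !muln0 sqrtr0 rmorph0 mulr0.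
rewrite /wt !natrM -!natr1 natrB // mulr2n; ring.
Qed.

Lemma rho_ahom : ahom (@rho R n).
Proof. exact: pres_lift_ahom rho_rel0. Qed.

Definition Rr (x : U R) : fmx C 'I_n.+1 := mx_fmx (rho n x).
Lemma Rr_ahom : ahom Rr.
Proof. exact: ahom_comp rho_ahom (@mx_fmx_ahom C n.+1). Qed.

Definition qup (i : nat) : K :=
  fps_map real (qexp (i%:R - n%:R / 2 + 1) * fps_sqrt (qint R i.+1 * qint R (n - i)%N)).
Definition qdn (i : nat) : K :=
  fps_map real (qexp (- (i%:R - n%:R / 2)) * fps_sqrt (qint R i * qint R (n - i).+1%N)).

Lemma qup_top : qup n = 0.
Proof. by rewrite /qup subnn qint0 mulr0 fps_sqrt0 mulr0 fps_map_rmorph0. Qed.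
Lemma qdn0 : qdn 0 = 0.
Proof. by rewrite /qdn qint0 mul0r fps_sqrt0 mulr0 fps_map_rmorph0. Qed.

Lemma qint_prod_gt0 i j : (0 < i)%N -> (0 < j)%N -> 0 < (qint R i * qint R j) 0%N.
Proof.
move=> i0 j0; rewrite fps_coefM big_ord_recl big_ord0 addr0 subn0 !qint_coef0.
by rewrite -natrM ltr0n muln_gt0 i0.
Qed.

(** The constant term is the undeformed square root of i(n-i+1). So the lowering coefficients are
    units of C[[hbar]], which is what all arguments along the ladder rest on. *)
Lemma qdn_neq0 i : (0 < i <= n)%N -> qdn i 0%N != 0.
Proof.
move=> /andP[i0 ni]; have := qint_prod_gt0 i0 (ltn0Sn (n - i)).
set x := qint R i * _ => x0; have [_ s0] := fps_sqrtP x0.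
rewrite fmorph_eq0 fps_coefM big_ord_recl big_ord0 addr0 subn0 s0.
rewrite mulf_neq0 //; last by rewrite sqrtr_eq0 -ltNge.
by rewrite /= fact0 invr1 mul1r expr0 oner_neq0.
Qed.

(** Raising from m and lowering from m + 1 carry the factors q^(m+1) and q^(-m-1), which cancel. *)
Lemma qup_qdn i : (i < n)%N -> qup i * qdn i.+1 = qint C i.+1 * qint C (n - i).
Proof.
move=> ni; rewrite /qup /qdn subnSK // -fps_map_rmorphM mulrACA -qexpD.
have -> : i%:R - n%:R / 2 + 1 - (i.+1%:R - n%:R / 2) = 0 :> R by rewrite -natr1; ring.
have x0 : 0 < (qint R i.+1 * qint R (n - i)) 0%N by rewrite qint_prod_gt0 // subn_gt0.
by have [-> _] := fps_sqrtP x0; rewrite qexp0 mul1r fps_map_rmorphM !fps_map_qint.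
Qed.

Lemma qladder_bracket :
  scal (qq C) * lie_bracket (@ladder_up K n qup) (@ladder_down K n qdn)
  = fmx_diag (fun i : 'I_n.+1 => qexp (wt n i))
    - fmx_diag (fun i : 'I_n.+1 => qexp (- wt n i)).
Proof.
rewrite ladder_bracket ?qdn0 ?qup_top // fmx_diagB.
rewrite fmx_diagZ; apply: eq_fmx_diag => i.
have ni : (i <= n)%N by rewrite -ltnS.
apply: etrans (qint_bracket C ni); congr (_ * (_ - _)).
  have [i0|i0] := posnP i; first by rewrite i0 qdn0 qint0 mulr0 mul0r.
  have lt_in : (i.-1 < n)%N by rewrite prednK.
  have := qup_qdn lt_in; rewrite (prednK i0) => qe; apply: etrans qe _.
  by congr (_ * qint C _); rewrite -subSS (prednK i0) subSn.
have [ni'|ni'] := ltnP i n; first exact: etrans (mulrC _ _) (qup_qdn ni').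
have -> : nat_of_ord i = n by apply/eqP; rewrite eqn_leq ni.
by rewrite qup_top subnn qint0 mulr0 mulr0.
Qed.

Lemma cst_wtS i : (i < n)%N -> fps_cst (wt n i.+1) = fps_cst (wt n i) + 2 :> K.
Proof.
move=> _; rewrite wtS fps_cstD; congr (_ + _).
by rewrite (_ : 2 = 1 + 1) // fps_cstD.
Qed.

Definition Rhoh (x : Uh R) : fmx K 'I_n.+1 := fun k i => rhoh_coef x k i.

Definition rhoh_word (x : {fps free_alg C su2_gen}) : fmx K 'I_n.+1 :=
  fun k i => fps_map (fun M : 'M[C]_n.+1 => M k i)
    (hwsum id (fun w : seq su2_gen => \prod_(g <- w) rhoh_gen R n g) x).

Lemma rhoh_word_ahom : ahom rhoh_word.
Proof.
have h1 := hwsum_prod_ahom (rhoh_gen R n).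
have h2 := ahom_fps_map (@mx_fmx_ahom C n.+1).
exact: ahom_comp (ahom_comp h1 h2) (@fps_fmx_ahom C 'I_n.+1).
Qed.

Lemma rhoh_word_letter g : rhoh_word (fps_cst (letter C g)) = match g with
  | gE => ladder_up qup
  | gF => ladder_down qdn
  | gH => fmx_diag (fun i : 'I_n.+1 => fps_cst (wt n i))
  end.
Proof.
apply: fmxP => k i; rewrite /rhoh_word hwsum_letter.
have -> : fps_map (fun M : 'M[C]_n.+1 => M k i) (rhoh_gen R n g) = rhoh_entry R g k i.
  by apply: fpsP => m; rewrite /= mxE.
case: g => //=; rewrite /fmx_diag; case: eqP => [->|_]; rewrite ?mulr0 // mulr1.
by rewrite wtE.
Qed.

Lemma suh_rel_rhoh r : suh_rel r -> rhoh_word r = 0.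
Proof.
have e := rhoh_word_letter.
apply: (suh_kill rhoh_word_ahom (d := fun i => wt n i)); rewrite ?e //.
- exact: (@ladder_weight_up K n qup (fun i => fps_cst (wt n i)) cst_wtS).
- exact: (@ladder_weight_down K n qdn (fun i => fps_cst (wt n i)) cst_wtS).
exact: qladder_bracket.
Qed.

Lemma Rhoh_pi x : Rhoh (\pi_(Uh R) x) = rhoh_word x.
Proof.
have [hl _ _] := rhoh_word_ahom.
apply: (repr_hpresented (@separated_fmx C 'I_n.+1) (f := rhoh_word)) => //.
by move=> s t r Sr; exact: ideal_gen_ahom0 rhoh_word_ahom suh_rel_rhoh _ _ _ Sr.
Qed.

Lemma Rhoh_ahom : ahom Rhoh.
Proof.
exact: hpresented_ahom rhoh_word_ahom Rhoh_pi.
Qed.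

Lemma Rhoh_gen g : Rhoh (Uh_gen R g) = rhoh_word (fps_cst (letter C g)).
Proof. exact: Rhoh_pi. Qed.

End Spin.

Section DiagLadder.
Variables (K : comPzRingType) (n : nat) (e d : nat -> K) (c : K).
Local Notation D := (fmx_diag (fun i : 'I_n.+1 => d i)).

Lemma diag_ladder_up : (forall i, (i < n)%N -> d i.+1 = c * d i) ->
  D * @ladder_up K n e = scal c * (@ladder_up K n e * D).
Proof.
move=> dS; apply: fmxP => k i; rewrite fmxZE fmx_diagMl fmx_diagMr /ladder_up.
case: eqP => [ki|_]; last by rewrite mul0r !mulr0.
by rewrite ki dS; [ring | rewrite -ltnS -ki ltn_ord].
Qed.

Lemma diag_ladder_down : (forall i, (i < n)%N -> d i = c * d i.+1) ->
  D * @ladder_down K n e = scal c * (@ladder_down K n e * D).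
Proof.
move=> dS; apply: fmxP => k i; rewrite fmxZE fmx_diagMl fmx_diagMr /ladder_down.
case: eqP => [ki|_]; last by rewrite mul0r !mulr0.
have kn : (k < n)%N by rewrite -ltnS ki ltn_ord.
rewrite -ki (dS k kn); ring.
Qed.
End DiagLadder.

Section KronBracket.
Variables (K : comPzRingType) (I J : finType).
Implicit Types (a x : fmx K I) (b y : fmx K J).

Lemma kron_bracket a x b y :
  lie_bracket (kron a 1 + kron 1 b) (kron x y)
  = kron (lie_bracket a x) y + kron x (lie_bracket b y).
Proof.
rewrite /lie_bracket mulrDl mulrDr !kronM !mul1r !mulr1.
rewrite (slinB (@kron_slinl _ _ _ y)) (slinB (@kron_slinr _ _ _ x)).
by rewrite opprD addrACA.
Qed.

Lemma bracketDr (A : pzRingType) (u v w : A) :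
  lie_bracket u (v + w) = lie_bracket u v + lie_bracket u w.
Proof. by rewrite /lie_bracket mulrDr mulrDl opprD addrACA. Qed.
Lemma bracket1 (A : pzRingType) (u : A) : lie_bracket u 1 = 0.
Proof. by rewrite /lie_bracket mulr1 mul1r subrr. Qed.
Lemma diag_bracket (d d' : I -> K) : lie_bracket (fmx_diag d) (fmx_diag d') = 0.
Proof.
apply/eqP; rewrite subr_eq0 !fmx_diagM; apply/eqP.
by apply: eq_fmx_diag => i; rewrite mulrC.
Qed.
Lemma kron0l y : kron (0 : fmx K I) y = 0.
Proof. by rewrite (slin0 (@kron_slinl _ _ _ y)). Qed.
Lemma kron0r x : kron x (0 : fmx K J) = 0.
Proof. by rewrite (slin0 (@kron_slinr _ _ _ x)). Qed.
Lemma kron_Mn x y n : kron (x *+ n) y = kron x y *+ n.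
Proof.
elim: n => [|n IHn]; first by rewrite !mulr0n kron0l.
by rewrite !mulrS (slinD (@kron_slinl _ _ _ y)) IHn.
Qed.
Lemma kron_Mnr x y n : kron x (y *+ n) = kron x y *+ n.
Proof.
elim: n => [|n IHn]; first by rewrite !mulr0n kron0r.
by rewrite !mulrS (slinD (@kron_slinr _ _ _ x)) IHn.
Qed.
Lemma kron_diag (d : I -> K) (d' : J -> K) :
  kron (fmx_diag d) (fmx_diag d') = fmx_diag (fun i => d i.1 * d' i.2).
Proof.
apply: fmxP => -[i i'] [k k']; rewrite /kron /fmx_diag xpair_eqE /= -mulnb natrM.
by rewrite mulrACA.
Qed.
Lemma kron_diagl (d : I -> K) :
  kron (fmx_diag d) (1 : fmx K J) = fmx_diag (fun i => d i.1).
Proof.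
have -> : (1 : fmx K J) = fmx_diag (fun=> 1).
  by apply: fmxP => i k; rewrite /fmx_diag mul1r.
by rewrite kron_diag; apply: eq_fmx_diag => i; rewrite mulr1.
Qed.
Lemma kron_diagr (d : J -> K) :
  kron (1 : fmx K I) (fmx_diag d) = fmx_diag (fun i => d i.2).
Proof.
have -> : (1 : fmx K I) = fmx_diag (fun=> 1).
  by apply: fmxP => i k; rewrite /fmx_diag mul1r.
by rewrite kron_diag; apply: eq_fmx_diag => i; rewrite mul1r.
Qed.

(* The q-bracket relation for [E (x) k + 1 (x) E] and [F (x) 1 + k^-1 (x) F];
   the cross terms cancel because [c] measures both commutations. *)
Lemma coproduct_bracket c c' (e1 f1 k1 k1' : fmx K I) (e2 f2 k2 k2' : fmx K J) :
  scal c * lie_bracket e1 f1 = k1 - k1' -> scal c * lie_bracket e2 f2 = k2 - k2' ->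
  k1' * e1 = scal c' * (e1 * k1') -> k2 * f2 = scal c' * (f2 * k2) ->
  scal c * lie_bracket (kron e1 k2 + kron 1 e2) (kron f1 1 + kron k1' f2)
  = kron k1 k2 - kron k1' k2'.
Proof.
move=> r1 r2 ke kf.
have -> : lie_bracket (kron e1 k2 + kron 1 e2) (kron f1 1 + kron k1' f2)
    = kron (lie_bracket e1 f1) k2 + kron k1' (lie_bracket e2 f2)
      + (kron (e1 * k1') (k2 * f2) - kron (k1' * e1) (f2 * k2)).
  rewrite /lie_bracket !mulrDl !mulrDr !kronM !mul1r !mulr1.
  rewrite (slinB (@kron_slinl _ _ _ k2)) (slinB (@kron_slinr _ _ _ k1')).
  apply: fmxP => i k; rewrite !(fmxDE, fmxNE).
  ring.
rewrite ke kf (slinZ (@kron_slinl _ _ _ _)) (slinZ (@kron_slinr _ _ _ _)) subrr addr0.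
rewrite mulrDr -(slinZ (@kron_slinl _ _ _ _)) -(slinZ (@kron_slinr _ _ _ _)) r1 r2.
rewrite (slinB (@kron_slinl _ _ _ _)) (slinB (@kron_slinr _ _ _ _)).
by rewrite addrA subrK.
Qed.
End KronBracket.

Section CtensHexp.
Variables (F : numFieldType) (A B : pzAlgType {fps F}) (I J : finType).
Variables (f : A -> fmx {fps F} I) (g : B -> fmx {fps F} J).
Hypotheses (fh : ahom f) (gh : ahom g).

Lemma ctens_rep_l a : ctens_rep f g (ctensl B a) = kron (f a) 1.
Proof. by have [_ _ <-] := gh; rewrite ctensl_pure; exact: ctens_rep_pure. Qed.
Lemma ctens_rep_r b : ctens_rep f g (ctensr A b) = kron 1 (g b).
Proof. by have [_ _ <-] := fh; rewrite ctensr_pure; exact: ctens_rep_pure. Qed.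

Lemma ctens_rep_hexpl a (d : I -> F) : f a = fmx_diag (fun i => fps_cst (d i)) ->
  ctens_rep f g (hexpl B a) = kron (fmx_diag (fun i => qexp (d i))) 1.
Proof.
move=> fa; have h := ahom_comp (@pi_ctens_ahom _ A B) (ctens_rep_ahom fh gh).
rewrite kron_diagl; apply: (hexp_diag (d := fun i => d i.1) h).
by apply: etrans (ctens_rep_l a) _; rewrite fa kron_diagl.
Qed.
Lemma ctens_rep_hexpr b (d : J -> F) : g b = fmx_diag (fun i => fps_cst (d i)) ->
  ctens_rep f g (hexpr A b) = kron 1 (fmx_diag (fun i => qexp (d i))).
Proof.
move=> gb; have h := ahom_comp (@pi_ctens_ahom _ A B) (ctens_rep_ahom fh gh).
rewrite kron_diagr; apply: (hexp_diag (d := fun i => d i.2) h).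
by apply: etrans (ctens_rep_r b) _; rewrite gb kron_diagr.
Qed.
End CtensHexp.

Section CoproductRep.
Variables (R : realType) (n1 n2 : nat).
Local Notation C := R[i].
Local Notation K := {fps C}.
Local Notation I1 := 'I_n1.+1.
Local Notation I2 := 'I_n2.+1.

Definition Rhoh2 : UUh R -> fmx K (I1 * I2)%type := ctens_rep (@Rhoh R n1) (@Rhoh R n2).

Lemma Rhoh2E i1 i2 k1 k2 t :
  rhoh2_coef i1 i2 k1 k2 t = Rhoh2 t (i1, i2) (k1, k2).
Proof. by []. Qed.

Lemma Rhoh2_ahom : ahom Rhoh2.
Proof. exact: ctens_rep_ahom (@Rhoh_ahom R n1) (@Rhoh_ahom R n2). Qed.

Lemma Rhoh2_pure a b : Rhoh2 (ctpure a b) = kron (@Rhoh R n1 a) (@Rhoh R n2 b).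
Proof. exact: ctens_rep_pure (@Rhoh_ahom R n1) (@Rhoh_ahom R n2) a b. Qed.

Lemma Rhoh2_l a : Rhoh2 (ctensl (Uh R) a) = kron (@Rhoh R n1 a) 1.
Proof. exact: ctens_rep_l (@Rhoh_ahom R n1) (@Rhoh_ahom R n2) a. Qed.
Lemma Rhoh2_r b : Rhoh2 (ctensr (Uh R) b) = kron 1 (@Rhoh R n2 b).
Proof. exact: ctens_rep_r (@Rhoh_ahom R n1) (@Rhoh_ahom R n2) b. Qed.

Definition Uh_Delta_gen (g : su2_gen) : UUh R :=
  let E := Uh_gen R gE in let H := Uh_gen R gH in let F := Uh_gen R gF in
  match g with
  | gE => ctensl (Uh R) E * hexpr (Uh R) H + ctensr (Uh R) E
  | gF => ctensl (Uh R) F + hexpl (Uh R) (- H) * ctensr (Uh R) F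
  | gH => ctensl (Uh R) H + ctensr (Uh R) H
  end.

Lemma Uh_DeltaE : @Uh_Delta R = ctens_lift Uh_Delta_gen.
Proof. by []. Qed.

Definition RDelta_word (x : {fps free_alg C su2_gen}) : fmx K (I1 * I2)%type :=
  Rhoh2 (ctens_word Uh_Delta_gen x).

Lemma RDelta_word_ahom : ahom RDelta_word.
Proof. exact: ahom_comp (ctens_word_ahom Uh_Delta_gen) Rhoh2_ahom. Qed.

Lemma RDelta_word_gen g :
  RDelta_word (fps_cst (letter C g)) = Rhoh2 (Uh_Delta_gen g).
Proof.
have e := ctens_word_letter Uh_Delta_gen g; exact: (f_equal (Rhoh2 : _ -> fmx K _) e).
Qed.

Local Notation K1 := (fmx_diag (fun i : I1 => qexp (wt R n1 i))).
Local Notation K1' := (fmx_diag (fun i : I1 => qexp (- wt R n1 i))).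
Local Notation K2 := (fmx_diag (fun i : I2 => qexp (wt R n2 i))).
Local Notation K2' := (fmx_diag (fun i : I2 => qexp (- wt R n2 i))).
Local Notation H1 := (fmx_diag (fun i : I1 => fps_cst (wt R n1 i))).
Local Notation H2 := (fmx_diag (fun i : I2 => fps_cst (wt R n2 i))).
Local Notation E1 := (@ladder_up K n1 (qup R n1)).
Local Notation E2 := (@ladder_up K n2 (qup R n2)).
Local Notation F1 := (@ladder_down K n1 (qdn R n1)).
Local Notation F2 := (@ladder_down K n2 (qdn R n2)).

Definition wt2 (i : I1 * I2) := wt R n1 i.1 + wt R n2 i.2.

Lemma Rhoh2_hexpr : Rhoh2 (hexpr (Uh R) (Uh_gen R gH)) = kron 1 K2.
Proof.
apply: (ctens_rep_hexpr (@Rhoh_ahom R n1) (@Rhoh_ahom R n2)).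
by rewrite Rhoh_gen rhoh_word_letter.
Qed.

Lemma Rhoh2_hexpl : Rhoh2 (hexpl (Uh R) (- Uh_gen R gH)) = kron K1' 1.
Proof.
have [Rl _ _] := @Rhoh_ahom R n1.
apply: (ctens_rep_hexpl (@Rhoh_ahom R n1) (@Rhoh_ahom R n2)).
rewrite (slinN Rl) Rhoh_gen rhoh_word_letter.
by apply: fmxP => x y; rewrite fmxNE /fmx_diag fps_cstN mulNr.
Qed.

Lemma RDelta_E : RDelta_word (fps_cst (letter C gE)) = kron E1 K2 + kron 1 E2.
Proof.
have [hl hM _] := Rhoh2_ahom; apply: etrans (RDelta_word_gen _) _.
apply: etrans (slinD hl _ _) _; congr (_ + _).
  apply: etrans (hM _ _) _; apply: etrans (congr2 *%R (Rhoh2_l _) Rhoh2_hexpr) _.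
  by rewrite kronM mulr1 mul1r Rhoh_gen rhoh_word_letter.
by apply: etrans (Rhoh2_r _) _; rewrite Rhoh_gen rhoh_word_letter.
Qed.

Lemma RDelta_F : RDelta_word (fps_cst (letter C gF)) = kron F1 1 + kron K1' F2.
Proof.
have [hl hM _] := Rhoh2_ahom; apply: etrans (RDelta_word_gen _) _.
apply: etrans (slinD hl _ _) _; congr (_ + _).
  by apply: etrans (Rhoh2_l _) _; rewrite Rhoh_gen rhoh_word_letter.
apply: etrans (hM _ _) _; apply: etrans (congr2 *%R Rhoh2_hexpl (Rhoh2_r _)) _.
by rewrite kronM mulr1 mul1r Rhoh_gen rhoh_word_letter.
Qed.

Lemma RDelta_H : RDelta_word (fps_cst (letter C gH)) = kron H1 1 + kron 1 H2.
Proof.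
have [hl hM _] := Rhoh2_ahom; apply: etrans (RDelta_word_gen _) _.
apply: etrans (slinD hl _ _) _; congr (_ + _).
  by apply: etrans (Rhoh2_l _) _; rewrite Rhoh_gen rhoh_word_letter.
by apply: etrans (Rhoh2_r _) _; rewrite Rhoh_gen rhoh_word_letter.
Qed.

Lemma RDelta_H_diag :
  RDelta_word (fps_cst (letter C gH)) = fmx_diag (fun i => fps_cst (wt2 i)).
Proof.
rewrite RDelta_H kron_diagl kron_diagr; apply: fmxP => i k.
by rewrite fmxDE /fmx_diag -mulrDl -fps_cstD.
Qed.

(** Raising changes the weight by 2, hence the constant q^-2. The same constant in
    [qexp_ladder_down] is what makes the cross terms of the coproduct cancel. *)
Lemma qexp_ladder_up n : fmx_diag (fun i : 'I_n.+1 => qexp (- wt R n i)) * @ladder_up K n (qup R n)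
  = scal (qexp (- 2)) * (@ladder_up K n (qup R n) * fmx_diag (fun i : 'I_n.+1 => qexp (- wt R n i))).
Proof.
apply: (@diag_ladder_up K n (qup R n) (fun i => qexp (- wt R n i))) => i _.
by rewrite wtS opprD addrC qexpD.
Qed.

Lemma qexp_ladder_down n : fmx_diag (fun i : 'I_n.+1 => qexp (wt R n i)) * @ladder_down K n (qdn R n)
  = scal (qexp (- 2)) * (@ladder_down K n (qdn R n) * fmx_diag (fun i : 'I_n.+1 => qexp (wt R n i))).
Proof.
apply: (@diag_ladder_down K n (qdn R n) (fun i => qexp (wt R n i))) => i _.
by rewrite -qexpD wtS addrC addrK.
Qed.

Lemma suh_rel_RDelta r : suh_rel r -> RDelta_word r = 0.
Proof.
apply: (suh_kill RDelta_word_ahom RDelta_H_diag).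
- rewrite RDelta_H RDelta_E bracketDr !kron_bracket diag_bracket !bracket1 kron0l kron0r.
  rewrite (@ladder_weight_up K n1 _ (fun i => fps_cst (wt R n1 i)) (@cst_wtS R n1)).
  rewrite (@ladder_weight_up K n2 _ (fun i => fps_cst (wt R n2 i)) (@cst_wtS R n2)).
  by rewrite addr0 add0r kron_Mn kron_Mnr mulrnDl.
- rewrite RDelta_H RDelta_F bracketDr !kron_bracket diag_bracket !bracket1 kron0l kron0r.
  rewrite (@ladder_weight_down K n1 _ (fun i => fps_cst (wt R n1 i)) (@cst_wtS R n1)).
  rewrite (@ladder_weight_down K n2 _ (fun i => fps_cst (wt R n2 i)) (@cst_wtS R n2)).
  rewrite addr0 add0r (slinN (@kron_slinl _ _ _ _)) (slinN (@kron_slinr _ _ _ _)).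
  rewrite kron_Mn kron_Mnr mulrnDl.
  exact: esym (opprD _ _).
rewrite RDelta_E RDelta_F.
apply: etrans (coproduct_bracket (qladder_bracket R n1) (qladder_bracket R n2)
  (qexp_ladder_up n1) (qexp_ladder_down n2)) _.
apply: (f_equal2 (fun x y : fmx K (I1 * I2)%type => x - y)).
  by apply: etrans (kron_diag _ _) _; apply: eq_fmx_diag => i;
    exact: esym (qexpD _ _).
apply: etrans (kron_diag _ _) _; apply: eq_fmx_diag => i.
exact: etrans (esym (qexpD _ _)) (congr1 (@qexp C) (esym (opprD _ _))).
Qed.

(** The coproduct followed by a pair of spin representations. [suh_rel_RDelta] makes it a
    homomorphism, and the coproduct enters the later arguments in this form. *)
Definition RDelta (x : Uh R) : fmx K (I1 * I2)%type :=
  Rhoh2 (ctens_lift Uh_Delta_gen x).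

Lemma RDeltaE x : Rhoh2 (Uh_Delta x) = RDelta x.
Proof. by rewrite Uh_DeltaE. Qed.

Lemma RDelta_gen g : RDelta (Uh_gen R g) = RDelta_word (fps_cst (letter C g)).
Proof.
have e := @ctens_lift_letter C su2_gen (@suh_rel R) (Uh R) (Uh R) Uh_Delta_gen _ Rhoh2
  (@separated_fmx C _) Rhoh2_ahom suh_rel_RDelta g.
apply: etrans e _; exact: esym (RDelta_word_gen g).
Qed.

Lemma RDelta_ahom : ahom RDelta.
Proof.
have e := @ctens_lift_ahom C su2_gen (@suh_rel R) (Uh R) (Uh R) Uh_Delta_gen _ Rhoh2
  (@separated_fmx C _) Rhoh2_ahom suh_rel_RDelta.
exact: e.
Qed.

End CoproductRep.

(** * Recoupling of Clebsch-Gordan coefficients *)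

Section LadderSchur.
Variables (K : comPzRingType) (d d' : nat) (f f' : nat -> K).
Variable G : 'I_d.+1 -> 'I_d'.+1 -> K.
Hypothesis f_reg : forall i x, (0 < i <= d)%N -> f i * x = 0 -> x = 0.
Hypothesis f'_reg : forall i x, (0 < i <= d')%N -> f' i * x = 0 -> x = 0.
Hypothesis G_weight : forall (m : 'I_d.+1) (m' : 'I_d'.+1), (m.*2 + d' != m'.*2 + d)%N -> G m m' = 0.
Hypothesis G_comm : forall (m : 'I_d.+1) (m' : 'I_d'.+1),
  \sum_k G m k * @ladder_down K d' f' k m' = \sum_k @ladder_down K d f m k * G k m'.

(** Extension by zero to natural numbers, so that the inductions along the ladder need not handle
    bounded indices. *)
Let g m m' := if (m <= d)%N && (m' <= d')%N then G (inord m) (inord m') else 0.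

Let gE (m : 'I_d.+1) (m' : 'I_d'.+1) : g m m' = G m m'.
Proof.
have md : (m <= d)%N by rewrite -ltnS.
have md' : (m' <= d')%N by rewrite -ltnS.
by rewrite /g md md' /= !inord_val.
Qed.

Let g_comm m m' : (m <= d)%N -> (m' <= d')%N ->
  (if m' is k.+1 then g m k * f' m' else 0)
  = (if (m < d)%N then f m.+1 * g m.+1 m' else 0).
Proof.
move=> md md'; have := G_comm (inord m) (inord m').
rewrite /ladder_down !inordK ?ltnS // => e.
have -> : (if m' is k.+1 then g m k * f' m' else 0)
    = \sum_k G (inord m) k * (if k.+1 == m' then f' m' else 0).
  case: m' md' {e} => [|k] kd'.
    by rewrite big1 // => k _; rewrite mulr0.
  have kd : (k < d'.+1)%N by rewrite ltnS ltnW.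
  rewrite (bigD1 (Ordinal kd)) //= eqxx big1 ?addr0 => [|j /eqP jk].
    rewrite /g md (ltnW kd') /=; congr (G _ _ * _).
    by apply: val_inj; rewrite /= inordK.
  case: eqP => [[jk']|_]; last by rewrite mulr0.
  by case: jk; apply: val_inj.
rewrite e; case: ltnP => [lt_md|dm].
  have md1 : (m.+1 < d.+1)%N by [].
  rewrite (bigD1 (Ordinal md1)) //= eqxx big1 ?addr0 => [|j /eqP jk].
    rewrite /g lt_md md' /=; congr (_ * G _ _).
    by apply: val_inj; rewrite /= inordK.
  case: eqP => [jk'|_]; last by rewrite mul0r.
  by case: jk; apply: val_inj.
rewrite big1 // => k _; case: eqP => [km|_]; last by rewrite mul0r.
by move: (ltn_ord k); rewrite -km ltnS ltnNge dm.
Qed.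

Let g_weight m m' : (m.*2 + d' != m'.*2 + d)%N -> g m m' = 0.
Proof.
rewrite /g; case: andP => // -[md md'] ne.
by apply: G_weight; rewrite !inordK.
Qed.

(** Schur's lemma from weights and lowering alone. The weights 2m - d and 2m' - d' must agree, which
    leaves a single diagonal of [G]; unequal lengths force a zero at one end of it, and regularity
    of the lowering coefficients spreads it. *)
Lemma schur_neq : d != d' -> forall m m', G m m' = 0.
Proof.
move=> dd' m m'; rewrite -gE.
have [e|] := eqVneq (m.*2 + d')%N (m'.*2 + d)%N; last exact: g_weight.
have md : (m <= d)%N by rewrite -ltnS.
have md' : (m' <= d')%N by rewrite -ltnS.
case: (ltngtP d d') dd' => // [lt_dd'|lt_d'd] _.
  have [s sE] : exists s, (m' = m + s :> nat)%N by exists (m' - m)%N; lia.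
  have s0 : (0 < s)%N by lia.
  have ds : (d' = d + s.*2)%N by lia.
  rewrite sE; clear e sE md'.
  (* The descent starts at the top index d, whose row in the shorter lowering matrix is zero. *)
  suff H : forall k, (k <= d)%N -> g (d - k)%N (d - k + s)%N = 0.
    by have := H (d - m)%N (leq_subr _ _); rewrite subKn.
  elim=> [|k IHk] kd.
    rewrite subn0; have l1 : (d + s < d')%N by lia.
    have := g_comm (leqnn d) l1; rewrite ltnn mulrC => /f'_reg -> //.
  have l1 : (d - k.+1 + s < d')%N by lia.
  have := g_comm (leq_subr k.+1 d) l1.
  have -> : (d - k.+1 < d)%N by lia.
  have -> : (d - k.+1).+1 = (d - k)%N by lia.
  rewrite -addSn; have -> : (d - k.+1).+1 = (d - k)%N by lia.
  rewrite IHk 1?ltnW // mulr0 mulrC => /f'_reg -> //.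
  by lia.
have [s sE] : exists s, (m = m' + s :> nat)%N by exists (m - m')%N; lia.
have s0 : (0 < s)%N by lia.
have ds : (d = d' + s.*2)%N by lia.
rewrite sE; clear e sE md.
(* The ascent starts at the index 0, whose column in the shorter lowering matrix is zero. *)
elim: (nat_of_ord m') md' => [|k IHk] kd.
  have l1 : (s.-1 <= d)%N by lia.
  have := g_comm l1 (leq0n d').
  have -> : (s.-1 < d)%N by lia.
  by rewrite prednK // add0n => /esym/f_reg -> //; lia.
have l1 : (k + s <= d)%N by lia.
have := g_comm l1 kd; have -> : (k + s < d)%N by lia.
rewrite IHk 1?ltnW // mul0r -addSn => /esym/f_reg -> //.
by lia.
Qed.

(** Equal weights now mean the main diagonal; commutation gives f (m+1) g m m = f (m+1) g (m+1)
    (m+1), so all diagonal entries equal the top one. *)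
Lemma schur_eq : d = d' -> (forall i, f i = f' i) ->
  forall (m : 'I_d.+1) (m' : 'I_d'.+1),
    G m m' = g d d' * (m == m' :> nat)%:R.
Proof.
move=> dd' ff' m m'; rewrite -gE.
case: eqP => [<-|ne]; last first.
  by rewrite mulr0 g_weight //; apply/eqP => e; apply: ne; lia.
rewrite mulr1 -dd'; have md : (m <= d)%N by rewrite -ltnS.
suff H : forall k, (k <= d)%N -> g (d - k)%N (d - k)%N = g d d.
  by have := H (d - m)%N (leq_subr _ _); rewrite subKn.
elim=> [|k IHk] kd; first by rewrite subn0.
have l1 : (d - k.+1 < d')%N by lia.
have := g_comm (leq_subr k.+1 d) l1.
have -> : (d - k.+1 < d)%N by lia.
have -> : (d - k.+1).+1 = (d - k)%N by lia.
rewrite IHk 1?ltnW // mulrC -ff' => e; apply/eqP; rewrite -subr_eq0; apply/eqP.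
apply: (@f_reg (d - k)%N); first by lia.
by rewrite mulrBr e subrr.
Qed.

End LadderSchur.

Section Collapse.
Variables (K : comPzRingType) (N : nat) (p : pred nat).
Lemma collapse (A : forall j, 'I_j.+1 -> K) j (m : 'I_j.+1) :
  (j <= N)%N -> p j ->
  \sum_(j1 < N.+1 | p j1) \sum_(m1 < j1.+1) A j1 m1 * ((j1 == j :> nat) && (m1 == m :> nat))%:R
  = A j m.
Proof.
move=> jN pj; rewrite (bigD1 (Ordinal (jN : (j < N.+1)%N))) //= [X in _ + X]big1 ?addr0.
  rewrite (bigD1 m) //= !eqxx mulr1 big1 ?addr0 // => m1 m1m.
  by move: m1m; rewrite -val_eqE /= => /negPf->; rewrite mulr0.
move=> j1 /andP[_ j1j]; rewrite big1 // => m1 _.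
by move: j1j; rewrite -val_eqE /= => /negPf->; rewrite mulr0.
Qed.
End Collapse.

Section Recoupling.
Variables (K : comPzRingType) (X L L' : finType) (N Nw : nat) (wX : X -> nat).
Variables (f : nat -> nat -> K) (XF : X -> X -> K).
Hypothesis f_reg : forall n i x, (0 < i <= n)%N -> f n i * x = 0 -> x = 0.
Local Notation F n := (@ladder_down K n (f n)).

(* An orthonormal, complete family of intertwiners from the spin-j ladders,
   graded by weight; the multiplicity space is indexed by the J with [p J j]. *)
Record coupling (L0 : finType) (p : L0 -> pred nat)
    (M : L0 -> forall j, X -> 'I_j.+1 -> K) : Prop := Coupling {
  coupling_bound : forall J j, p J j -> (j <= N)%N;
  coupling_complete : forall x y,
    \sum_J \sum_(j < N.+1 | p J j) \sum_(m < j.+1) M J j x m * M J j y m = (x == y)%:R;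
  coupling_orth : forall J j J' j' (m : 'I_j.+1) (m' : 'I_j'.+1), p J j -> p J' j' ->
    \sum_x M J j x m * M J' j' x m' = ((J == J') && ((j == j') && (m == m' :> nat)))%:R;
  coupling_F : forall J j x (m : 'I_j.+1), p J j ->
    \sum_y XF x y * M J j y m = \sum_k M J j x k * F j k m;
  coupling_weight : forall J j x (m : 'I_j.+1), p J j ->
    ((wX x).*2 + j != m.*2 + Nw)%N -> M J j x m = 0
}.

Variables (p : L -> pred nat) (M : L -> forall j, X -> 'I_j.+1 -> K).
Variables (p' : L' -> pred nat) (M' : L' -> forall j, X -> 'I_j.+1 -> K).
Hypotheses (hM : coupling p M) (hM' : coupling p' M').

(** Overlaps of the two families. For the two bracketings of three spins their scalars are the
    recoupling (6j) coefficients. *)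
Let G J j J' j' (m : 'I_j.+1) (m' : 'I_j'.+1) := \sum_x M J x m * M' J' x m'.

Let M'E J' j' x (m' : 'I_j'.+1) :
  M' J' x m' = \sum_J \sum_(j < N.+1 | p J j) \sum_(m < j.+1) M J x m * G J J' m m'.
Proof.
transitivity (\sum_y (x == y)%:R * M' J' y m'); first by rewrite sum_deltal.
transitivity (\sum_y \sum_J \sum_(j < N.+1 | p J j) \sum_(m < j.+1)
    M J x m * (M J y m * M' J' y m')).
  apply: eq_bigr => y _; rewrite -(coupling_complete hM) mulr_suml.
  apply: eq_bigr => J _; rewrite mulr_suml; apply: eq_bigr => j _.
  by rewrite mulr_suml; apply: eq_bigr => m _; rewrite mulrA.
rewrite exchange_big; apply: eq_bigr => J _.
rewrite exchange_big; apply: eq_bigr => j _.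
rewrite exchange_big; apply: eq_bigr => m _.
by rewrite mulr_sumr.
Qed.

Let ME J j z (m : 'I_j.+1) :
  M J z m = \sum_J' \sum_(j' < N.+1 | p' J' j') \sum_(m' < j'.+1) M' J' z m' * G J J' m m'.
Proof.
transitivity (\sum_y M J y m * (y == z)%:R); first by rewrite sum_deltar.
transitivity (\sum_y \sum_J' \sum_(j' < N.+1 | p' J' j') \sum_(m' < j'.+1)
    M' J' z m' * (M J y m * M' J' y m')).
  apply: eq_bigr => y _; rewrite -(coupling_complete hM') mulr_sumr.
  apply: eq_bigr => J' _; rewrite mulr_sumr; apply: eq_bigr => j' _.
  by rewrite mulr_sumr; apply: eq_bigr => m' _; rewrite mulrA mulrC.
rewrite exchange_big; apply: eq_bigr => J' _.
rewrite exchange_big; apply: eq_bigr => j' _.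
rewrite exchange_big; apply: eq_bigr => m' _.
by rewrite mulr_sumr.
Qed.

(** The families intertwine [XF] acting from the left, and nothing is assumed about its transpose.
    So [XF] is not moved across the pairing: [M'] is expanded in [M] by completeness, [XF] is
    applied there, and orthonormality of [M] extracts the wanted row. *)
Let G_comm J j J' j' (m : 'I_j.+1) (m' : 'I_j'.+1) : p J j -> p' J' j' ->
  \sum_k G J J' m k * F j' k m' = \sum_k F j m k * G J J' k m'.
Proof.
move=> pj pj'.
transitivity (\sum_x M J x m * \sum_y XF x y * M' J' y m').
  transitivity (\sum_k \sum_x M J x m * M' J' x k * F j' k m').
    by apply: eq_bigr => k _; rewrite mulr_suml.
  rewrite exchange_big; apply: eq_bigr => x _.
  rewrite (coupling_F hM') // mulr_sumr; apply: eq_bigr => k _.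
  by rewrite mulrA.
transitivity (\sum_x M J x m * \sum_J1 \sum_(j1 < N.+1 | p J1 j1) \sum_(m1 < j1.+1)
     (\sum_k M J1 x k * F j1 k m1) * G J1 J' m1 m').
  apply: eq_bigr => x _; congr (_ * _).
  transitivity (\sum_y \sum_J1 \sum_(j1 < N.+1 | p J1 j1) \sum_(m1 < j1.+1)
      XF x y * M J1 y m1 * G J1 J' m1 m').
    apply: eq_bigr => y _; rewrite M'E mulr_sumr; apply: eq_bigr => J1 _.
    rewrite mulr_sumr; apply: eq_bigr => j1 _; rewrite mulr_sumr.
    by apply: eq_bigr => m1 _; rewrite mulrA.
  rewrite exchange_big; apply: eq_bigr => J1 _.
  rewrite exchange_big; apply: eq_bigr => j1 pj1.
  rewrite exchange_big; apply: eq_bigr => m1 _.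
  by rewrite -(coupling_F hM) // mulr_suml.
transitivity (\sum_J1 \sum_(j1 < N.+1 | p J1 j1) \sum_(k < j1.+1)
   (\sum_x M J x m * M J1 x k) * \sum_(m1 < j1.+1) F j1 k m1 * G J1 J' m1 m').
  transitivity (\sum_x \sum_J1 \sum_(j1 < N.+1 | p J1 j1) \sum_(k < j1.+1)
     M J x m * M J1 x k * \sum_(m1 < j1.+1) F j1 k m1 * G J1 J' m1 m').
    apply: eq_bigr => x _; rewrite mulr_sumr; apply: eq_bigr => J1 _.
    rewrite mulr_sumr; apply: eq_bigr => j1 _.
    transitivity (M J x m * \sum_(k < j1.+1) \sum_(m1 < j1.+1)
       M J1 x k * F j1 k m1 * G J1 J' m1 m').
      congr (_ * _); rewrite exchange_big; apply: eq_bigr => m1 _.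
      by rewrite mulr_suml.
    rewrite mulr_sumr; apply: eq_bigr => k _; rewrite -mulrA; congr (_ * _).
    by rewrite mulr_sumr; apply: eq_bigr => m1 _; rewrite mulrA.
  rewrite exchange_big; apply: eq_bigr => J1 _.
  rewrite exchange_big; apply: eq_bigr => j1 _.
  rewrite exchange_big; apply: eq_bigr => k _.
  by rewrite mulr_suml.
rewrite (bigD1 J) //= [X in _ + X]big1 ?addr0; last first.
  move=> J1 J1J; rewrite big1 // => j1 pj1; rewrite big1 // => k _.
  by rewrite (coupling_orth hM) // eq_sym (negPf J1J) mul0r.
rewrite -(@collapse K N (p J) (fun j1 k => \sum_(m1 < j1.+1) F j1 k m1 * G J J' m1 m')) //;
  last exact: (coupling_bound hM pj).
apply: eq_bigr => j1 pj1; apply: eq_bigr => k _.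
by rewrite (coupling_orth hM) // eqxx /= mulrC eq_sym [(m == k :> nat)]eq_sym.
Qed.

Let G_weight J j J' j' (m : 'I_j.+1) (m' : 'I_j'.+1) : p J j -> p' J' j' ->
  (m.*2 + j' != m'.*2 + j)%N -> G J J' m m' = 0.
Proof.
move=> pj pj' ne; apply: big1 => x _.
have [e|/(coupling_weight hM pj) ->] := eqVneq ((wX x).*2 + j)%N (m.*2 + Nw)%N;
  last by rewrite mul0r.
rewrite [M' J' x m'](coupling_weight hM' pj') ?mulr0 //.
by apply: contra ne => /eqP e'; apply/eqP; lia.
Qed.

Let GE J J' j (m m' : 'I_j.+1) : p J j -> p' J' j ->
  G J J' m m' = G J J' (@ord_max j) (@ord_max j) * (m == m' :> nat)%:R.
Proof.
move=> pj pj'; have H := @schur_eq K j j (f j) (f j) (@G J j J' j) (@f_reg j)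
    (fun m1 m2 => @G_weight J j J' j m1 m2 pj pj')
    (fun m1 m2 => @G_comm J j J' j m1 m2 pj pj') erefl (fun=> erefl).
rewrite (H m m') (H ord_max ord_max) /= eqxx mulr1.
by [].
Qed.

Let G0 J J' j j' (m : 'I_j.+1) (m' : 'I_j'.+1) :
  p J j -> p' J' j' -> j != j' -> G J J' m m' = 0.
Proof.
move=> pj pj' jj'.
exact: (@schur_neq K j j' (f j) (f j') (@G J j J' j') (@f_reg j) (@f_reg j')
    (fun m1 m2 => @G_weight J j J' j' m1 m2 pj pj')
    (fun m1 m2 => @G_comm J j J' j' m1 m2 pj pj') jj' m m').
Qed.

Let collapseG (L0 : finType) (q : L0 -> pred nat) (B : L0 -> forall j, 'I_j.+1 -> K)
    (H : L0 -> forall j, 'I_j.+1 -> K) (w : L0 -> K) j (m : 'I_j.+1) :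
  (forall J j1, q J j1 -> (j1 <= N)%N) ->
  (forall J j1 (m1 : 'I_j1.+1), q J j1 -> j1 != j -> H J j1 m1 = 0) ->
  (forall J (m1 : 'I_j.+1), q J j -> H J j m1 = w J * (m1 == m :> nat)%:R) ->
  \sum_J \sum_(j1 < N.+1 | q J j1) \sum_(m1 < j1.+1) B J j1 m1 * H J j1 m1
  = \sum_(J | q J j) B J j m * w J.
Proof.
move=> q_le H0 Hw; rewrite [RHS]big_mkcond; apply: eq_bigr => J _.
case: ifP => [qj|nqj]; last first.
  rewrite big1 // => j1 qj1; rewrite big1 // => m1 _.
  by rewrite H0 ?mulr0 //; apply: contraFneq nqj => <-.
rewrite -(@collapse K N (q J) (fun j1 m1 => B J j1 m1 * w J) j m (q_le _ _ qj) qj).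
apply: eq_bigr => j1 qj1; apply: eq_bigr => m1 _.
have [e|ne] := eqVneq (j1 : nat) j; last by rewrite H0 // !mulr0.
case: j1 qj1 m1 e => j1 /= _ qj1 m1 e; move: m1; rewrite e => m1.
by rewrite Hw // mulrA.
Qed.

(* Both sides are the equivariant projection onto the spin-j isotypic part,
   composed with the identification of [m] with [m']. *)
Theorem recoupling j (m m' : 'I_j.+1) x z :
  \sum_(J | p J j) M J x m * M J z m' = \sum_(J | p' J j) M' J x m * M' J z m'.
Proof.
(* The scalars given by Schur's lemma. Expanding one factor of each side in the other family yields
   the same double sum with weights [W J J']. *)
pose W J J' := G J J' (@ord_max j) (@ord_max j).
transitivity (\sum_(J | p J j) \sum_(J' | p' J' j) M J x m * (M' J' z m' * W J J')).
  apply: eq_bigr => J pj; rewrite -mulr_sumr; congr (_ * _); rewrite ME.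
  apply: (@collapseG L' p' (fun J' j' m1 => M' J' z m1) (fun J' j' m1 => G J J' m' m1)).
  - exact: (coupling_bound hM').
  - by move=> J' j1 m1 pj' ne; apply: G0; rewrite // eq_sym.
  - by move=> J' m1 pj'; rewrite GE // eq_sym.
rewrite exchange_big; apply: eq_bigr => J' pj' /=.
transitivity ((\sum_(J | p J j) M J x m * W J J') * M' J' z m').
  by rewrite mulr_suml; apply: eq_bigr => J _; ring.
congr (_ * _); rewrite M'E; apply: esym.
apply: (@collapseG L p (fun J j1 m1 => M J x m1) (fun J j1 m1 => G J J' m1 m)).
- exact: (coupling_bound hM).
- by move=> J j1 m1 pj ne; apply: G0.
- by move=> J m1 pj; rewrite GE.
Qed.

End Recoupling.

Lemma cg_range_le a b n : cg_range a b n -> (n <= a + b)%N.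
Proof. by case/and4P. Qed.

Lemma sum_cg_range (V : nmodType) a b M (H : nat -> V) : (a + b <= M)%N ->
  \sum_(n < M.+1 | cg_range a b n) H n = \sum_(n < (a + b).+1 | cg_range a b n) H n.
Proof.
move=> abM; have abM1 : ((a + b).+1 <= M.+1)%N by [].
rewrite [RHS](big_ord_widen_cond M.+1 (cg_range a b) H) //; apply: eq_bigl => n /=.
by case r : (cg_range a b n) => //=; rewrite ltnS (cg_range_le r).
Qed.

(** * The two bracketings of a triple tensor product *)

Section CGCoupling.
Variables (K : comPzRingType) (c : cg_family K) (f kap : nat -> nat -> K).
Local Notation F n := (@ladder_down K n (f n)).
Hypothesis f_reg : forall n i x, (0 < i <= n)%N -> f n i * x = 0 -> x = 0.
Hypothesis c_orth : cg_orthogonal c.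
Hypothesis c_weight : forall a b n (i1 : 'I_a.+1) (i2 : 'I_b.+1) (i : 'I_n.+1),
  cg_range a b n -> ((i1 + i2).*2 + n != i.*2 + (a + b))%N -> c i1 i2 i = 0.
Hypothesis c_F : forall a b n (i1 : 'I_a.+1) (i2 : 'I_b.+1) (i : 'I_n.+1),
  cg_range a b n ->
  \sum_k F a i1 k * c k i2 i + kap a i1 * \sum_k F b i2 k * c i1 k i
  = \sum_k c i1 i2 k * F n k i.
Hypothesis kapM : forall a b n i1 i2 i,
  ((i1 + i2).*2 + n = i.*2 + (a + b))%N -> kap a i1 * kap b i2 = kap n i.

Lemma cg_rows a b M (i1 k1 : 'I_a.+1) (i2 k2 : 'I_b.+1) : (a + b <= M)%N ->
  \sum_(n < M.+1 | cg_range a b n) \sum_(i < n.+1) c i1 i2 i * c k1 k2 i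
  = ((i1 == k1) && (i2 == k2))%:R.
Proof.
move=> abM; rewrite -(proj1 (c_orth a b)).
exact: (sum_cg_range (fun n => \sum_(i < n.+1) c i1 i2 i * c k1 k2 i)).
Qed.

Variables n1 n2 n3 : nat.
Local Notation N := (n1 + n2 + n3)%N.
Local Notation X := ('I_n1.+1 * 'I_n2.+1 * 'I_n3.+1)%type.

Definition cg_left (J j : nat) (x : X) (m : 'I_j.+1) : K :=
  \sum_(i < J.+1) c x.1.1 x.1.2 i * c i x.2 m.
Definition cg_right (J j : nat) (x : X) (m : 'I_j.+1) : K :=
  \sum_(i < J.+1) c x.1.2 x.2 i * c x.1.1 i m.

(** The twofold coproduct F (x) 1 (x) 1 + k (x) F (x) 1 + k (x) k (x) F, where [kap] gives the
    eigenvalues of the group-like k, which is e^(-hbar H) in the application. *)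
Definition XF (x y : X) : K :=
  F n1 x.1.1 y.1.1 * (x.1.2 == y.1.2)%:R * (x.2 == y.2)%:R
  + kap n1 x.1.1 * (x.1.1 == y.1.1)%:R * F n2 x.1.2 y.1.2 * (x.2 == y.2)%:R
  + kap n1 x.1.1 * kap n2 x.1.2 * (x.1.1 == y.1.1)%:R * (x.1.2 == y.1.2)%:R
    * F n3 x.2 y.2.

Lemma sumX (H : 'I_n1.+1 -> 'I_n2.+1 -> 'I_n3.+1 -> K) :
  \sum_(x : X) H x.1.1 x.1.2 x.2 = \sum_a \sum_b \sum_d H a b d.
Proof.
rewrite -(pair_bigA _ (fun (ab : 'I_n1.+1 * 'I_n2.+1) d => H ab.1 ab.2 d)) /=.
by rewrite -(pair_bigA _ (fun a b => \sum_d H a b d)).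
Qed.

Lemma XF_apply (v : X -> K) (x : X) : \sum_y XF x y * v y
  = \sum_k F n1 x.1.1 k * v (k, x.1.2, x.2)
    + kap n1 x.1.1 * (\sum_k F n2 x.1.2 k * v (x.1.1, k, x.2))
    + kap n1 x.1.1 * kap n2 x.1.2 * (\sum_k F n3 x.2 k * v (x.1, k)).
Proof.
case: x => -[x1 x2] x3 /=.
transitivity (\sum_a \sum_b \sum_d XF (x1, x2, x3) (a, b, d) * v (a, b, d)).
  by rewrite -sumX; apply: eq_bigr => -[[]].
have tri (a1 : 'I_n1.+1) (a2 : 'I_n2.+1) (a3 : 'I_n3.+1) :
    XF (x1, x2, x3) (a1, a2, a3) * v (a1, a2, a3)
    = (x3 == a3)%:R * ((x2 == a2)%:R * (F n1 x1 a1 * v (a1, a2, a3)))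
    + (x3 == a3)%:R * ((x1 == a1)%:R * (kap n1 x1 * (F n2 x2 a2 * v (a1, a2, a3))))
    + (x2 == a2)%:R * ((x1 == a1)%:R * (kap n1 x1 * kap n2 x2 * (F n3 x3 a3 * v (a1, a2, a3)))).
  by rewrite /XF /=; ring.
transitivity (\sum_a \sum_b ((x2 == b)%:R * (F n1 x1 a * v (a, b, x3))
    + (x1 == a)%:R * (kap n1 x1 * (F n2 x2 b * v (a, b, x3)))
    + (x2 == b)%:R * ((x1 == a)%:R * (kap n1 x1 * kap n2 x2 * \sum_d F n3 x3 d * v (a, b, d))))).
  apply: eq_bigr => a _; apply: eq_bigr => b _.
  under eq_bigr => d _ do rewrite tri.
  rewrite !big_split /=; congr (_ + _ + _).
  - by rewrite sum_deltal.
  - by rewrite sum_deltal.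
  by rewrite -!mulr_sumr.
transitivity (\sum_a (F n1 x1 a * v (a, x2, x3)
    + (x1 == a)%:R * (kap n1 x1 * \sum_b F n2 x2 b * v (a, b, x3))
    + (x1 == a)%:R * (kap n1 x1 * kap n2 x2 * \sum_d F n3 x3 d * v (a, x2, d)))).
  apply: eq_bigr => a _; rewrite !big_split /=; congr (_ + _ + _).
  - by rewrite sum_deltal.
  - by rewrite -!mulr_sumr.
  - by rewrite sum_deltal.
by rewrite !big_split /= !sum_deltal.
Qed.

Definition wX (x : X) : nat := (x.1.1 + x.1.2 + x.2)%N.

(** Each property follows by using it for the outer and for the inner coupling. The multiplicity
    index is the intermediate spin [J]. *)
Lemma cg_left_coupling : @coupling K X N N wX f XF 'I_(n1 + n2).+1
  (fun J j => cg_range n1 n2 J && cg_range J n3 j) (fun J j => @cg_left J j).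
Proof.
split.
- move=> J j /andP[/cg_range_le rJ /cg_range_le rj].
  by apply: leq_trans rj _; rewrite leq_add2r.
- move=> [[x1 x2] x3] [[y1 y2] y3].
  transitivity (\sum_(J < (n1 + n2).+1 | cg_range n1 n2 J)
      \sum_(i < J.+1) \sum_(i' < J.+1) (c x1 x2 i * c y1 y2 i') *
        ((i == i') && (x3 == y3))%:R).
    rewrite [RHS]big_mkcond; apply: eq_bigr => J _; case: ifP => rJ; last first.
      by apply: big_pred0 => j.
    transitivity (\sum_(j < N.+1 | cg_range J n3 j) \sum_(i < J.+1) \sum_(i' < J.+1)
        \sum_(m < j.+1) c x1 x2 i * c y1 y2 i' * (c i x3 m * c i' y3 m)).
      apply: eq_bigr => j _; rewrite /cg_left /=.
      transitivity (\sum_(m < j.+1) \sum_(i < J.+1) \sum_(i' < J.+1)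
          c x1 x2 i * c y1 y2 i' * (c i x3 m * c i' y3 m)).
        apply: eq_bigr => m _; rewrite mulr_suml; apply: eq_bigr => i _.
        by rewrite mulr_sumr; apply: eq_bigr => i' _; ring.
      by rewrite exchange_big; apply: eq_bigr => i _; rewrite exchange_big.
    rewrite exchange_big; apply: eq_bigr => i _; rewrite exchange_big.
    apply: eq_bigr => i' _; rewrite -(@cg_rows J n3 N); last first.
      by rewrite leq_add2r (cg_range_le rJ).
    rewrite mulr_sumr; apply: eq_bigr => j _.
    by rewrite mulr_sumr.
  rewrite !xpair_eqE -[RHS]mulr1 -mulnb natrM -(@cg_rows n1 n2 (n1 + n2)%N) //.
  rewrite mulr1 mulr_suml; apply: eq_bigr => J _; rewrite mulr_suml.
  apply: eq_bigr => i _; rewrite (bigD1 i) //= eqxx big1 ?addr0 // => i' i'i.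
  by rewrite eq_sym (negPf i'i) mulr0.
- move=> J j J' j' m m' /andP[rJ rj] /andP[rJ' rj'].
  transitivity (\sum_(i < J.+1) \sum_(i' < J'.+1)
      (\sum_(x1 < n1.+1) \sum_(x2 < n2.+1) c x1 x2 i * c x1 x2 i')
        * (\sum_(x3 < n3.+1) c i x3 m * c i' x3 m')).
    rewrite (sumX (fun x1 x2 x3 => (\sum_(i < J.+1) c x1 x2 i * c i x3 m)
       * (\sum_(i < J'.+1) c x1 x2 i * c i x3 m'))).
    transitivity (\sum_(x1 < n1.+1) \sum_(x2 < n2.+1) \sum_(x3 < n3.+1) \sum_(i < J.+1) \sum_(i' < J'.+1)
        (c x1 x2 i * c x1 x2 i') * (c i x3 m * c i' x3 m')).
      apply: eq_bigr => x1 _; apply: eq_bigr => x2 _; apply: eq_bigr => x3 _.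
      rewrite mulr_suml; apply: eq_bigr => i _.
      by rewrite mulr_sumr; apply: eq_bigr => i' _; ring.
    under eq_bigr => x1 _.
      under eq_bigr => x2 _.
        rewrite exchange_big; under eq_bigr => i _.
          rewrite exchange_big; under eq_bigr => i' _ do rewrite -mulr_sumr.
          over.
        over.
      rewrite exchange_big; under eq_bigr => i _.
        rewrite exchange_big; under eq_bigr => i' _ do rewrite -mulr_suml.
        over.
      over.
    rewrite exchange_big; apply: eq_bigr => i _; rewrite exchange_big.
    by apply: eq_bigr => i' _; rewrite mulr_suml.
  transitivity (\sum_(i < J.+1) \sum_(i' < J'.+1)
     ((J == J') && (i == i' :> nat))%:R * (\sum_(x3 < n3.+1) c i x3 m * c i' x3 m')).
    apply: eq_bigr => i _; apply: eq_bigr => i' _.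
    by rewrite (proj2 (c_orth n1 n2)).
  have [JJ|ne] := eqVneq J J'; last first.
    by rewrite /= big1 // => i _; rewrite big1 // => i' _; rewrite mul0r.
  subst J'; rewrite /= -(proj2 (c_orth J n3)) //; apply: eq_bigr => i _.
  rewrite (bigD1 i) //= eqxx mul1r [X in _ + X]big1 ?addr0 // => i' i'i.
  by rewrite val_eqE eq_sym (negPf i'i) mul0r.
- move=> J j [[x1 x2] x3] m /andP[rJ rj]; rewrite XF_apply /cg_left /=.
  transitivity (\sum_(i < J.+1) c x1 x2 i * \sum_(k < j.+1) c i x3 k * F j k m); last first.
    transitivity (\sum_(i < J.+1) \sum_(k < j.+1) c x1 x2 i * c i x3 k * F j k m).
      by apply: eq_bigr => i _; rewrite mulr_sumr; apply: eq_bigr => k _; rewrite mulrA.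
    by rewrite exchange_big; apply: eq_bigr => k _; rewrite mulr_suml.
  under [RHS]eq_bigr => i _ do rewrite -(c_F i x3 m rj) mulrDr.
  rewrite big_split /=; congr (_ + _).
    transitivity (\sum_(i' < J.+1) (\sum_(i < J.+1) c x1 x2 i * F J i i') * c i' x3 m).
      under [RHS]eq_bigr => i' _ do rewrite -(c_F x1 x2 i' rJ) mulrDl.
      rewrite big_split /=; congr (_ + _).
        transitivity (\sum_k \sum_(i < J.+1) F n1 x1 k * c k x2 i * c i x3 m).
          by apply: eq_bigr => k _; rewrite mulr_sumr; apply: eq_bigr => i _; rewrite mulrA.
        by rewrite exchange_big; apply: eq_bigr => i _; rewrite mulr_suml.
      transitivity (\sum_k \sum_(i < J.+1) kap n1 x1 * (F n2 x2 k * c x1 k i * c i x3 m)).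
        rewrite mulr_sumr; apply: eq_bigr => k _; rewrite !mulr_sumr.
        by apply: eq_bigr => i _; ring.
      rewrite exchange_big; apply: eq_bigr => i _; rewrite -mulr_sumr -mulrA.
      by rewrite mulr_suml.
    transitivity (\sum_(i' < J.+1) \sum_(i < J.+1) c x1 x2 i * (F J i i' * c i' x3 m)).
      by apply: eq_bigr => i' _; rewrite mulr_suml; apply: eq_bigr => i _; rewrite mulrA.
    by rewrite exchange_big; apply: eq_bigr => i _; rewrite mulr_sumr.
  transitivity (\sum_k \sum_(i < J.+1) kap n1 x1 * kap n2 x2 * c x1 x2 i * (F n3 x3 k * c i k m)).
    rewrite mulr_sumr; apply: eq_bigr => k _; rewrite !mulr_sumr.
    by apply: eq_bigr => i _; ring.
  rewrite exchange_big; apply: eq_bigr => i _; rewrite -mulr_sumr mulrA; congr (_ * _).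
  (* Coassociativity of the group-like factor: either the weights of x1 and x2 add up to that of i,
     and [kapM] applies, or the coefficient vanishes. *)
  have [e|ne] := eqVneq ((x1 + x2).*2 + J)%N (i.*2 + (n1 + n2))%N.
    by rewrite (kapM e) mulrC.
  by rewrite (c_weight rJ ne) mulr0 mul0r.
- move=> J j [[x1 x2] x3] m /andP[rJ rj] /= ne; apply: big1 => i _ /=.
  have [e|ne'] := eqVneq ((x1 + x2).*2 + J)%N (i.*2 + (n1 + n2))%N; last first.
    by rewrite (c_weight rJ ne') mul0r.
  rewrite [X in _ * X](c_weight rj) ?mulr0 //; apply: contra ne => /eqP e'.
  by rewrite /wX /=; apply/eqP; lia.
Qed.

(** The mirror image with the same [XF]: the factor of the first leg comes from the outer coupling,
    that of the second leg from the inner one. *)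
Lemma cg_right_coupling : @coupling K X N N wX f XF 'I_(n2 + n3).+1
  (fun J j => cg_range n2 n3 J && cg_range n1 J j) (fun J j => @cg_right J j).
Proof.
split.
- move=> J j /andP[/cg_range_le rJ /cg_range_le rj].
  by apply: leq_trans rj _; rewrite -addnA leq_add2l.
- move=> [[x1 x2] x3] [[y1 y2] y3].
  transitivity (\sum_(J < (n2 + n3).+1 | cg_range n2 n3 J)
      \sum_(i < J.+1) \sum_(i' < J.+1) (c x2 x3 i * c y2 y3 i') *
        ((x1 == y1) && (i == i'))%:R).
    rewrite [RHS]big_mkcond; apply: eq_bigr => J _; case: ifP => rJ; last first.
      by apply: big_pred0 => j.
    transitivity (\sum_(j < N.+1 | cg_range n1 J j) \sum_(i < J.+1) \sum_(i' < J.+1)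
        \sum_(m < j.+1) c x2 x3 i * c y2 y3 i' * (c x1 i m * c y1 i' m)).
      apply: eq_bigr => j _; rewrite /cg_right /=.
      transitivity (\sum_(m < j.+1) \sum_(i < J.+1) \sum_(i' < J.+1)
          c x2 x3 i * c y2 y3 i' * (c x1 i m * c y1 i' m)).
        apply: eq_bigr => m _; rewrite mulr_suml; apply: eq_bigr => i _.
        by rewrite mulr_sumr; apply: eq_bigr => i' _; ring.
      by rewrite exchange_big; apply: eq_bigr => i _; rewrite exchange_big.
    rewrite exchange_big; apply: eq_bigr => i _; rewrite exchange_big.
    apply: eq_bigr => i' _; rewrite -(@cg_rows n1 J N); last first.
      by rewrite -addnA leq_add2l (cg_range_le rJ).
    rewrite mulr_sumr; apply: eq_bigr => j _.
    by rewrite mulr_sumr.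
  rewrite !xpair_eqE -andbA -mulnb natrM -(@cg_rows n2 n3 (n2 + n3)%N) //.
  rewrite mulr_sumr; apply: eq_bigr => J _; rewrite mulr_sumr.
  apply: eq_bigr => i _; rewrite (bigD1 i) //= eqxx andbT big1 ?addr0 => [|i' i'i].
    by rewrite mulrC.
  by rewrite [i == i']eq_sym (negPf i'i) andbF mulr0.
- move=> J j J' j' m m' /andP[rJ rj] /andP[rJ' rj'].
  transitivity (\sum_(i < J.+1) \sum_(i' < J'.+1)
      (\sum_(x2 < n2.+1) \sum_(x3 < n3.+1) c x2 x3 i * c x2 x3 i')
        * (\sum_(x1 < n1.+1) c x1 i m * c x1 i' m')).
    rewrite (sumX (fun x1 x2 x3 => (\sum_(i < J.+1) c x2 x3 i * c x1 i m)
       * (\sum_(i < J'.+1) c x2 x3 i * c x1 i m'))).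
    transitivity (\sum_(x1 < n1.+1) \sum_(x2 < n2.+1) \sum_(x3 < n3.+1) \sum_(i < J.+1) \sum_(i' < J'.+1)
        (c x2 x3 i * c x2 x3 i') * (c x1 i m * c x1 i' m')).
      apply: eq_bigr => x1 _; apply: eq_bigr => x2 _; apply: eq_bigr => x3 _.
      rewrite mulr_suml; apply: eq_bigr => i _.
      by rewrite mulr_sumr; apply: eq_bigr => i' _; ring.
    under eq_bigr => x1 _.
      under eq_bigr => x2 _.
        rewrite exchange_big; under eq_bigr => i _.
          rewrite exchange_big; under eq_bigr => i' _ do rewrite -mulr_suml.
          over.
        over.
      rewrite exchange_big; under eq_bigr => i _.
        rewrite exchange_big; under eq_bigr => i' _ do rewrite -mulr_suml.
        over.
      over.
    rewrite exchange_big; apply: eq_bigr => i _; rewrite exchange_big.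
    by apply: eq_bigr => i' _; rewrite mulr_sumr.
  transitivity (\sum_(i < J.+1) \sum_(i' < J'.+1)
     ((J == J') && (i == i' :> nat))%:R * (\sum_(x1 < n1.+1) c x1 i m * c x1 i' m')).
    apply: eq_bigr => i _; apply: eq_bigr => i' _.
    by rewrite (proj2 (c_orth n2 n3)).
  have [JJ|ne] := eqVneq J J'; last first.
    by rewrite /= big1 // => i _; rewrite big1 // => i' _; rewrite mul0r.
  subst J'; rewrite /= -(proj2 (c_orth n1 J)) // [RHS]exchange_big; apply: eq_bigr => i _.
  rewrite (bigD1 i) //= eqxx mul1r [X in _ + X]big1 ?addr0 // => i' i'i.
  by rewrite val_eqE eq_sym (negPf i'i) mul0r.
- move=> J j [[x1 x2] x3] m /andP[rJ rj]; rewrite XF_apply /cg_right /=.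
  transitivity (\sum_(i < J.+1) c x2 x3 i * \sum_(k < j.+1) c x1 i k * F j k m); last first.
    transitivity (\sum_(i < J.+1) \sum_(k < j.+1) c x2 x3 i * c x1 i k * F j k m).
      by apply: eq_bigr => i _; rewrite mulr_sumr; apply: eq_bigr => k _; rewrite mulrA.
    by rewrite exchange_big; apply: eq_bigr => k _; rewrite mulr_suml.
  under [RHS]eq_bigr => i _ do rewrite -(c_F x1 i m rj) mulrDr.
  rewrite big_split /= -addrA; congr (_ + _).
    transitivity (\sum_k \sum_(i < J.+1) c x2 x3 i * (F n1 x1 k * c k i m)).
      by apply: eq_bigr => k _; rewrite mulr_sumr; apply: eq_bigr => i _; ring.
    by rewrite exchange_big; apply: eq_bigr => i _; rewrite mulr_sumr.
  transitivity (kap n1 x1 * \sum_(i' < J.+1) (\sum_(i < J.+1) c x2 x3 i * F J i i') * c x1 i' m).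
    rewrite -mulrA -mulrDr; congr (_ * _).
    under [RHS]eq_bigr => i' _ do rewrite -(c_F x2 x3 i' rJ) mulrDl.
    rewrite big_split /=; congr (_ + _).
      transitivity (\sum_k \sum_(i < J.+1) F n2 x2 k * c k x3 i * c x1 i m).
        by apply: eq_bigr => k _; rewrite mulr_sumr; apply: eq_bigr => i _; rewrite mulrA.
      by rewrite exchange_big; apply: eq_bigr => i _; rewrite mulr_suml.
    transitivity (\sum_k \sum_(i < J.+1) kap n2 x2 * (F n3 x3 k * c x2 k i * c x1 i m)).
      rewrite mulr_sumr; apply: eq_bigr => k _; rewrite !mulr_sumr.
      by apply: eq_bigr => i _; ring.
    rewrite exchange_big; apply: eq_bigr => i _; rewrite -mulr_sumr -mulrA.
    by rewrite mulr_suml.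
  transitivity (\sum_(i < J.+1) \sum_(i' < J.+1) c x2 x3 i * (kap n1 x1 * (F J i i' * c x1 i' m))).
    rewrite exchange_big mulr_sumr; apply: eq_bigr => i' _.
    by rewrite mulr_suml mulr_sumr; apply: eq_bigr => i _; ring.
  by apply: eq_bigr => i _; rewrite -mulr_sumr -mulr_sumr.
- move=> J j [[x1 x2] x3] m /andP[rJ rj] /= ne; apply: big1 => i _ /=.
  have [e|ne'] := eqVneq ((x2 + x3).*2 + J)%N (i.*2 + (n2 + n3))%N; last first.
    by rewrite (c_weight rJ ne') mul0r.
  rewrite [X in _ * X](c_weight rj) ?mulr0 //; apply: contra ne => /eqP e'.
  by rewrite /wX /=; apply/eqP; lia.
Qed.

Theorem cg_recoupling j (m m' : 'I_j.+1) (x z : X) :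
  \sum_(J < (n1 + n2).+1 | cg_range n1 n2 J && cg_range J n3 j)
     @cg_left J j x m * @cg_left J j z m'
  = \sum_(J < (n2 + n3).+1 | cg_range n2 n3 J && cg_range n1 J j)
     @cg_right J j x m * @cg_right J j z m'.
Proof. exact: (recoupling f_reg cg_left_coupling cg_right_coupling). Qed.

End CGCoupling.

Section DiagSums.
Variables (K : comPzRingType) (I : finType).
Implicit Types (d x : I -> K).
Lemma sum_diag_r d x i : \sum_k x k * fmx_diag d k i = x i * d i.
Proof.
rewrite -(sum_deltar (fun k => x k * d k)).
by apply: eq_bigr => k _; rewrite mulrA.
Qed.
Lemma sum_diag_l d x i : \sum_k fmx_diag d i k * x k = d i * x i.
Proof.
rewrite -(sum_deltal x) mulr_sumr.
by apply: eq_bigr => k _; rewrite mulrA.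
Qed.
End DiagSums.

Lemma sum_diag_l2 (K : comPzRingType) (I J : finType) (d : I * J -> K)
    (v : I -> J -> K) i j :
  \sum_a \sum_b fmx_diag d (i, j) (a, b) * v a b = d (i, j) * v i j.
Proof.
rewrite -(sum_diag_l d (fun p => v p.1 p.2)) pair_bigA.
by apply: eq_bigr => -[].
Qed.

Lemma sum_coproduct (K : comPzRingType) (I J : finType) (f1 : fmx K I) (f2 : fmx K J)
    (k : I -> K) (v : I -> J -> K) i1 i2 :
  \sum_a f1 i1 a * v a i2 + k i1 * \sum_b f2 i2 b * v i1 b
  = \sum_a \sum_b (kron f1 1 + kron (fmx_diag k) f2) (i1, i2) (a, b) * v a b.
Proof.
transitivity (\sum_a \sum_b ((i2 == b)%:R * (f1 i1 a * v a b)
    + (i1 == a)%:R * (k i1 * (f2 i2 b * v a b)))); last first.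
  apply: eq_bigr => a _; apply: eq_bigr => b _.
  by rewrite fmxDE /kron /fmx_diag fmx1E /=; ring.
apply: esym; transitivity
  (\sum_a (f1 i1 a * v a i2 + (i1 == a)%:R * (k i1 * \sum_b f2 i2 b * v a b))).
  by apply: eq_bigr => a _; rewrite big_split /= sum_deltal -!mulr_sumr.
by rewrite big_split /= sum_deltal.
Qed.

Section LadderSums.
Variables (K : comPzRingType) (n : nat) (f : nat -> K).
Local Notation F := (@ladder_down K n f).

Lemma sum_down_l (v : 'I_n.+1 -> K) (m k : 'I_n.+1) : m.+1 = k :> nat ->
  \sum_j F m j * v j = f k * v k.
Proof.
move=> mk; rewrite (bigD1 k) //= big1 ?addr0 => [|j /eqP jk].
  by rewrite /ladder_down mk eqxx.
rewrite /ladder_down; case: eqP => [mj|_]; last by rewrite mul0r.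
by case: jk; apply: val_inj; rewrite /= -mj mk.
Qed.

Lemma sum_down_r (v : 'I_n.+1 -> K) (m k : 'I_n.+1) : m.+1 = k :> nat ->
  \sum_j v j * F j k = v m * f k.
Proof.
move=> mk; rewrite (bigD1 m) //= big1 ?addr0 => [|j /eqP jm].
  by rewrite /ladder_down mk eqxx.
rewrite /ladder_down; case: eqP => [jk|_]; last by rewrite mulr0.
by case: jm; apply: val_inj; apply: succn_inj; rewrite /= jk mk.
Qed.

Lemma sum_down_max (v : 'I_n.+1 -> K) (m : 'I_n.+1) : m = n :> nat ->
  \sum_j F m j * v j = 0.
Proof.
move=> mn; rewrite big1 // => j _; rewrite /ladder_down mn.
by case: eqP => [e|_]; rewrite ?mul0r //; have := ltn_ord j; rewrite -e ltnn.
Qed.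

Lemma sum_down_0 (v : 'I_n.+1 -> K) (k : 'I_n.+1) : k = 0%N :> nat ->
  \sum_j v j * F j k = 0.
Proof. by move=> k0; rewrite big1 // => j _; rewrite /ladder_down k0 mulr0. Qed.

(** Neighbouring values agree after multiplication by a regular lowering coefficient, so the values
    are equal all the way down from the top. *)
Lemma down_const (v : 'I_n.+1 -> K) :
  (forall i x, (0 < i <= n)%N -> f i * x = 0 -> x = 0) ->
  (forall m k : 'I_n.+1, m.+1 = k :> nat -> f k * v k = f k * v m) ->
  forall k, v k = v ord_max.
Proof.
move=> f_reg vS k.
suff H : forall d, (d <= n)%N -> v (inord (n - d)) = v ord_max.
  have kn : (k <= n)%N by rewrite -ltnS.
  by rewrite -(H (n - k)%N (leq_subr _ _)) subKn // inord_val.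
elim=> [|d IHd] dn.
  by congr v; apply: val_inj; rewrite /= inordK subn0.
rewrite -IHd 1?ltnW //; set m := inord _; set k' := inord _.
have mE : m = (n - d.+1)%N :> nat by rewrite inordK // ltnS leq_subr.
have kE : k' = (n - d)%N :> nat by rewrite inordK // ltnS leq_subr.
have e := vS m k' _; apply/esym/eqP; rewrite -subr_eq0; apply/eqP.
apply: (f_reg k'); first by rewrite kE; lia.
by rewrite mulrBr e ?subrr // mE kE subnSK.
Qed.
End LadderSums.

(** * Values and symmetries of the q-Clebsch-Gordan coefficients *)

Section QCG.
Variables (R : realType) (c : cg_family R) (cq : cg_family {fps R}).
Hypotheses (hc : is_CG c) (hcq : is_qCG c cq).
Local Notation C := R[i].
Local Notation K := {fps C}.
Local Notation real := (real_complex R).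

Definition qcg : cg_family K := fun n1 n2 n i1 i2 i => fps_map real (cq i1 i2 i : {fps R}).

(** The eigenvalue of e^(-hbar H), the left factor of the second term of the coproduct of F. *)
Definition qkap (n i : nat) : K := qexp (- wt R n i).

Lemma fps_cancel0 (x y : K) : x 0%N != 0 -> x * y = 0 -> y = 0.
Proof.
move=> /fps_unit[z xz] e; rewrite -[y]mul1r -xz [x * z]mulrC -mulrA e; exact: mulr0.
Qed.

Lemma qdn_reg n i x : (0 < i <= n)%N -> qdn R n i * x = 0 -> x = 0.
Proof. by move=> /(@qdn_neq0 R n i); exact: fps_cancel0. Qed.

Lemma qcg_orth : cg_orthogonal qcg.
Proof.
move=> n1 n2; have [h1 h2] := qCG_orthogonal hcq n1 n2; split.
  move=> i1 k1 i2 k2; rewrite -(fps_map_rmorph_nat real) -(h1 i1 k1 i2 k2).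
  rewrite fps_map_rmorph_sum; apply: eq_bigr => n _.
  rewrite fps_map_rmorph_sum; apply: eq_bigr => i _.
  exact: esym (fps_map_rmorphM _ _ _).
move=> n n' i i' r r'; rewrite -(fps_map_rmorph_nat real) -(h2 _ _ i i' r r').
rewrite fps_map_rmorph_sum; apply: eq_bigr => i1 _.
rewrite fps_map_rmorph_sum; apply: eq_bigr => i2 _.
exact: esym (fps_map_rmorphM _ _ _).
Qed.

Lemma qcg_intertwines n1 n2 n (x : Uh R) (i1 : 'I_n1.+1) (i2 : 'I_n2.+1) (i : 'I_n.+1) :
  cg_range n1 n2 n ->
  \sum_(k < n.+1) qcg i1 i2 k * Rhoh x k i
  = \sum_(k1 < n1.+1) \sum_(k2 < n2.+1) RDelta x (i1, i2) (k1, k2) * qcg k1 k2 i.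
Proof.
move=> r; apply: etrans (qCG_intertwines hcq x i1 i2 i r) _.
apply: eq_bigr => k1 _; apply: eq_bigr => k2 _.
by rewrite Rhoh2E RDeltaE.
Qed.

Lemma wt_nat n1 n2 n (i1 i2 i : nat) :
  wt R n1 i1 + wt R n2 i2 - wt R n i
  = ((i1 + i2).*2 + n)%N%:R - (i.*2 + (n1 + n2))%N%:R.
Proof. by rewrite /wt !natrD -!muln2 !natrM !natrD !mulr_natr !mulrnDl; ring. Qed.

(** Intertwining of H says that the difference of weights times the coefficient is zero, and a
    nonzero constant difference can be cancelled. *)
Lemma qcg_weight n1 n2 n (i1 : 'I_n1.+1) (i2 : 'I_n2.+1) (i : 'I_n.+1) :
  cg_range n1 n2 n -> ((i1 + i2).*2 + n != i.*2 + (n1 + n2))%N -> qcg i1 i2 i = 0.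
Proof.
move=> r ne; have := qcg_intertwines (Uh_gen R gH) i1 i2 i r.
rewrite Rhoh_gen rhoh_word_letter RDelta_gen RDelta_H_diag.
rewrite sum_diag_r (sum_diag_l2 _ (fun a b => qcg a b i)) => e.
apply: (@fps_cancel0 (fps_cst (wt2 R (i1, i2) - wt R n i))).
  by rewrite /= /wt2 wt_nat subr_eq0 eqr_nat.
rewrite fps_cstD fps_cstN mulrBl -e mulrC; exact: subrr.
Qed.

Lemma qcg_F n1 n2 n (i1 : 'I_n1.+1) (i2 : 'I_n2.+1) (i : 'I_n.+1) : cg_range n1 n2 n ->
  \sum_k @ladder_down K n1 (qdn R n1) i1 k * qcg k i2 i
    + qkap n1 i1 * \sum_k @ladder_down K n2 (qdn R n2) i2 k * qcg i1 k i
  = \sum_k qcg i1 i2 k * @ladder_down K n (qdn R n) k i.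
Proof.
move=> r; have := qcg_intertwines (Uh_gen R gF) i1 i2 i r.
rewrite Rhoh_gen rhoh_word_letter RDelta_gen RDelta_F => ->.
exact: (sum_coproduct (@ladder_down K n1 (qdn R n1)) (@ladder_down K n2 (qdn R n2))
  (fun a : 'I_n1.+1 => qkap n1 a) (fun a b => qcg a b i) i1 i2).
Qed.

Lemma qkapM a b n i1 i2 i : ((i1 + i2).*2 + n = i.*2 + (a + b))%N ->
  qkap a i1 * qkap b i2 = qkap n i.
Proof.
move=> e; apply: etrans (esym (qexpD _ _)) _; congr qexp.
have /eqP := wt_nat a b n i1 i2 i; rewrite e subrr subr_eq0 => /eqP <-.
exact: esym (opprD _ _).
Qed.

Lemma qcg_lim n1 n2 n (i1 : 'I_n1.+1) (i2 : 'I_n2.+1) (i : 'I_n.+1) :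
  cg_range n1 n2 n -> qcg i1 i2 i 0%N = real (c i1 i2 i).
Proof. by move=> r; rewrite /= (qCG_lim hcq). Qed.

Lemma cg_range_add n1 n2 : cg_range n1 n2 (n1 + n2).
Proof.
rewrite /cg_range (leq_trans (leq_subr _ _) (leq_addr _ _)) leqnn.
by rewrite (leq_trans (leq_subr _ _) (leq_addl _ _)) oddD addbb.
Qed.

(** By weights this coefficient is the only nonzero entry of its row, so orthogonality makes its
    square 1. At hbar = 0 the sign convention makes it positive, hence x + 1 is a unit and x = 1. *)
Lemma qcg_top n1 n2 :
  qcg (@ord_max n1) (@ord_max n2) (@ord_max (n1 + n2)) = 1.
Proof.
set x := qcg _ _ _.
have xx : x * x = 1.
  have [h1 _] := qcg_orth n1 n2.
  have h := h1 ord_max ord_max ord_max ord_max; rewrite !eqxx in h.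
  apply: etrans _ h.
  rewrite (bigD1 ord_max) ?cg_range_add //= (bigD1 ord_max) //=.
  rewrite [X in _ = _ + X + _]big1 ?addr0 => [|i ii]; last first.
    rewrite (@qcg_weight n1 n2 (n1 + n2) ord_max ord_max i) ?mul0r ?cg_range_add //=.
    by move: ii; rewrite -val_eqE /= => /eqP ne; apply/eqP => e; apply: ne; lia.
  rewrite [X in _ = _ + X]big1 ?addr0 // => n /andP[r nn].
  rewrite big1 // => i _.
  rewrite (@qcg_weight n1 n2 n ord_max ord_max i) ?mul0r //=.
  move: nn; rewrite -val_eqE /= => /eqP ne; apply/eqP => e; apply: ne.
  by have := ltn_ord i; have := ltn_ord n; lia.
have x0 : 0 < x 0%N.
  rewrite /x qcg_lim ?cg_range_add //.
  (* For n = n1 + n2 the index (n + n2 - n1)/2 of the sign convention is n2, the top one. *)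
  rewrite ltcR; apply: (CG_sign hc (cg_range_add n1 n2)) => /=.
  by rewrite -addnA addKn addnn doubleK.
apply/eqP; rewrite -subr_eq0; apply/eqP; apply: (@fps_cancel0 (x + 1)).
  by rewrite fps_coefD lt0r_neq0 // addr_gt0 // ltr01.
have -> : (x + 1) * (x - 1) = x * x - 1 by ring.
by rewrite xx subrr.
Qed.

Lemma qkap0 (z : 'I_1) : qkap 0 z = 1.
Proof. by rewrite ord1 /qkap /wt mul0rn subrr oppr0 qexp0. Qed.

(** Coupling with spin 0: weights leave the diagonal, lowering makes it constant, and the top entry
    is 1 by [qcg_top]. *)
Lemma qcg_unit_l n (z : 'I_1) (k i : 'I_n.+1) : @qcg 0 n n z k i = (k == i)%:R.
Proof.
have r : cg_range 0 n n := cg_range_add 0 n.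
have [<-|ne] := eqVneq k i; last first.
  apply: qcg_weight => //; rewrite ord1 /=; apply: contra ne => /eqP e.
  by apply/eqP/val_inj; move: e => /=; lia.
transitivity (@qcg 0 n n z ord_max ord_max); last by rewrite ord1 -(qcg_top 0 n) ord1.
apply: (@down_const K n (qdn R n) (fun j => @qcg 0 n n z j j)).
  by move=> j x; exact: qdn_reg.
move=> m k' mk; have := qcg_F z m k' r.
rewrite sum_down_max; last by rewrite ord1.
rewrite add0r qkap0 mul1r (sum_down_l _ _ mk) (sum_down_r _ _ mk) => ->.
exact: mulrC.
Qed.

Lemma cg_range_n0 n : cg_range n 0 n.
Proof. by have := cg_range_add n 0; rewrite addn0. Qed.

Lemma qcg_unit_r n (z : 'I_1) (k i : 'I_n.+1) : @qcg n 0 n k z i = (k == i)%:R.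
Proof.
have r := cg_range_n0 n.
have [<-|ne] := eqVneq k i; last first.
  apply: qcg_weight => //; rewrite ord1 /=; apply: contra ne => /eqP e.
  by apply/eqP/val_inj; move: e => /=; lia.
transitivity (@qcg n 0 n ord_max z ord_max); last first.
  have := qcg_top n 0; rewrite addn0 => <-; congr (qcg _ _ _).
  by rewrite !ord1.
apply: (@down_const K n (qdn R n) (fun j => @qcg n 0 n j z j)).
  by move=> j x; exact: qdn_reg.
move=> m k' mk; have := qcg_F m z k' r.
rewrite [\sum_(k < 1) _]sum_down_max; last by rewrite ord1.
rewrite mulr0 addr0 (sum_down_l _ _ mk) (sum_down_r _ _ mk) => ->.
exact: mulrC.
Qed.

Local Notation i0 := (@ord0 1).
Local Notation i1 := (@ord_max 1).

Lemma qkap10 : qkap 1 i0 = qexp 1.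
Proof. by rewrite /qkap /wt mul0rn sub0r opprK. Qed.
Lemma qkap11 : qkap 1 i1 = qexp (-1).
Proof. by rewrite /qkap /wt /= mulr2n addrK. Qed.

(** Lower the top vector of the triplet and compare its components (-,+) and (+,-): they differ by
    [qkap] at m = 1/2, that is q^-1. This is the origin of q in ab = q ba. *)
Lemma qcg_half_triplet :
  @qcg 1 1 2 i0 i1 (inord 1) = qexp 1 * @qcg 1 1 2 i1 i0 (inord 1).
Proof.
have r : cg_range 1 1 2 by [].
have e1 : (inord 1 : 'I_3).+1 = @ord_max 2 :> nat by rewrite inordK.
have e2 : i0.+1 = i1 :> nat by [].
have z v : \sum_j @ladder_down K 1 (qdn R 1) i1 j * v j = 0 :=
  @sum_down_max K 1 (qdn R 1) v i1 erefl.
have h2 : qdn R 1 1 * qcg i1 i1 (@ord_max 2) = qcg i0 i1 (inord 1 : 'I_3) * qdn R 2 2.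
  apply: etrans (esym (@sum_down_l K 1 (qdn R 1) (fun k => qcg k i1 ord_max) i0 i1 e2)) _.
  apply: etrans _ (@sum_down_r K 2 (qdn R 2) (fun k => qcg i0 i1 k) _ _ e1).
  apply: etrans _ (qcg_F i0 i1 (@ord_max 2) r).
  by rewrite [X in _ + _ * X](z (fun k => qcg i0 k ord_max)) mulr0 addr0.
have h1 : qexp (-1) * (qdn R 1 1 * qcg i1 i1 (@ord_max 2))
    = qcg i1 i0 (inord 1 : 'I_3) * qdn R 2 2.
  rewrite -qkap11.
  rewrite -[X in _ * X](@sum_down_l K 1 (qdn R 1) (fun k => qcg i1 k ord_max) i0 i1 e2).
  apply: etrans _ (@sum_down_r K 2 (qdn R 2) (fun k => qcg i1 i0 k) _ _ e1).
  apply: etrans _ (qcg_F i1 i0 (@ord_max 2) r).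
  by rewrite [X in X + _](z (fun k => qcg k i0 ord_max)) add0r.
have H := @qdn_reg 2 2 _ isT; apply/eqP; rewrite -subr_eq0; apply/eqP.
apply: H; rewrite mulrBr [qdn R 2 2 * qcg i0 _ _]mulrC -h2.
rewrite [X in _ - X]mulrCA [X in _ - _ * X]mulrC -h1.
rewrite [X in _ - X]mulrA -qexpD subrr qexp0 mul1r; exact: subrr.
Qed.

(** Lowering annihilates the singlet; the identity is the component (-,-) of this equation. *)
Lemma qcg_half_singlet :
  @qcg 1 1 0 i1 i0 ord0 = - qexp 1 * @qcg 1 1 0 i0 i1 ord0.
Proof.
have r : cg_range 1 1 0 by [].
have e2 : i0.+1 = i1 :> nat by [].
have := qcg_F i0 i0 (@ord0 0) r.
rewrite !(sum_down_l _ _ e2) sum_down_0 // qkap10 => h.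
have H := @qdn_reg 1 1 _ isT; apply/eqP; rewrite -subr_eq0; apply/eqP.
apply: H; rewrite mulNr opprK mulrDr; apply: etrans _ h; congr (_ + _).
by ring.
Qed.

Lemma qcg_half_norm :
  @qcg 1 1 0 i0 i1 ord0 * @qcg 1 1 0 i0 i1 ord0
  + @qcg 1 1 0 i1 i0 ord0 * @qcg 1 1 0 i1 i0 ord0 = 1.
Proof.
have r : cg_range 1 1 0 by [].
have [_ h] := qcg_orth 1 1.
have e := h 0%N 0%N ord0 ord0 r r; apply: (etrans _ e).
rewrite !big_ord_recl !big_ord0 /=.
rewrite (@qcg_weight 1 1 0 ord0 ord0) // mul0r add0r !addr0.
have -> : lift ord0 ord0 = i1 by apply: val_inj.
rewrite (@qcg_weight 1 1 0 i1 i1) // mul0r !addr0.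
by [].
Qed.

End QCG.

(** * The action on quantum Euclidean space *)

Section CtensMap.
Variables (F : fieldType) (A B A' B' V : pzAlgType {fps F}).
Variables (f : A -> A') (g : B -> B') (h : ctens A' B' -> V).
Hypotheses (fl : slin f) (gl : slin g) (hl : slin h) (V_sep : separated V).

Let Phi (x : {fps free_alg F (A + B)%type}) : V :=
  h (\pi_(ctens A' B') (hwsum id (fun w => fps_cst
    (letter F (inl (f (wleft w)) : A' + B')%type
     * letter F (inr (g (wright w)) : A' + B')%type)) x)).

Let Phi_slin : slin Phi.
Proof.
have [pl _ _] := @pi_ctens_ahom F A' B'.
exact: slin_comp (slin_comp (hwsum_slin _) pl) hl.
Qed.

Let Phi_word u : Phi (hword F u) = h (ctpure (f (wleft u)) (g (wright u))).
Proof.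
have [_ pM _] := @pi_ctens_ahom F A' B'.
pose l := fps_cst (letter F (inl (f (wleft u)) : A' + B')%type).
pose r := fps_cst (letter F (inr (g (wright u)) : A' + B')%type).
have e : hwsum id (fun w => fps_cst
    (letter F (inl (f (wleft w)) : A' + B')%type
     * letter F (inr (g (wright w)) : A' + B')%type)) (hword F u) = l * r.
  by rewrite hwsum_word fps_cstM.
have e' := pM l r; rewrite -e in e'.
rewrite /Phi; exact (f_equal h e').
Qed.

(** As for [ctens_lift_pi], independence of the representative is established after composition with
    a linear map [h] into a separated algebra. *)
Lemma ctmap_pi x : h (ctmap f g (\pi_(ctens A B) x)) = Phi x.
Proof.
apply: (@ctens_factor F A B V V_sep (fun a b => h (ctpure (f a) (g b))) Phi x).
- by move=> b; exact: slin_comp (slin_comp fl (slin_ctpurel (g b))) hl.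
- by move=> a; exact: slin_comp (slin_comp gl (slin_ctpurer (f a))) hl.
- exact: Phi_slin.
- exact: Phi_word.
Qed.

Lemma ctmap_slin : slin (fun t => h (ctmap f g t)).
Proof.
move=> c; elim/quotW=> x; elim/quotW=> y.
have -> : scal c * \pi_(ctens A B) x + \pi_(ctens A B) y
    = \pi_(ctens A B) (scal c * x + y) by rewrite piD piM.
apply: etrans (ctmap_pi _) _; apply: etrans (Phi_slin c x y) _.
exact: esym (f_equal2 (fun u v => scal c * u + v) (ctmap_pi x) (ctmap_pi y)).
Qed.

Lemma ctmap_pure a b : h (ctmap f g (ctpure a b)) = h (ctpure (f a) (g b)).
Proof.
have -> : ctpure a b = \pi_(ctens A B) (hword F [:: inl a; inr b]).
  by rewrite pi_ctens_word !legsE.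
by apply: etrans (ctmap_pi _) _; apply: etrans (Phi_word _) _; rewrite !legsE.
Qed.
End CtensMap.

Section Reindex.
Variables (K : comPzRingType) (I J : finType) (s : I -> J) (s' : J -> I).
Hypotheses (sK : cancel s s') (s'K : cancel s' s).

Definition fmx_reindex (x : fmx K J) : fmx K I := fun i k => x (s i) (s k).

Lemma fmx_reindex_ahom : ahom fmx_reindex.
Proof.
apply: ahomI => [x y|x y|c]; apply: fmxP => i k; rewrite /fmx_reindex //.
  by rewrite !fmxME (reindex s) //; exists s' => j _.
by rewrite /scal /= /fmx_scal (inj_eq (can_inj sK)).
Qed.
End Reindex.

Section MiddleSwap.
Variables (I J I' J' : finType).
(** Exchanges the two middle legs: so4 (x) so4 groups them as (1,2),(3,4), while the two copies of
    su2 act on (1,3) and (2,4). *)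
Definition mswap (x : (I * J) * (I' * J')) : (I * I') * (J * J') :=
  ((x.1.1, x.2.1), (x.1.2, x.2.2)).
End MiddleSwap.

Lemma mswapK (I J I' J' : finType) : cancel (@mswap I J I' J') (@mswap I I' J J').
Proof. by move=> [[a b] [d e]]. Qed.

Lemma tensor_rel_ahom0 (L : comPzRingType) (A B Q V : pzAlgType L) (l : A -> Q)
    (r : B -> Q) (Xi : Q -> V) (la : A -> V) (rb : B -> V) :
  ahom Xi -> ahom la -> ahom rb -> (forall a, Xi (l a) = la a) ->
  (forall b, Xi (r b) = rb b) -> (forall a b, la a * rb b = rb b * la a) ->
  forall x, tensor_rel l r x -> Xi x = 0.
Proof.
move=> Xh lh rh Xl Xr comm x; have [Xlin XM X1] := Xh.
have [llin lM l1] := lh; have [rlin rM r1] := rh.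
case=> [a a'|b b'|a a'|b b'|d|d|a b]; rewrite (slinB Xlin) ?(slinD Xlin) ?XM ?Xl ?Xr.
- by rewrite (slinD llin) subrr.
- by rewrite (slinD rlin) subrr.
- by rewrite lM subrr.
- by rewrite rM subrr.
- by rewrite (ahom_scal d lh) (ahom_scal d Xh) subrr.
- by rewrite (ahom_scal d rh) (ahom_scal d Xh) subrr.
- by rewrite comm subrr.
Qed.

Section Legs.
Variables (K : comPzRingType) (I1 I2 : finType).
Local Notation J := ((I1 * I1) * (I2 * I2))%type.

Definition leg13 (x : fmx K (I1 * I2)%type) : fmx K J :=
  fmx_reindex (@mswap _ _ _ _) (kron x (1 : fmx K (I1 * I2)%type)).
Definition leg24 (x : fmx K (I1 * I2)%type) : fmx K J :=
  fmx_reindex (@mswap _ _ _ _) (kron (1 : fmx K (I1 * I2)%type) x).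

Lemma reindex_mswap_ahom : ahom (fmx_reindex (K := K) (@mswap I1 I1 I2 I2)).
Proof. exact: fmx_reindex_ahom (@mswapK _ _ _ _) (@mswapK _ _ _ _). Qed.

Lemma leg13_ahom : ahom leg13.
Proof. exact: ahom_comp (@kronl_ahom K _ _) reindex_mswap_ahom. Qed.
Lemma leg24_ahom : ahom leg24.
Proof. exact: ahom_comp (@kronr_ahom K _ _) reindex_mswap_ahom. Qed.

Lemma legs_comm x y : leg13 x * leg24 y = leg24 y * leg13 x.
Proof.
have [_ M _] := reindex_mswap_ahom; apply: etrans (esym (M _ _)) _.
by apply: etrans _ (M _ _); rewrite !kronM !mul1r !mulr1.
Qed.

Lemma leg13_24 x y a a' b b' k k' l l' :
  (leg13 x * leg24 y) ((k, k'), (l, l')) ((a, a'), (b, b')) = x (k, l) (a, b) * y (k', l') (a', b').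
Proof.
have [_ M _] := reindex_mswap_ahom.
have -> : leg13 x * leg24 y = fmx_reindex (@mswap _ _ _ _) (kron x y).
  by apply: etrans (esym (M _ _)) _; rewrite kronM mulr1 mul1r.
by [].
Qed.

Lemma leg13_kron (x : fmx K I1) (y : fmx K I2) :
  kron (kron x (1 : fmx K I1)) (kron y (1 : fmx K I2)) = leg13 (kron x y).
Proof.
apply: fmxP => -[[a a'] [b b']] [[k k'] [l l']].
rewrite /leg13 /fmx_reindex /kron /= !fmx1E xpair_eqE -mulnb natrM.
exact: mulrACA.
Qed.
Lemma leg24_kron (x : fmx K I1) (y : fmx K I2) :
  kron (kron (1 : fmx K I1) x) (kron (1 : fmx K I2) y) = leg24 (kron x y).
Proof.
apply: fmxP => -[[a a'] [b b']] [[k k'] [l l']].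
rewrite /leg24 /fmx_reindex /kron /= !fmx1E xpair_eqE -mulnb natrM.
exact: mulrACA.
Qed.

End Legs.

Section So4Rep.
Variables (R : realType) (n1 n2 : nat).
Local Notation C := R[i].
Local Notation K := {fps C}.
Local Notation I1 := 'I_n1.+1.
Local Notation I2 := 'I_n2.+1.
Local Notation J := ((I1 * I1) * (I2 * I2))%type.

Definition R4 : ctens (so4h R) (so4h R) -> fmx K J :=
  ctens_rep (@Rhoh2 R n1 n1) (@Rhoh2 R n2 n2).

Lemma R4_ahom : ahom R4.
Proof. exact: ctens_rep_ahom (@Rhoh2_ahom R n1 n1) (@Rhoh2_ahom R n2 n2). Qed.

Lemma R4_pure s t : R4 (ctpure s t) = kron (@Rhoh2 R n1 n1 s) (@Rhoh2 R n2 n2 t).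
Proof. exact: ctens_rep_pure (@Rhoh2_ahom R n1 n1) (@Rhoh2_ahom R n2 n2) s t. Qed.

Lemma R4_ctmap_l t : R4 (ctmap (@ctensl _ (Uh R) (Uh R)) (@ctensl _ (Uh R) (Uh R)) t)
  = leg13 (Rhoh2 t).
Proof.
have [ll _ _] := @ctensl_ahom C (Uh R) (Uh R); have [hl _ _] := R4_ahom.
have [rl _ _] := @Rhoh2_ahom R n1 n2; have [l13 _ _] := @leg13_ahom K I1 I2.
have cl := @ctmap_slin _ _ _ _ _ _ _ _ R4 ll ll hl (@separated_fmx C J).
have cp := @ctmap_pure _ _ _ _ _ _ _ _ R4 ll ll hl (@separated_fmx C J).
apply: (@ctens_slin_eq _ _ _ _ (@separated_fmx C J) _ (fun t => leg13 (Rhoh2 t)) cl).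
  exact: slin_comp rl l13.
move=> a b; apply: etrans (cp a b) _; apply: etrans (R4_pure _ _) _.
apply: etrans (f_equal2 (@kron K _ _) (Rhoh2_l _ _ _) (Rhoh2_l _ _ _)) _.
by apply: etrans (leg13_kron _ _) _; congr leg13; exact: esym (Rhoh2_pure _ _ _ _).
Qed.

Lemma R4_ctmap_r t : R4 (ctmap (@ctensr _ (Uh R) (Uh R)) (@ctensr _ (Uh R) (Uh R)) t)
  = leg24 (Rhoh2 t).
Proof.
have [ll _ _] := @ctensr_ahom C (Uh R) (Uh R); have [hl _ _] := R4_ahom.
have [rl _ _] := @Rhoh2_ahom R n1 n2; have [l24 _ _] := @leg24_ahom K I1 I2.
have cl := @ctmap_slin _ _ _ _ _ _ _ _ R4 ll ll hl (@separated_fmx C J).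
have cp := @ctmap_pure _ _ _ _ _ _ _ _ R4 ll ll hl (@separated_fmx C J).
apply: (@ctens_slin_eq _ _ _ _ (@separated_fmx C J) _ (fun t => leg24 (Rhoh2 t)) cl).
  exact: slin_comp rl l24.
move=> a b; apply: etrans (cp a b) _; apply: etrans (R4_pure _ _) _.
apply: etrans (f_equal2 (@kron K _ _) (Rhoh2_r _ _ _) (Rhoh2_r _ _ _)) _.
by apply: etrans (leg24_kron _ _) _; congr leg24; exact: esym (Rhoh2_pure _ _ _ _).
Qed.

Definition so4h_Delta_gen (s : (Uh R + Uh R)%type) : ctens (so4h R) (so4h R) :=
  match s with
  | inl g => ctmap (@ctensl _ (Uh R) (Uh R)) (@ctensl _ (Uh R) (Uh R)) (Uh_Delta g)
  | inr g => ctmap (@ctensr _ (Uh R) (Uh R)) (@ctensr _ (Uh R) (Uh R)) (Uh_Delta g)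
  end.

Lemma so4h_DeltaE t : @so4h_Delta R t = ctens_lift so4h_Delta_gen t.
Proof.
apply: etrans _ (ctens_liftE so4h_Delta_gen t); rewrite /so4h_Delta.
have <- : (fun s : (Uh R + Uh R)%type =>
    match s with
    | inl g => ctmap (@ctensl _ (Uh R) (Uh R)) (@ctensl _ (Uh R) (Uh R)) (Uh_Delta g)
    | inr g => ctmap (@ctensr _ (Uh R) (Uh R)) (@ctensr _ (Uh R) (Uh R)) (Uh_Delta g)
    end) = so4h_Delta_gen by apply: funext => -[].
by [].
Qed.

Let la g := leg13 (@RDelta R n1 n2 g).
Let rb g := leg24 (@RDelta R n1 n2 g).

Let Xi_ahom : ahom (fun x => R4 (ctens_word so4h_Delta_gen x)).
Proof. exact: ahom_comp (ctens_word_ahom so4h_Delta_gen) R4_ahom. Qed.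
Let Xil g : R4 (ctens_word so4h_Delta_gen (fps_cst (letter C (inl g : Uh R + Uh R)%type))) = la g.
Proof.
have e := ctens_word_letter so4h_Delta_gen (inl g).
apply: etrans (f_equal (R4 : _ -> fmx K J) e) _; apply: etrans (R4_ctmap_l _) _.
by congr leg13; exact: RDeltaE.
Qed.
Let Xir g : R4 (ctens_word so4h_Delta_gen (fps_cst (letter C (inr g : Uh R + Uh R)%type))) = rb g.
Proof.
have e := ctens_word_letter so4h_Delta_gen (inr g).
apply: etrans (f_equal (R4 : _ -> fmx K J) e) _; apply: etrans (R4_ctmap_r _) _.
by congr leg24; exact: RDeltaE.
Qed.
Let la_ahom : ahom la. Proof. exact: ahom_comp (@RDelta_ahom R n1 n2) (@leg13_ahom K I1 I2). Qed.
Let rb_ahom : ahom rb. Proof. exact: ahom_comp (@RDelta_ahom R n1 n2) (@leg24_ahom K I1 I2). Qed.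

(** The coproduct of so4h is a lift over the letters of a completed tensor product. In the
    representation the images of the two kinds of letters commute, so the tensor relations are
    respected and the two su2 coproducts separate. *)
Lemma R4_so4h_Delta (g g' : Uh R) :
  R4 (so4h_Delta (ctpure g g')) = leg13 (RDelta g) * leg24 (RDelta g').
Proof.
have kill := tensor_rel_ahom0 Xi_ahom la_ahom rb_ahom Xil Xir (fun a b => legs_comm _ _).
have h := ctens_lift_ahom (@separated_fmx C J) R4_ahom kill.
have let_ := ctens_lift_letter (@separated_fmx C J) R4_ahom kill.
rewrite so4h_DeltaE; have [_ hM _] := h.
apply: etrans (hM _ _) _; congr (_ * _).
  by apply: etrans (let_ (inl g)) _; apply: etrans (R4_ctmap_l _) _; congr leg13; exact: RDeltaE.
by apply: etrans (let_ (inr g')) _; apply: etrans (R4_ctmap_r _) _; congr leg24; exact: RDeltaE.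
Qed.

End So4Rep.

Lemma slin_rep_comb (K : comPzRingType) (A V : pzAlgType K) (I : finType)
    (r : A -> fmx K I) (v : I -> V) i0 :
  slin r -> slin (fun a => \sum_i scal (r a i i0) * v i).
Proof.
move=> rl c x y; rewrite mulr_sumr -big_split /=; apply: eq_bigr => i _.
by rewrite rl fmxDE fmxZE scalD scalM mulrDl mulrA.
Qed.

Section LoweringUnique.
Variables (F : numFieldType) (M : lmodType {fps F}) (n : nat) (f : nat -> {fps F}).
Hypothesis f_neq0 : forall i, (0 < i <= n)%N -> f i 0%N != 0.
Local Notation D := (@ladder_down {fps F} n f).

Lemma scale_cancel (c : {fps F}) (x y : M) : c 0%N != 0 -> c *: x = c *: y -> x = y.
Proof.
move=> /fps_unit[z cz] e.
by rewrite -[x]scale1r -[y]scale1r -cz mulrC -!scalerA e.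
Qed.

Lemma sum_down_scale (v : 'I_n.+1 -> M) (m k : 'I_n.+1) : m.+1 = k :> nat ->
  \sum_j D j k *: v j = f k *: v m.
Proof.
move=> mk; rewrite (bigD1 m) //= big1 ?addr0 => [|j /eqP jm].
  by rewrite /ladder_down mk eqxx.
rewrite /ladder_down; case: eqP => [jk|_]; last by rewrite scale0r.
by case: jm; apply: val_inj; apply: succn_inj; rewrite /= jk mk.
Qed.

(** Acting on the vector of index m + 1 yields a unit times the vector of index m, so the top vector
    determines all the others. *)
Lemma lowering_unique1 (act : M -> M) (v w : 'I_n.+1 -> M) :
  (forall i, act (v i) = \sum_k D k i *: v k) ->
  (forall i, act (w i) = \sum_k D k i *: w k) ->
  v ord_max = w ord_max -> v =1 w.
Proof.
move=> av aw e k.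
suff H : forall d, (d <= n)%N -> v (inord (n - d)) = w (inord (n - d)).
  have kn : (k <= n)%N by rewrite -ltnS.
  by have := H (n - k)%N (leq_subr _ _); rewrite subKn // inord_val.
elim=> [|d IHd] dn.
  have -> : inord (n - 0) = ord_max :> 'I_n.+1 by apply: val_inj; rewrite /= inordK subn0.
  exact: e.
set m := inord _; set k' := inord (n - d) in IHd.
have mE : m = (n - d.+1)%N :> nat by rewrite inordK // ltnS leq_subr.
have kE : k' = (n - d)%N :> nat by rewrite inordK // ltnS leq_subr.
have mk : m.+1 = k' :> nat by rewrite mE kE subnSK.
apply: (@scale_cancel (f k')); first by apply: f_neq0; rewrite kE; lia.
by rewrite -(sum_down_scale v mk) -(sum_down_scale w mk) -av -aw IHd // ltnW.
Qed.

Lemma lowering_unique (act1 act2 : M -> M) (v w : 'I_n.+1 -> 'I_n.+1 -> M) :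
  (forall i i', act1 (v i i') = \sum_k D k i *: v k i') ->
  (forall i i', act1 (w i i') = \sum_k D k i *: w k i') ->
  (forall i i', act2 (v i i') = \sum_k D k i' *: v i k) ->
  (forall i i', act2 (w i i') = \sum_k D k i' *: w i k) ->
  v ord_max ord_max = w ord_max ord_max -> forall i i', v i i' = w i i'.
Proof.
move=> av1 aw1 av2 aw2 e i i'.
apply: (@lowering_unique1 act1 (v^~ i') (w^~ i')) => //.
exact: (@lowering_unique1 act2 (v ord_max) (w ord_max)).
Qed.
End LoweringUnique.

Section MhAction.
Variables (R : realType).
Local Notation C := R[i].
Local Notation K := {fps C}.
Variables (acth : so4h R -> Mh R -> Mh R) (hacth : is_Mh_action acth).
Variables (T : forall n : nat, 'I_n.+1 -> 'I_n.+1 -> Mh R) (hT : is_T acth T).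
Hypothesis Mh_sep : separated (Mh R : pzAlgType K).

Lemma Mh_scaleE (c : K) (x : Mh R) : c *: x = scal c * x.
Proof. by []. Qed.

Definition transforms n (S : 'I_n.+1 -> 'I_n.+1 -> Mh R) := forall (g g' : Uh R) i i',
  acth (ctpure g g') (S i i')
  = \sum_(k < n.+1) \sum_(k' < n.+1) (Rhoh g k i * Rhoh g' k' i') *: S k k'.

Lemma T_transforms n : transforms (@T n).
Proof. exact: (proj2 hT). Qed.

Lemma transforms_lower1 n (S : 'I_n.+1 -> 'I_n.+1 -> Mh R) : transforms S ->
  forall i i', acth (ctpure (Uh_gen R gF) (1 : Uh R)) (S i i')
    = \sum_k @ladder_down K n (qdn R n) k i *: S k i'.
Proof.
move=> tS i i'; rewrite tS; apply: eq_bigr => k _.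
have [_ _ r1] := @Rhoh_ahom R n; rewrite Rhoh_gen rhoh_word_letter r1.
rewrite (bigD1 i') //= big1 ?addr0 => [|k' k'i].
  by rewrite fmx1E eqxx mulr1.
by rewrite fmx1E (negPf k'i) mulr0 scale0r.
Qed.

Lemma transforms_lower2 n (S : 'I_n.+1 -> 'I_n.+1 -> Mh R) : transforms S ->
  forall i i', acth (ctpure (1 : Uh R) (Uh_gen R gF)) (S i i')
    = \sum_k @ladder_down K n (qdn R n) k i' *: S i k.
Proof.
move=> tS i i'; rewrite tS.
have [_ _ r1] := @Rhoh_ahom R n; rewrite Rhoh_gen rhoh_word_letter r1.
rewrite (bigD1 i) //= [X in _ + X]big1 ?addr0 => [|k ki].
  by apply: eq_bigr => k _; rewrite fmx1E eqxx mul1r.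
by rewrite big1 // => k' _; rewrite fmx1E (negPf ki) mul0r scale0r.
Qed.

Lemma transforms_unique n (S S' : 'I_n.+1 -> 'I_n.+1 -> Mh R) :
  transforms S -> transforms S' -> S ord_max ord_max = S' ord_max ord_max ->
  forall i i', S i i' = S' i i'.
Proof.
move=> tS tS'.
exact: (lowering_unique (@qdn_neq0 R n) (transforms_lower1 tS) (transforms_lower1 tS')
  (transforms_lower2 tS) (transforms_lower2 tS')).
Qed.

Lemma Mh_X_T (i j : 'I_2) : Mh_X R i j = @T 1 i j.
Proof.
apply: (@transforms_unique 1 (@Mh_X R) (@T 1)).
- exact: (Mh_act_X hacth).
- exact: T_transforms.
rewrite (proj1 hT) expr1; congr Mh_X; exact: val_inj.
Qed.

Lemma T0 i i' : @T 0 i i' = 1.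
Proof. by rewrite !ord1 -(expr0 (Mh_X R 1 1)) -(proj1 hT) !ord1; congr T; exact: val_inj. Qed.

Lemma acth_slin (x : Mh R) : slin (acth^~ x : so4h R -> Mh R).
Proof.
have am := Mh_module hacth; move=> c s t.
by rewrite (act_add am) (act_mul am) (act_scal am).
Qed.

(** The transformation law is given for pure tensors; separatedness of [Mh] extends it to the
    completed tensor product. *)
Lemma acth_T n (t : so4h R) (a : 'I_n.+1 * 'I_n.+1) :
  acth t (T a.1 a.2) = \sum_k scal (@Rhoh2 R n n t k a) * T k.1 k.2.
Proof.
have [rl _ _] := @Rhoh2_ahom R n n.
move: t; apply: (ctens_slin_eq Mh_sep) => [||g g'].
- exact: acth_slin.
- exact: (slin_rep_comb (fun k : 'I_n.+1 * 'I_n.+1 => T k.1 k.2) a rl).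
rewrite T_transforms Rhoh2_pure /kron.
by rewrite pair_bigA; apply: eq_bigr => -[k k'] _; rewrite Mh_scaleE.
Qed.

Definition TT n1 n2 (p p' : 'I_n1.+1 * 'I_n2.+1) : Mh R := T p.1 p'.1 * T p.2 p'.2.

(** The module algebra axiom evaluates [act2] on pure tensors only. Both sides of [E] are linear, so
    the formula extends to the coproduct, whose matrix is known from [R4_so4h_Delta]. *)
Lemma acth_TT n1 n2 (g g' : Uh R) (p p' : 'I_n1.+1 * 'I_n2.+1) :
  acth (ctpure g g') (TT p p')
  = \sum_k \sum_k' (RDelta g k p * RDelta g' k' p') *: TT k k'.
Proof.
have [act2 [act2_lin act2_pure act2_mul]] := Mh_act_mul hacth.
case: p p' => [a b] [a' b']; rewrite act2_mul.
pose v (k : ('I_n1.+1 * 'I_n1.+1) * ('I_n2.+1 * 'I_n2.+1)) := T k.1.1 k.1.2 * T k.2.1 k.2.2.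
have [rl _ _] := @R4_ahom R n1 n2.
have E : forall t, act2 t (T a a') (T b b')
    = \sum_k scal (@R4 R n1 n2 t k ((a, a'), (b, b'))) * v k.
  apply: (ctens_slin_eq Mh_sep) => [||s t].
  - by move=> c x y; exact: act2_lin.
  - exact: (slin_rep_comb v ((a, a'), (b, b')) rl).
  rewrite act2_pure R4_pure /kron /v /=.
  rewrite (acth_T s (a, a')) (acth_T t (b, b')) mulr_suml.
  rewrite -(pair_bigA _ (fun k l => scal (@Rhoh2 R n1 n1 s k (a, a') * @Rhoh2 R n2 n2 t l (b, b'))
    * (T k.1 k.2 * T l.1 l.2))) /=.
  apply: eq_bigr => k _; rewrite mulr_sumr; apply: eq_bigr => l _.
  by rewrite scalM; apply: esym; apply: mulr_comm4; exact: esym (scal_central _ _).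
rewrite E R4_so4h_Delta.
rewrite (reindex (@mswap 'I_n1.+1 'I_n2.+1 'I_n1.+1 'I_n2.+1)) /=; last first.
  by exists (@mswap _ _ _ _) => k _; exact: mswapK.
rewrite -(pair_bigA _ (fun k k' => scal ((leg13 (RDelta g) * leg24 (RDelta g'))
    (mswap (k, k')) (a, a', (b, b'))) * v (mswap (k, k')))) /=.
apply: eq_bigr => -[k l] _; apply: eq_bigr => -[k' l'] _.
by rewrite leg13_24.
Qed.

End MhAction.

Lemma coupled_action (K : comPzRingType) (M : lmodType K) (I N : finType)
    (act : M -> M) (W : I -> I -> M) (q : I -> N -> K) (A B : I -> I -> K)
    (a b : N -> N -> K) :
  linear act ->
  (forall p p', act (W p p') = \sum_k \sum_k' (A k p * B k' p') *: W k k') ->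
  (forall k i, \sum_p A k p * q p i = \sum_m q k m * a m i) ->
  (forall k i, \sum_p B k p * q p i = \sum_m q k m * b m i) ->
  forall i i', act (\sum_p \sum_p' (q p i * q p' i') *: W p p')
    = \sum_m \sum_m' (a m i * b m' i') *: \sum_p \sum_p' (q p m * q p' m') *: W p p'.
Proof.
move=> act_lin actW qA qB i i'.
have actD : {morph act : x y / x + y}.
  by move=> x y; have := act_lin 1 x y; rewrite !scale1r.
have act0 : act 0 = 0 by apply: (@addrI _ (act 0)); rewrite -actD !addr0.
have actZ c x : act (c *: x) = c *: act x.
  by have := act_lin c x 0; rewrite !addr0 act0 addr0.
have act_sum (J : finType) (G : J -> M) : act (\sum_j G j) = \sum_j act (G j).
  exact: (big_morph act actD act0).
transitivity (\sum_p \sum_p' \sum_k \sum_k'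
    (A k p * q p i) *: ((B k' p' * q p' i') *: W k k')).
  rewrite act_sum; apply: eq_bigr => p _; rewrite act_sum; apply: eq_bigr => p' _.
  rewrite actZ actW scaler_sumr; apply: eq_bigr => k _; rewrite scaler_sumr.
  by apply: eq_bigr => k' _; rewrite !scalerA; congr (_ *: _); ring.
transitivity (\sum_k \sum_k' (\sum_p A k p * q p i) *: ((\sum_p' B k' p' * q p' i') *: W k k')).
  under eq_bigr => p _.
    rewrite exchange_big; under eq_bigr => k _.
      rewrite exchange_big; under eq_bigr => k' _ do rewrite -scaler_sumr -scaler_suml.
      over.
    over.
  rewrite exchange_big; apply: eq_bigr => k _; rewrite exchange_big.
  by apply: eq_bigr => k' _; rewrite -scaler_suml.
transitivity (\sum_k \sum_k' \sum_m \sum_m' (a m i * b m' i') *: ((q k m * q k' m') *: W k k')).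
  apply: eq_bigr => k _; apply: eq_bigr => k' _; rewrite qA qB scaler_suml.
  apply: eq_bigr => m _; rewrite scaler_suml scaler_sumr.
  by apply: eq_bigr => m' _; rewrite !scalerA; congr (_ *: _); ring.
under eq_bigr => k _.
  rewrite exchange_big; under eq_bigr => m _.
    rewrite exchange_big; under eq_bigr => m' _ do rewrite -scaler_sumr.
    over.
  over.
rewrite exchange_big; apply: eq_bigr => m _; rewrite exchange_big.
by apply: eq_bigr => m' _; rewrite -scaler_sumr.
Qed.

Section MhRecursion.
Variables (R : realType) (c : cg_family R) (cq : cg_family {fps R}).
Hypotheses (hc : is_CG c) (hcq : is_qCG c cq).
Local Notation C := R[i].
Local Notation K := {fps C}.
Variables (acth : so4h R -> Mh R -> Mh R) (hacth : is_Mh_action acth).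
Variables (T : forall n : nat, 'I_n.+1 -> 'I_n.+1 -> Mh R) (hT : is_T acth T).
Hypothesis Mh_sep : separated (Mh R : pzAlgType K).
Local Notation qcg := (qcg cq).

Definition coupled n1 n2 n (i i' : 'I_n.+1) : Mh R :=
  \sum_(p : 'I_n1.+1 * 'I_n2.+1) \sum_(p' : 'I_n1.+1 * 'I_n2.+1)
    (qcg p.1 p.2 i * qcg p'.1 p'.2 i') *: TT T p p'.

Lemma coupled_transforms n1 n2 n : cg_range n1 n2 n ->
  transforms acth (@coupled n1 n2 n).
Proof.
move=> r g g' i i'.
have qg (x : Uh R) (k : 'I_n1.+1 * 'I_n2.+1) (j : 'I_n.+1) :
    \sum_p RDelta x k p * qcg p.1 p.2 j = \sum_m qcg k.1 k.2 m * Rhoh x m j.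
  case: k => k l; rewrite (qcg_intertwines hcq x k l j r).
  by rewrite pair_bigA; apply: eq_bigr => -[].
exact: (@coupled_action K (Mh R) _ _ (acth (ctpure g g')) (@TT R T n1 n2)
  (fun p i => qcg p.1 p.2 i) (RDelta g) (RDelta g') (Rhoh g) (Rhoh g')
  (act_linear (Mh_module hacth) (ctpure g g')) (acth_TT hacth hT Mh_sep g g') (qg g) (qg g') i i').
Qed.

(** Both families transform alike, so it suffices to compare top entries. There only the pair of top
    vectors couples, with coefficient 1, and the claim is d^(n+1) = d d^n. *)
Lemma T_succ n (i i' : 'I_n.+2) : T i i' = @coupled 1 n n.+1 i i'.
Proof.
have r : cg_range 1 n n.+1 := cg_range_add 1 n.
have U := @transforms_unique R acth n.+1 (@T n.+1) (@coupled 1 n n.+1)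
  (T_transforms hT (n := n.+1)) (coupled_transforms r).
apply: U.
have q0 (p : 'I_2 * 'I_n.+1) : p != (ord_max, ord_max) ->
    qcg p.1 p.2 (@ord_max n.+1) = 0.
  case: p => a b ne; apply: (qcg_weight hcq r).
  apply: contra ne => /eqP /= e; have := ltn_ord a; have := ltn_ord b => bn an.
  have ea : a = ord_max by apply: val_inj => /=; lia.
  have eb : b = ord_max by apply: val_inj => /=; lia.
  by rewrite ea eb.
have q1 : qcg (@ord_max 1) (@ord_max n) (@ord_max n.+1) = 1 := qcg_top hc hcq 1 n.
rewrite /coupled (bigD1 (ord_max, ord_max)) //= [X in _ = _ + X]big1 ?addr0; last first.
  by move=> p /q0 ->; rewrite big1 // => p' _; rewrite mul0r scale0r.
rewrite (bigD1 (ord_max, ord_max)) //= [X in _ = _ + X]big1 ?addr0; last first.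
  by move=> p /q0 ->; rewrite mulr0 scale0r.
rewrite q1 mulr1 scale1r /TT /= !(proj1 hT) expr1.
exact: exprS.
Qed.

End MhRecursion.

(** * Products in the basis det^k T *)

Section BasisExtension.
Variables (F : comNzRingType) (V : pzAlgType F) (I : eqType) (b : I -> V).
Hypothesis b_free : forall (s : seq I) (c : I -> F), uniq s ->
  \sum_(i <- s) scal (c i) * b i = 0 -> forall i, i \in s -> c i = 0.
Hypothesis b_span : forall v, exists (s : seq I) (c : I -> F),
  v = \sum_(i <- s) scal (c i) * b i.

(** Spanning lists may repeat an index; collecting multiplicities over a duplicate-free list makes
    freeness applicable. *)
Lemma sum_undup (W : pzAlgType F) (g : I -> W) (s u : seq I) (c : I -> F) :
  {subset s <= u} -> uniq u ->
  \sum_(i <- s) scal (c i) * g i = \sum_(i <- u) scal (c i *+ count_mem i s) * g i.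
Proof.
move=> su uu; elim: s su => [|i s IHs] su.
  by rewrite big_nil big1 // => i _; rewrite mulr0n scal0 mul0r.
rewrite big_cons IHs; last by move=> j js; apply: su; rewrite inE js orbT.
have iu : i \in u by apply: su; rewrite inE eqxx.
rewrite [RHS](eq_bigr (fun j => scal (c j *+ (i == j)) * g j
    + scal (c j *+ count_mem j s) * g j)); last first.
  by move=> j _; rewrite /= mulrnDr scalD mulrDl.
rewrite big_split; congr (_ + _) => /=.
rewrite (bigD1_seq i) //= eqxx mulr1n big1 ?addr0 // => j ji.
by rewrite eq_sym (negPf ji) mulr0n scal0 mul0r.
Qed.

(** Coordinates of every vector are picked by choice, and freeness makes the resulting value
    independent of the pick; linearity follows from this independence. *)
Lemma basis_extend (W : pzAlgType F) (g : I -> W) :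
  exists2 G : V -> W, slin G & forall i, G (b i) = g i.
Proof.
have /choice[sc scE] : forall v, exists sc : seq I * (I -> F),
    v = \sum_(i <- sc.1) scal (sc.2 i) * b i.
  by move=> v; have [s [c e]] := b_span v; exists (s, c).
pose G v := \sum_(i <- (sc v).1) scal ((sc v).2 i) * g i.
have GE v (s : seq I) (c : I -> F) : v = \sum_(i <- s) scal (c i) * b i ->
    G v = \sum_(i <- s) scal (c i) * g i.
  move=> vE; rewrite /G; set t := (sc v).1; set d := (sc v).2.
  pose u := undup (t ++ s).
  have uu : uniq u := undup_uniq _.
  have tu : {subset t <= u} by move=> i it; rewrite mem_undup mem_cat it.
  have su : {subset s <= u} by move=> i iS; rewrite mem_undup mem_cat iS orbT.
  rewrite (@sum_undup _ g t u d tu uu) (@sum_undup _ g s u c su uu); apply: eq_big_seq => i iu.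
  congr (scal _ * _); apply/eqP; rewrite -subr_eq0; apply/eqP.
  apply: (b_free (c := fun i => d i *+ count_mem i t - c i *+ count_mem i s) uu _ iu).
  rewrite (eq_bigr (fun i => scal (d i *+ count_mem i t) * b i
     - scal (c i *+ count_mem i s) * b i)); last first.
    by move=> j _; rewrite scalB mulrBl.
  rewrite sumrB -(@sum_undup _ b t u d tu uu) -(@sum_undup _ b s u c su uu) -vE -scE.
  exact: subrr.
exists G; last first.
  move=> i; rewrite (GE (b i) [:: i] (fun=> 1)) ?big_seq1 ?scal1 ?mul1r //.
move=> a v w; have [s [c vE]] := b_span v; have [t [d wE]] := b_span w.
pose u := undup (s ++ t); have uu : uniq u := undup_uniq _.
have su : {subset s <= u} by move=> i iS; rewrite mem_undup mem_cat iS.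
have tu : {subset t <= u} by move=> i it; rewrite mem_undup mem_cat it orbT.
rewrite (GE v s c vE) (GE w t d wE).
rewrite (GE _ u (fun i => a * (c i *+ count_mem i s) + d i *+ count_mem i t)).
  rewrite (@sum_undup _ g s u c su uu) (@sum_undup _ g t u d tu uu) mulr_sumr -big_split /=; apply: eq_bigr => i _.
  by rewrite scalD scalM mulrDl mulrA.
rewrite {1}vE {1}wE (@sum_undup _ b s u c su uu) (@sum_undup _ b t u d tu uu) mulr_sumr -big_split /=; apply: eq_bigr => i _.
by rewrite scalD scalM mulrDl mulrA.
Qed.

Lemma basis_fps_extend (W : pzAlgType F) (g : I -> {fps W}) :
  exists2 G : {fps V} -> {fps W}, slin G & forall i, G (fps_cst (b i)) = g i.
Proof.
have /choice[H HE] : forall r, exists H : V -> W, slin H /\ forall i, H (b i) = g i r.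
  by move=> r; have [H Hl Hb] := basis_extend (fun i => g i r); exists H.
pose G (x : {fps V}) : {fps W} := Fps (fun n => \sum_(k < n.+1) H (n - k)%N (x k)).
exists G.
  apply: slinP => [x y|a x]; apply: fpsP => n.
    rewrite fps_coefD -big_split; apply: eq_bigr => k _.
    by rewrite fps_coefD (slinD (proj1 (HE _))).
  rewrite fps_scalE.
  transitivity (\sum_(k < n.+1) \sum_(i < k.+1) scal (a i) * H (n - k)%N (x (k - i)%N)).
    apply: eq_bigr => k _; rewrite fps_scalE (slin_sum (proj1 (HE _))).
    by apply: eq_bigr => i _; rewrite (slinZ (proj1 (HE _))).
  rewrite (convolA (fun i j k => scal (a i) * H k (x j))).
  by apply: eq_bigr => i _; rewrite mulr_sumr.
move=> i; apply: fpsP => n; rewrite [LHS]big_ord_recl big1 => [|k _].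
  by rewrite addr0 subn0 (proj2 (HE _)).
exact: slin0 (proj1 (HE _)).
Qed.

Lemma slin_fps_basis_eq (W : pzAlgType {fps F}) (f g : {fps V} -> W) :
  separated W -> slin f -> slin g ->
  (forall i, f (fps_cst (b i)) = g (fps_cst (b i))) -> f =1 g.
Proof.
move=> W_sep fl gl fg; apply: slin_fps_eq => // v.
have [s [c ->]] := b_span v.
rewrite fps_cst_sum !slin_sum //; apply: eq_bigr => i _.
by rewrite fps_cstM -fps_scal_cst !slinZ // fg.
Qed.

End BasisExtension.

Section ProductFormula.
Variables (F : comNzRingType) (V : pzAlgType F).
Local Notation K := {fps F}.
Variables (q : cg_family K) (f kap : nat -> nat -> K).
Local Notation Fl n := (@ladder_down K n (f n)).
Hypothesis f_reg : forall n i x, (0 < i <= n)%N -> f n i * x = 0 -> x = 0.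
Hypothesis q_orth : cg_orthogonal q.
Hypothesis q_weight : forall a b n (i1 : 'I_a.+1) (i2 : 'I_b.+1) (i : 'I_n.+1),
  cg_range a b n -> ((i1 + i2).*2 + n != i.*2 + (a + b))%N -> q i1 i2 i = 0.
Hypothesis q_F : forall a b n (i1 : 'I_a.+1) (i2 : 'I_b.+1) (i : 'I_n.+1),
  cg_range a b n ->
  \sum_k Fl a i1 k * q k i2 i + kap a i1 * \sum_k Fl b i2 k * q i1 k i
  = \sum_k q i1 i2 k * Fl n k i.
Hypothesis kapM : forall a b n i1 i2 i,
  ((i1 + i2).*2 + n = i.*2 + (a + b))%N -> kap a i1 * kap b i2 = kap n i.
Hypothesis q_unit_l : forall n (z : 'I_1) (k i : 'I_n.+1), q z k i = (k == i)%:R.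
Hypothesis q_unit_r : forall n (z : 'I_1) (k i : 'I_n.+1), q k z i = (k == i)%:R.

Variable e : nat -> forall n, 'I_n.+1 -> 'I_n.+1 -> V.

(* The right-hand side of the product formula for [T_{i i'} (det^k T_{a a'})]. *)
Definition cgprod n1 n2 (i i' : 'I_n1.+1) k (a a' : 'I_n2.+1) : {fps V} :=
  \sum_(n < (n1 + n2).+1 | cg_range n1 n2 n) \sum_(m < n.+1) \sum_(m' < n.+1)
    scal (q i a m * q i' a' m') * fps_cst (e (k + (n1 + n2 - n)./2)%N m m').

Lemma couple_sum (A : pzAlgType K) (P : finType) (N : nat) (p : pred nat) (al be : P -> K)
    (U U' : P -> forall j, 'I_j.+1 -> K) (E : forall j, 'I_j.+1 -> 'I_j.+1 -> A) :
  \sum_l \sum_l' scal (al l * be l') *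
     \sum_(j < N.+1 | p j) \sum_(m < j.+1) \sum_(m' < j.+1)
        scal (U l j m * U' l' j m') * E j m m'
  = \sum_(j < N.+1 | p j) \sum_(m < j.+1) \sum_(m' < j.+1)
        scal ((\sum_l al l * U l j m) * (\sum_l' be l' * U' l' j m')) * E j m m'.
Proof.
transitivity (\sum_l \sum_l' \sum_(j < N.+1 | p j) \sum_(m < j.+1) \sum_(m' < j.+1)
    scal (al l * U l j m * (be l' * U' l' j m')) * E j m m').
  apply: eq_bigr => l _; apply: eq_bigr => l' _; rewrite mulr_sumr.
  apply: eq_bigr => j _; rewrite mulr_sumr; apply: eq_bigr => m _.
  rewrite mulr_sumr; apply: eq_bigr => m' _; rewrite mulrA -scalM.
  by congr (scal _ * _); ring.
under eq_bigr => l _ do rewrite exchange_big.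
rewrite exchange_big; apply: eq_bigr => j _.
under eq_bigr => l _ do rewrite exchange_big.
rewrite exchange_big; apply: eq_bigr => m _.
under eq_bigr => l _ do rewrite exchange_big.
rewrite exchange_big; apply: eq_bigr => m' _.
rewrite mulr_suml (big_morph (scal : K -> A) (@scalD K A) (@scal0 K A)) mulr_suml; apply: eq_bigr => l _.
by rewrite mulr_sumr (big_morph (scal : K -> A) (@scalD K A) (@scal0 K A)) mulr_suml.
Qed.

Lemma cgprodE n1 n2 N (i i' : 'I_n1.+1) k (a a' : 'I_n2.+1) : (n1 + n2 <= N)%N ->
  cgprod i i' k a a' = \sum_(n < N.+1 | cg_range n1 n2 n) \sum_(m < n.+1) \sum_(m' < n.+1)
    scal (q i a m * q i' a' m') * fps_cst (e (k + (n1 + n2 - n)./2)%N m m').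
Proof.
move=> le_N; apply: esym; exact: (sum_cg_range (fun n => \sum_(m < n.+1) \sum_(m' < n.+1)
    scal (q i a m * q i' a' m') * fps_cst (e (k + (n1 + n2 - n)./2)%N m m')) le_N).
Qed.

(** The powers of the determinant gained in the two steps depend only on the final spin; the parity
    conditions in [cg_range] make the halves exact. *)
Lemma cg_exponent_r n1 n2 n3 J j : cg_range n2 n3 J -> cg_range n1 J j ->
  ((n2 + n3 - J)./2 + (n1 + J - j)./2 = (n1 + n2 + n3 - j)./2)%N.
Proof.
move=> /and4P[_ _ le1 o1] /and4P[_ _ le2 o2].
by rewrite -[RHS]doubleK; lia.
Qed.

Lemma cg_exponent_l n1 n2 n3 J j : cg_range n1 n2 J -> cg_range J n3 j ->
  ((n1 + n2 - J)./2 + (J + n3 - j)./2 = (n1 + n2 + n3 - j)./2)%N.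
Proof.
move=> /and4P[_ _ le1 o1] /and4P[_ _ le2 o2].
by rewrite -[RHS]doubleK; lia.
Qed.

(** [G] plays the role of left multiplication by T_(x1 y1). Unprimed and primed indices pass through
    the same intermediate spin J, which is exactly the kind of sum that [cg_recoupling]
    transforms. *)
Lemma cgprod_assoc n1 n2 n3 (x1 y1 : 'I_n1.+1) (x2 y2 : 'I_n2.+1) (x3 y3 : 'I_n3.+1) k
    (G : {fps V} -> {fps V}) : slin G ->
  (forall k J (l l' : 'I_J.+1), G (fps_cst (e k l l')) = cgprod x1 y1 k l l') ->
  G (cgprod x2 y2 k x3 y3)
  = \sum_(J < (n1 + n2).+1 | cg_range n1 n2 J) \sum_(i < J.+1) \sum_(i' < J.+1)
      scal (q x1 x2 i * q y1 y2 i') * cgprod i i' (k + (n1 + n2 - J)./2)%N x3 y3.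
Proof.
move=> Gl Ge; pose N := (n1 + n2 + n3)%N.
pose x := (x1, x2, x3); pose y := (y1, y2, y3).
transitivity (\sum_(J < (n2 + n3).+1 | cg_range n2 n3 J) \sum_(j < N.+1 | cg_range n1 J j)
    \sum_(m < j.+1) \sum_(m' < j.+1) scal (@cg_right K q n1 n2 n3 J j x m * cg_right q J y m')
      * fps_cst (e (k + (N - j)./2)%N m m')).
  rewrite slin_sum //; apply: eq_bigr => J rJ.
  rewrite -(@couple_sum _ _ N (cg_range n1 J) (q x2 x3) (q y2 y3)
    (fun l j m => q x1 l m) (fun l j m => q y1 l m)
    (fun j m m' => fps_cst (e (k + (N - j)./2)%N m m'))).
  rewrite slin_sum //; apply: eq_bigr => l _; rewrite slin_sum //; apply: eq_bigr => l' _.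
  rewrite slinZ // Ge (@cgprodE _ _ N); last first.
    by rewrite /N -addnA leq_add2l (cg_range_le rJ).
  congr (_ * _); apply: eq_bigr => j rj; apply: eq_bigr => m _; apply: eq_bigr => m' _.
  by rewrite -addnA (cg_exponent_r rJ rj).
transitivity (\sum_(J < (n1 + n2).+1 | cg_range n1 n2 J) \sum_(j < N.+1 | cg_range J n3 j)
    \sum_(m < j.+1) \sum_(m' < j.+1) scal (@cg_left K q n1 n2 n3 J j x m * cg_left q J y m')
      * fps_cst (e (k + (N - j)./2)%N m m')); last first.
  apply: eq_bigr => J rJ.
  rewrite -(@couple_sum _ _ N (fun j => cg_range J n3 j) (q x1 x2) (q y1 y2)
    (fun l j m => q l x3 m) (fun l j m => q l y3 m)
    (fun j m m' => fps_cst (e (k + (N - j)./2)%N m m'))).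
  apply: eq_bigr => l _; apply: eq_bigr => l' _.
  rewrite (@cgprodE _ _ N); last by rewrite leq_add2r (cg_range_le rJ).
  congr (_ * _); apply: eq_bigr => j rj; apply: eq_bigr => m _; apply: eq_bigr => m' _.
  by rewrite -addnA (cg_exponent_l rJ rj).
(* With the final spin j outermost the basis vectors no longer depend on J, and the sum over J
   concerns the coefficients only. *)
rewrite (exchange_big_dep predT) //= [RHS](exchange_big_dep predT) //=.
apply: eq_bigr => j _.
have sumE (L : nat) (p : pred 'I_L.+1) (Z : 'I_L.+1 -> 'I_n1.+1 * 'I_n2.+1 * 'I_n3.+1 -> 'I_j.+1 -> K) :
    \sum_(J < L.+1 | p J) \sum_(m < j.+1) \sum_(m' < j.+1) scal (Z J x m * Z J y m')
      * fps_cst (e (k + (N - j)./2)%N m m')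
    = \sum_(m < j.+1) \sum_(m' < j.+1) scal (\sum_(J < L.+1 | p J) Z J x m * Z J y m')
      * fps_cst (e (k + (N - j)./2)%N m m').
  rewrite exchange_big; apply: eq_bigr => m _; rewrite exchange_big; apply: eq_bigr => m' _.
  by rewrite (big_morph (scal : K -> {fps V}) (@scalD K {fps V}) (@scal0 K {fps V})) mulr_suml.
rewrite (sumE _ _ (fun J => @cg_right K q n1 n2 n3 J j)).
rewrite (sumE _ _ (fun J => @cg_left K q n1 n2 n3 J j)).
apply: eq_bigr => m _; apply: eq_bigr => m' _; congr (scal _ * _).
exact: esym (cg_recoupling f_reg q_orth q_weight q_F kapM m m' x y).
Qed.

Lemma cg_range_0n n m : cg_range 0 n m = (m == n).
Proof. by rewrite /cg_range; apply/idP/eqP => [/and4P[]|->]; lia. Qed.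
Lemma cg_range_n0E n m : cg_range n 0 m = (m == n).
Proof. by rewrite /cg_range; apply/idP/eqP => [/and4P[]|->]; lia. Qed.

Lemma sum_delta2 n (a a' : 'I_n.+1) (E : 'I_n.+1 -> 'I_n.+1 -> {fps V}) :
  \sum_m \sum_m' scal ((a == m)%:R * (a' == m')%:R : K) * E m m' = E a a'.
Proof.
rewrite (bigD1 a) //= [X in _ + X]big1 ?addr0 => [|m ma]; last first.
  by rewrite big1 // => m' _; rewrite eq_sym (negPf ma) mul0r scal0 mul0r.
rewrite (bigD1 a') //= [X in _ + X]big1 ?addr0 => [|m ma]; last first.
  by rewrite [a' == m]eq_sym (negPf ma) mulr0 scal0 mul0r.
by rewrite !eqxx mulr1 scal1 mul1r.
Qed.

Lemma cgprod_unit_l (z z' : 'I_1) k n (a a' : 'I_n.+1) :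
  cgprod z z' k a a' = fps_cst (e k a a').
Proof.
rewrite /cgprod (eq_bigl (fun j : 'I_(0 + n).+1 => j == ord_max)); last first.
  by move=> j; rewrite cg_range_0n.
rewrite big_pred1_eq /= subnn addn0.
rewrite -[RHS](sum_delta2 a a' (fun m m' => fps_cst (e k m m'))).
by apply: eq_bigr => m _; apply: eq_bigr => m' _; rewrite !q_unit_l.
Qed.

Lemma cgprod_unit_r n (i i' : 'I_n.+1) k (z z' : 'I_1) :
  cgprod i i' k z z' = fps_cst (e k i i').
Proof.
rewrite (@cgprodE n 0 n) ?addn0 //.
rewrite (eq_bigl (fun j : 'I_n.+1 => j == ord_max)); last first.
  by move=> j; rewrite cg_range_n0E.
rewrite big_pred1_eq /= subnn addn0.
rewrite -[RHS](sum_delta2 i i' (fun m m' => fps_cst (e k m m'))).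
by apply: eq_bigr => m _; apply: eq_bigr => m' _; rewrite !q_unit_r.
Qed.

End ProductFormula.

Lemma slin_add (K : pzRingType) (A B : pzAlgType K) (f g : A -> B) :
  slin f -> slin g -> slin (fun x => f x + g x).
Proof. by move=> fl gl c x y; rewrite fl gl mulrDr addrACA. Qed.

(** * An action of the quantum space on power series over the classical one *)

Section WordAction.
Variables (F : comNzRingType) (G : choiceType) (V : pzAlgType F).
Variable L : G -> {fps V} -> {fps V}.
Hypothesis L_slin : forall g, slin (L g).

Definition word_act (s : seq G) (y : {fps V}) : {fps V} := foldr (fun g z => L g z) y s.

Lemma word_act_slin s : slin (word_act s).
Proof. by elim: s => [|g s IHs] c x y //=; rewrite IHs L_slin. Qed.

Definition free_act (x : {fps free_alg F G}) (y : {fps V}) : {fps V} :=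
  hwsum id (fun s => word_act s y) x.

Lemma free_act_slinl y : slin (free_act^~ y).
Proof. exact: hwsum_slin. Qed.

Lemma free_act_word s y : free_act (hword F s) y = word_act s y.
Proof. exact: hwsum_word. Qed.

Lemma free_act_slinr x : slin (free_act x).
Proof.
move=> c y z.
apply: (slin_hfree_eq (@separated_fps F V) (f := fun x => free_act x (scal c * y + z))
  (g := fun x => scal c * free_act x y + free_act x z)) => [||s].
- exact: free_act_slinl.
- exact: slin_add (slin_scal _ (free_act_slinl y)) (free_act_slinl z).
by rewrite !free_act_word word_act_slin.
Qed.

Lemma free_actM x x' y : free_act (x * x') y = free_act x (free_act x' y).
Proof.
have V_sep := @separated_fps F V.
apply: (slin_hfree_eq V_sep (f := fun x => free_act (x * x') y)
  (g := fun x => free_act x (free_act x' y))) => [||s].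
- exact: slin_comp (slin_mulr _) (free_act_slinl y).
- exact: free_act_slinl.
rewrite free_act_word; apply: (slin_hfree_eq V_sep (f := fun x' => free_act (hword F s * x') y)
  (g := fun x' => word_act s (free_act x' y))) => [||t].
- exact: slin_comp (slin_mull _) (free_act_slinl y).
- exact: slin_comp (free_act_slinl y) (word_act_slin s).
by rewrite -hword_cat !free_act_word /word_act foldr_cat.
Qed.

Lemma free_act_letter g y : free_act (fps_cst (letter F g)) y = L g y.
Proof. by rewrite -word1 -/(hword F [:: g]) free_act_word. Qed.

Lemma free_act1 y : free_act 1 y = y.
Proof. by rewrite -[RHS]/(word_act [::] y) -free_act_word /hword /word big_nil. Qed.

Variable S : {fps free_alg F G} -> Prop.
Hypothesis free_act_rel : forall r y, S r -> free_act r y = 0.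

Definition pres_act (z : hpresented S) (y : {fps V}) : {fps V} := free_act (repr z) y.

Lemma pres_act_pi x y : pres_act (\pi_(hpresented S) x) y = free_act x y.
Proof.
have kS s t r : S r -> free_act (hword F s * r * hword F t) y = 0.
  by move=> Sr; rewrite !free_actM (free_act_rel _ Sr) free_act_word (slin0 (word_act_slin s)).
exact: (@repr_hpresented F G S _ (@separated_fps F V) (free_act^~ y) x (free_act_slinl y) kS).
Qed.

Lemma pres_act_slinl y : slin (pres_act^~ y).
Proof.
move=> c; elim/quotW=> u; elim/quotW=> v.
have -> : scal c * \pi_(hpresented S) u + \pi_(hpresented S) v
    = \pi_(hpresented S) (scal c * u + v) by rewrite piD piM.
by rewrite !pres_act_pi free_act_slinl.
Qed.

Lemma pres_act_slinr z : slin (pres_act z).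
Proof. exact: free_act_slinr. Qed.

Lemma pres_actM z z' y : pres_act (z * z') y = pres_act z (pres_act z' y).
Proof.
elim/quotW: z => u; elim/quotW: z' => v.
have -> : \pi_(hpresented S) u * \pi_(hpresented S) v = \pi_(hpresented S) (u * v).
  by rewrite piM.
by rewrite !pres_act_pi free_actM.
Qed.

Lemma pres_act1 y : pres_act 1 y = y.
Proof. by rewrite -[1]/(\pi_(hpresented S) 1) pres_act_pi free_act1. Qed.

Lemma pres_act_letter g y : pres_act (\pi_(hpresented S) (fps_cst (letter F g))) y = L g y.
Proof. by rewrite pres_act_pi free_act_letter. Qed.

End WordAction.

Lemma slinBZ (K : pzRingType) (A B : pzAlgType K) (f : A -> B) (z : K) (u v : A) :
  slin f -> f (u - scal z * v) = f u - scal z * f v.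
Proof. by move=> fl; rewrite slinB // slinZ. Qed.

Lemma subr_scal1 (K : pzRingType) (A : pzAlgType K) (u v : A) : u - v = u - scal 1 * v.
Proof. by rewrite scal1 mul1r. Qed.

(** The relations of [Mh] over an arbitrary algebra, with [ord0] and [ord_max] as indices, to serve
    for the action as well as for the limit hbar -> 0. *)
Definition Mh_relation (F : numFieldType) (A : pzAlgType {fps F}) (X : 'I_2 -> 'I_2 -> A)
    (r : A) : Prop :=
  let a := X ord0 ord0 in let b := X ord0 ord_max in
  let c := X ord_max ord0 in let d := X ord_max ord_max in
  [\/ [\/ r = a * b - scal (qexp 1) * (b * a), r = a * c - scal (qexp 1) * (c * a)
        | r = b * d - scal (qexp 1) * (d * b)],
      r = c * d - scal (qexp 1) * (d * c), r = b * c - c * b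
    | r = a * d - d * a - (scal (qexp 1) - scal (qexp (-1))) * (b * c)].

Section SpinHalf.
Variables (F : numFieldType) (V : pzAlgType F).
Local Notation K := {fps F}.
Variables (q : cg_family K) (f kap : nat -> nat -> K).
Local Notation Fl n := (@ladder_down K n (f n)).
Hypothesis f_reg : forall n i x, (0 < i <= n)%N -> f n i * x = 0 -> x = 0.
Hypothesis q_orth : cg_orthogonal q.
Hypothesis q_weight : forall a b n (i1 : 'I_a.+1) (i2 : 'I_b.+1) (i : 'I_n.+1),
  cg_range a b n -> ((i1 + i2).*2 + n != i.*2 + (a + b))%N -> q i1 i2 i = 0.
Hypothesis q_F : forall a b n (i1 : 'I_a.+1) (i2 : 'I_b.+1) (i : 'I_n.+1),
  cg_range a b n ->
  \sum_k Fl a i1 k * q k i2 i + kap a i1 * \sum_k Fl b i2 k * q i1 k i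
  = \sum_k q i1 i2 k * Fl n k i.
Hypothesis kapM : forall a b n i1 i2 i,
  ((i1 + i2).*2 + n = i.*2 + (a + b))%N -> kap a i1 * kap b i2 = kap n i.
Hypothesis q_unit_l : forall n (z : 'I_1) (k i : 'I_n.+1), q z k i = (k == i)%:R.
Local Notation i0 := (@ord0 1).
Local Notation i1 := (@ord_max 1).
Hypothesis q_triplet :
  @q 1 1 2 i0 i1 (inord 1) = qexp 1 * @q 1 1 2 i1 i0 (inord 1).
Hypothesis q_singlet :
  @q 1 1 0 i1 i0 ord0 = - qexp 1 * @q 1 1 0 i0 i1 ord0.
Hypothesis q_norm :
  @q 1 1 0 i0 i1 ord0 * @q 1 1 0 i0 i1 ord0
  + @q 1 1 0 i1 i0 ord0 * @q 1 1 0 i1 i0 ord0 = 1.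

Variable e : nat -> forall n, 'I_n.+1 -> 'I_n.+1 -> V.
Variable L : 'I_2 * 'I_2 -> {fps V} -> {fps V}.
Hypothesis L_slin : forall g, slin (L g).
Hypothesis L_e : forall (i i' : 'I_2) k n (a a' : 'I_n.+1),
  L (i, i') (fps_cst (e k a a')) = cgprod q e i i' k a a'.

Let s x1 x2 := @q 1 1 0 x1 x2 ord0.
Let t (x1 x2 : 'I_2) := @q 1 1 2 x1 x2 (inord (x1 + x2)).

Lemma cg_range11 (J : 'I_3) : cg_range 1 1 J = (J == ord0) || (J == ord_max).
Proof. by case: J => [[|[|[|//]]] ?]. Qed.

(** Two spins 1/2 couple to the singlet, which raises the power of the determinant, or to the
    triplet. Weights fix the triplet index to x1 + x2, so each channel has one coefficient, [s] or
    [t], per pair. *)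
Lemma LL_e (x1 y1 x2 y2 : 'I_2) k n (x3 y3 : 'I_n.+1) :
  L (x1, y1) (L (x2, y2) (fps_cst (e k x3 y3)))
  = scal (s x1 x2 * s y1 y2) * fps_cst (e k.+1 x3 y3)
    + scal (t x1 x2 * t y1 y2) *
      cgprod q e (inord (x1 + x2) : 'I_3) (inord (y1 + y2) : 'I_3) k x3 y3.
Proof.
have Le k' J (l l' : 'I_J.+1) := L_e x1 y1 k' l l'.
rewrite L_e; apply: etrans (cgprod_assoc f_reg q_orth q_weight q_F kapM x2 y2 x3 y3 k
  (L_slin (x1, y1)) Le) _.
rewrite (bigD1 (@ord0 (1 + 1))) ?cg_range11 //= (bigD1 (@ord_max (1 + 1))) ?cg_range11 //=.
rewrite [X in _ + (_ + X)]big1 ?addr0; last first.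
  by move=> J; rewrite -andbA cg_range11; case: eqP => //= _; case: eqP.
congr (_ + _).
  by rewrite !big_ord_recl !big_ord0 !addr0 /= cgprod_unit_l // addn1.
have w (z1 z2 : 'I_2) (i : 'I_3) : i != inord (z1 + z2) -> q z1 z2 i = 0.
  move=> ne; apply: q_weight => //; apply: contra ne => /eqP h.
  have := ltn_ord z1; have := ltn_ord z2 => l2 l1.
  by apply/eqP/val_inj; rewrite /= inordK; lia.
rewrite (bigD1 (inord (x1 + x2))) //= [X in _ + X]big1 ?addr0; last first.
  by move=> i /w ->; rewrite big1 // => i' _; rewrite mul0r scal0 mul0r.
rewrite (bigD1 (inord (y1 + y2))) //= [X in _ + X]big1 ?addr0; last first.
  by move=> i /w ->; rewrite mulr0 scal0 mul0r.
by rewrite addn0.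
Qed.

Let s00 : s i0 i0 = 0. Proof. exact: q_weight. Qed.
Let s11 : s i1 i1 = 0. Proof. exact: q_weight. Qed.
Let tE : t i0 i1 = qexp 1 * t i1 i0. Proof. exact: q_triplet. Qed.
Let sE : s i1 i0 = - qexp 1 * s i0 i1. Proof. exact: q_singlet. Qed.

Let LL (x1 y1 x2 y2 : 'I_2) y := L (x1, y1) (L (x2, y2) y).

Lemma scal_comb2 (A : pzAlgType K) (z d1 d2 : K) (u v : A) :
  scal (z * d1) * u + scal (z * d2) * v - scal z * (scal d1 * u + scal d2 * v) = 0.
Proof. by rewrite !scalM mulrDr !mulrA subrr. Qed.

(** A commutation relation splits into one scalar identity for the singlet and one for the triplet,
    because the triplet index is symmetric in the two factors. *)
Lemma LL_commute (u u' v v' : 'I_2) k n (x3 y3 : 'I_n.+1) (z : K) :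
  s u v * s u' v' = z * (s v u * s v' u') -> t u v * t u' v' = z * (t v u * t v' u') ->
  LL u u' v v' (fps_cst (e k x3 y3)) - scal z * LL v v' u u' (fps_cst (e k x3 y3)) = 0.
Proof.
move=> hs ht; rewrite /LL !LL_e hs ht [(v + u)%N]addnC [(v' + u')%N]addnC.
exact: scal_comb2.
Qed.

Lemma scal_comb3 (A : pzAlgType K) (z c1 c2 c3 d1 d2 d3 : K) (u v : A) :
  c1 - c2 - z * c3 = 0 -> d1 - d2 - z * d3 = 0 ->
  scal c1 * u + scal d1 * v - (scal c2 * u + scal d2 * v)
    - scal z * (scal c3 * u + scal d3 * v) = 0.
Proof.
move=> hc hd.
rewrite mulrDr [scal z * (scal c3 * u)]mulrA [scal z * (scal d3 * v)]mulrA -!scalM.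
rewrite opprD addrACA -!mulrBl opprD addrACA -!mulrBl -!scalB hc hd.
by rewrite scal0 !mul0r addr0.
Qed.

(** The scalar identities come from [sE], [tE], the vanishing of [s00] and [s11], and q^-1 q = 1.
    Only the last relation combines three products. *)
Lemma Mh_relations_e r k n (x3 y3 : 'I_n.+1) :
  Mh_relation (fun i j : 'I_2 => fps_cst (letter F (i, j))) r ->
  free_act L r (fps_cst (e k x3 y3)) = 0.
Proof.
pose X (i j : 'I_2) := fps_cst (letter F (i, j)) : {fps free_alg F ('I_2 * 'I_2)%type}.
pose a := X i0 i0; pose b := X i0 i1; pose c := X i1 i0; pose d := X i1 i1.
set y := fps_cst _.
have fl := free_act_slinl L y.
have XX u u' v v' : free_act L (X u u' * X v v') y = LL u u' v v' y.
  by rewrite (free_actM L_slin) !(free_act_letter L).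
have ab u u' v v' z : s u v * s u' v' = z * (s v u * s v' u') ->
    t u v * t u' v' = z * (t v u * t v' u') ->
    free_act L (X u u' * X v v' - scal z * (X v v' * X u u')) y = 0.
  move=> hs ht; apply: etrans (slinBZ z (X u u' * X v v') (X v v' * X u u') fl) _.
  apply: etrans (f_equal2 (fun p p' => p - scal z * p') (XX _ _ _ _) (XX _ _ _ _)) _.
  exact: LL_commute.
have inv : qexp (-1) * qexp 1 = 1 :> K by rewrite -qexpD addNr qexp0.
case=> [[->|->|->]|->|->|->].
- by apply: ab; [rewrite s00 !mul0r mulr0 | rewrite tE; ring].
- by apply: ab; [rewrite s00 !mulr0 | rewrite tE; ring].
- by apply: ab; [rewrite s11 !mulr0 | rewrite tE; ring].
- by apply: ab; [rewrite s11 !mul0r mulr0 | rewrite tE; ring].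
- have E : b * c - c * b = b * c - scal 1 * (c * b) by exact: subr_scal1.
  by rewrite E; apply: ab; rewrite mul1r mulrC.
have Q : scal (qexp 1) - scal (qexp (-1)) = scal (qexp 1 - qexp (-1))
  :> {fps free_alg F ('I_2 * 'I_2)%type} by rewrite scalB.
rewrite Q; apply: etrans (slinBZ _ (a * d - d * a) (b * c) fl) _; apply: etrans (f_equal2 (fun p p' => p - scal _ * p')
  (etrans (slinB fl _ _) (f_equal2 (fun p p' => p - p') (XX _ _ _ _) (XX _ _ _ _))) (XX _ _ _ _)) _.
rewrite /LL !LL_e; apply: scal_comb3.
  rewrite sE; set z := s i0 i1; set p := qexp 1 in inv *; set p' := qexp (-1) in inv *.
  have -> : z * z - - p * z * (- p * z) - (p - p') * (z * (- p * z))
    = z * z * (1 - p' * p) by ring.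
  by rewrite inv subrr mulr0.
rewrite tE; set z := t i1 i0; set p := qexp 1 in inv *; set p' := qexp (-1) in inv *.
have -> : p * z * (p * z) - z * z - (p - p') * (p * z * z)
  = z * z * (p' * p - 1) by ring.
by rewrite inv subrr mulr0.
Qed.

(* The left-hand side is the action of [det_q]. *)
Lemma det_e k n (x3 y3 : 'I_n.+1) :
  LL i0 i0 i1 i1 (fps_cst (e k x3 y3))
    - scal (qexp 1) * LL i0 i1 i1 i0 (fps_cst (e k x3 y3)) = fps_cst (e k.+1 x3 y3).
Proof.
rewrite /LL !LL_e mulrDr opprD addrACA !mulrA -!scalM -!mulrBl -!scalB.
have -> : s i0 i1 * s i0 i1 - qexp 1 * (s i0 i1 * s i1 i0) = 1.
  have := q_norm; rewrite -/(s i0 i1) -/(s i1 i0) sE => <-; ring.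
have -> : t i0 i1 * t i0 i1 - qexp 1 * (t i0 i1 * t i1 i0) = 0.
  rewrite tE; ring.
by rewrite scal1 mul1r scal0 mul0r addr0.
Qed.

End SpinHalf.

Section RegularRepresentation.
Variables (F : numFieldType) (V : pzAlgType F) (H : pzAlgType {fps F}).
Local Notation K := {fps F}.
Variables (q : cg_family K) (f kap : nat -> nat -> K).
Local Notation Fl n := (@ladder_down K n (f n)).
Hypothesis f_reg : forall n i x, (0 < i <= n)%N -> f n i * x = 0 -> x = 0.
Hypothesis q_orth : cg_orthogonal q.
Hypothesis q_weight : forall a b n (i1 : 'I_a.+1) (i2 : 'I_b.+1) (i : 'I_n.+1),
  cg_range a b n -> ((i1 + i2).*2 + n != i.*2 + (a + b))%N -> q i1 i2 i = 0.
Hypothesis q_F : forall a b n (i1 : 'I_a.+1) (i2 : 'I_b.+1) (i : 'I_n.+1),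
  cg_range a b n ->
  \sum_k Fl a i1 k * q k i2 i + kap a i1 * \sum_k Fl b i2 k * q i1 k i
  = \sum_k q i1 i2 k * Fl n k i.
Hypothesis kapM : forall a b n i1 i2 i,
  ((i1 + i2).*2 + n = i.*2 + (a + b))%N -> kap a i1 * kap b i2 = kap n i.
Hypothesis q_unit_l : forall n (z : 'I_1) (k i : 'I_n.+1), q z k i = (k == i)%:R.
Hypothesis q_unit_r : forall n (z : 'I_1) (k i : 'I_n.+1), q k z i = (k == i)%:R.

Variable e : nat -> forall n, 'I_n.+1 -> 'I_n.+1 -> V.
Variables (D : H) (T : forall n, 'I_n.+1 -> 'I_n.+1 -> H).
Hypothesis T0 : forall i i' : 'I_1, T i i' = 1.
Hypothesis T_succ : forall n (i i' : 'I_n.+2), T i i'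
  = \sum_(p : 'I_2 * 'I_n.+1) \sum_(p' : 'I_2 * 'I_n.+1)
      scal (q p.1 p.2 i * q p'.1 p'.2 i') * (T p.1 p'.1 * T p.2 p'.2).
Variable A : H -> {fps V} -> {fps V}.
Hypothesis act_slinl : forall y, slin (A^~ y).
Hypothesis act_slinr : forall x, slin (A x).
Hypothesis actM : forall x z y, A (x * z) y = A x (A z y).
Hypothesis act1 : forall y, A 1 y = y.
Hypothesis act_T1 : forall (i i' : 'I_2) k n (a a' : 'I_n.+1),
  A (T i i') (fps_cst (e k a a')) = cgprod q e i i' k a a'.
Hypothesis act_D : forall k n (a a' : 'I_n.+1),
  A D (fps_cst (e k a a')) = fps_cst (e k.+1 a a').

Lemma sum_delta_range (N n : nat) (i i' : 'I_n.+1)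
    (E : forall j, 'I_j.+1 -> 'I_j.+1 -> {fps V}) (p : pred nat) : (n <= N)%N -> p n ->
  \sum_(j < N.+1 | p j) \sum_(m < j.+1) \sum_(m' < j.+1)
     scal (((n == j) && (i == m :> nat))%:R * ((n == j) && (i' == m' :> nat))%:R : K) * E j m m'
  = E n i i'.
Proof.
rewrite -ltnS => nN pn; rewrite (bigD1 (Ordinal nN)) //= [X in _ + X]big1 ?addr0; last first.
  move=> j /andP[_ /negPf jn]; rewrite big1 // => m _; rewrite big1 // => m' _.
  by rewrite eq_sym -[j == n :> nat]/(j == Ordinal nN) jn mul0r scal0 mul0r.
rewrite -[RHS](@sum_delta2 F V n i i' (E n)).
by apply: eq_bigr => m _; apply: eq_bigr => m' _; rewrite !eqxx.
Qed.

(** Induction through [T_succ]. Associativity produces a sum over the spins j in 1/2 (x) n/2, and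
    summation against the coefficients of [T_succ] selects j = n + 1 by orthogonality. *)
Lemma act_T n (i i' : 'I_n.+1) k n2 (a a' : 'I_n2.+1) :
  A (T i i') (fps_cst (e k a a')) = cgprod q e i i' k a a'.
Proof.
elim: n => [|n IHn] in i i' *; first by rewrite T0 act1 cgprod_unit_l.
rewrite T_succ (slin_sum (act_slinl _)).
pose U (p : 'I_2 * 'I_n.+1) j (m : 'I_j.+1) := q p.1 p.2 m.
transitivity (\sum_p \sum_p' scal (q p.1 p.2 i * q p'.1 p'.2 i') *
     \sum_(j < (1 + n).+1 | cg_range 1 n j) \sum_(m < j.+1) \sum_(m' < j.+1)
        scal (U p j m * U p' j m') * cgprod q e m m' (k + (1 + n - j)./2)%N a a').
  apply: eq_bigr => p _; rewrite (slin_sum (act_slinl _)); apply: eq_bigr => p' _.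
  rewrite (slinZ (act_slinl _)) actM IHn; congr (_ * _).
  have Le k' J (l l' : 'I_J.+1) := act_T1 p.1 p'.1 k' l l'.
  exact: (cgprod_assoc f_reg q_orth q_weight q_F kapM p.2 p'.2 a a' k (act_slinr _) Le).
have := @couple_sum F {fps V} _ (1 + n) (cg_range 1 n)
  (fun p : 'I_2 * 'I_n.+1 => q p.1 p.2 i) (fun p => q p.1 p.2 i') U U
  (fun j m m' => cgprod q e m m' (k + (1 + n - j)./2)%N a a').
move=> /= ->; have r : cg_range 1 n n.+1 := cg_range_add 1 n.
have [_ orth] := q_orth 1 n.
have E := @sum_delta_range (1 + n) n.+1 i i'
  (fun j m m' => cgprod q e m m' (k + (1 + n - j)./2)%N a a') (cg_range 1 n) (leqnn _) r.
apply: etrans (etrans E _); last by rewrite add1n subnn addn0.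
apply: eq_bigr => j rj; apply: eq_bigr => m _; apply: eq_bigr => m' _.
have o (x : 'I_n.+2) (y : 'I_j.+1) : \sum_p q p.1 p.2 x * U p j y
    = ((n.+1 == j) && (x == y :> nat))%:R.
  rewrite -(orth n.+1 j x y r rj).
  by rewrite -(pair_bigA _ (fun a b => q a b x * q a b y)).
by rewrite !o.
Qed.

Lemma act_DX d k n (a a' : 'I_n.+1) :
  A (D ^+ d) (fps_cst (e k a a')) = fps_cst (e (d + k) a a').
Proof.
elim: d => [|d IHd]; first by rewrite expr0 act1.
by rewrite exprS actM IHd act_D.
Qed.

Lemma act_DX_T d n (i i' : 'I_n.+1) k n2 (a a' : 'I_n2.+1) :
  A (D ^+ d * T i i') (fps_cst (e k a a')) = cgprod q e i i' (d + k) a a'.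
Proof.
rewrite actM act_T slin_sum //; apply: eq_bigr => j _.
rewrite slin_sum //; apply: eq_bigr => m _; rewrite slin_sum //; apply: eq_bigr => m' _.
by rewrite slinZ // act_DX addnA.
Qed.

Variable I : eqType.
Variable b : I -> V.
Hypothesis b_span : forall v, exists (s : seq I) (c : I -> F),
  v = \sum_(i <- s) scal (c i) * b i.
Hypothesis b_e : forall i, exists k n (a a' : 'I_n.+1), b i = e k a a'.
Variables (phi : H -> {fps V}) (psi : {fps V} -> H).
Hypotheses (phi_slin : slin phi) (phiK : cancel phi psi) (psiK : cancel psi phi).
Hypothesis phi_T : forall d n (i i' : 'I_n.+1), phi (D ^+ d * T i i') = fps_cst (e d i i').

Lemma psi_slin : slin psi.
Proof. by move=> c x y; apply: (can_inj phiK); rewrite phi_slin !psiK. Qed.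

(** The vector acted on has spin 0 and no determinant factor. By [cgprod_unit_r] the product formula
    has a single term there, so both sides agree on the basis. *)
Lemma act_vacuum x : A x (fps_cst (e 0 (@ord0 0) (@ord0 0))) = phi x.
Proof.
set u := fps_cst _; rewrite -[x in LHS]phiK; move: (phi x) => {x}.
apply: (slin_fps_basis_eq b_span (separated_fps (A := V))
  (f := fun y => A (psi y) u) (g := id)) => [||i].
- exact: slin_comp psi_slin (act_slinl u).
- exact: slin_id.
have [k [n [a [a' ->]]]] := b_e i.
by rewrite -phi_T phiK act_DX_T addn0 cgprod_unit_r // phi_T.
Qed.

Lemma phiM x z : phi (x * z) = A x (phi z).
Proof. by rewrite -!act_vacuum actM. Qed.

Theorem product_formula d n (i i' : 'I_n.+1) k n2 (a a' : 'I_n2.+1) :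
  phi (D ^+ d * T i i' * (D ^+ k * T a a')) = cgprod q e i i' (d + k) a a'.
Proof. by rewrite phiM phi_T act_DX_T. Qed.

Variable lam : H -> V.
Hypotheses (lamD : {morph lam : x y / x + y}) (lamM : {morph lam : x y / x * y}).
Hypothesis lamZ : forall c x, lam (scal c * x) = scal (c 0%N) * lam x.
Hypothesis lam_T : forall k n (i i' : 'I_n.+1), lam (D ^+ k * T i i') = e k i i'.

(** [lam] kills multiples of hbar by [lamZ], so only the constant term of [phi x] matters, and on
    basis vectors the two agree. It turns the product formula into its undeformed version. *)
Lemma lam_phi x : lam x = phi x 0%N.
Proof.
rewrite -[x in LHS]phiK; move: (phi x) => {x} y.
rewrite {1}(fps_split y 1) big_ord1 expr0 scal1 mul1r expr1.
rewrite (slinD psi_slin) (slinZ psi_slin) lamD lamZ scal0 mul0r addr0.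
have [s [c ->]] := b_span (y 0%N); rewrite fps_cst_sum (slin_sum psi_slin).
have lam0 : lam 0 = 0 by apply: (@addrI _ (lam 0)); rewrite -lamD !addr0.
rewrite (big_morph lam lamD lam0); apply: eq_bigr => i _.
rewrite fps_cstM -fps_scal_cst (slinZ psi_slin) lamZ; congr (_ * _).
by have [k [n [a [a' ->]]]] := b_e i; rewrite -phi_T phiK lam_T.
Qed.

Theorem product_formula_lim d n (i i' : 'I_n.+1) k n2 (a a' : 'I_n2.+1) :
  e d i i' * e k a a'
  = \sum_(j < (n + n2).+1 | cg_range n n2 j) \sum_(m < j.+1) \sum_(m' < j.+1)
      scal (q i a m 0%N * q i' a' m' 0%N) * e (d + k + (n + n2 - j)./2)%N m m'.
Proof.
rewrite -!lam_T -lamM lam_phi product_formula fps_coef_sum; apply: eq_bigr => j _.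
rewrite fps_coef_sum; apply: eq_bigr => m _; rewrite fps_coef_sum; apply: eq_bigr => m' _.
by rewrite fps_scalE big_ord1 fps_coefM big_ord1.
Qed.

End RegularRepresentation.

(** * The limit hbar -> 0 *)

Section HpresentedLimit.
Variables (F : comNzRingType) (G : choiceType) (V : pzAlgType F) (v : G -> V).
Variable S : {fps free_alg F G} -> Prop.

Definition word_lim (x : {fps free_alg F G}) : V :=
  wsum id (fun w => \prod_(g <- w) v g) (x 0%N).

Lemma word_limD : {morph word_lim : x y / x + y}.
Proof. by move=> x y; have [l _ _] := wsum_prod_ahom v; rewrite /word_lim (slinD l). Qed.
Lemma word_limB : {morph word_lim : x y / x - y}.
Proof. by move=> x y; have [l _ _] := wsum_prod_ahom v; rewrite /word_lim (slinB l). Qed.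
Lemma word_limM : {morph word_lim : x y / x * y}.
Proof.
move=> x y; have [_ M _] := wsum_prod_ahom v.
by rewrite /word_lim fps_coefM big_ord1 M.
Qed.
Lemma word_lim1 : word_lim 1 = 1.
Proof. by have [_ _ h1] := wsum_prod_ahom v. Qed.
Lemma word_lim_scal c : word_lim (scal c) = scal (c 0%N).
Proof. exact: (ahom_scal (c 0%N) (wsum_prod_ahom v)). Qed.
Lemma word_lim_letter g : word_lim (fps_cst (letter F g)) = v g.
Proof. exact: wsum_letter. Qed.

Hypothesis lim_rel : forall r, S r -> word_lim r = 0.

Definition hpres_lim (z : hpresented S) : V := word_lim (repr z).

Lemma hpres_lim_pi x : hpres_lim (\pi_(hpresented S) x) = word_lim x.
Proof.
apply/eqP; rewrite -subr_eq0 -word_limB; apply/eqP.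
(* Agreement to first order with an element of the ideal is enough, since [word_lim] reads the
   constant coefficient only. *)
have /(_ 1%N)[y Iy xy] := @quot_repr _ (ideal_closure (ideal_gen S)) x.
rewrite /word_lim xy // -/(word_lim y).
apply: (ideal_gen0 word_limD) Iy => a b r Sr.
by rewrite !word_limM (lim_rel Sr) mulr0 mul0r.
Qed.

Lemma hpres_limD : {morph hpres_lim : x y / x + y}.
Proof.
elim/quotW=> x; elim/quotW=> y.
by apply: etrans (congr1 hpres_lim (esym (piD _ x y))) _; rewrite !hpres_lim_pi word_limD.
Qed.
Lemma hpres_limM : {morph hpres_lim : x y / x * y}.
Proof.
elim/quotW=> x; elim/quotW=> y.
by apply: etrans (congr1 hpres_lim (esym (piM _ x y))) _; rewrite !hpres_lim_pi word_limM.
Qed.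
Lemma hpres_lim1 : hpres_lim 1 = 1.
Proof. by apply: etrans (hpres_lim_pi 1) word_lim1. Qed.
Lemma hpres_limZ c x : hpres_lim (scal c * x) = scal (c 0%N) * hpres_lim x.
Proof.
rewrite hpres_limM; congr (_ * _).
by apply: etrans (hpres_lim_pi (scal c)) (word_lim_scal c).
Qed.
Lemma hpres_lim_letter g :
  hpres_lim (\pi_(hpresented S) (fps_cst (letter F g))) = v g.
Proof. by rewrite hpres_lim_pi word_lim_letter. Qed.

End HpresentedLimit.

Lemma Mh_relation_lim (F : numFieldType) (A : pzAlgType {fps F}) (V : comPzRingType)
    (g : A -> V) (X : 'I_2 -> 'I_2 -> A) r :
  {morph g : x y / x - y} -> {morph g : x y / x * y} ->
  (forall a, g (scal (qexp a)) = 1) -> Mh_relation X r -> g r = 0.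
Proof.
move=> gB gM gq.
by case=> [[->|->|->]|->|->|->]; rewrite !gB !gM ?gB ?gq ?mul1r; ring.
Qed.

Lemma Mh_det_lim (F : fieldType) (A : pzAlgType {fps F}) (V : pzAlgType F) (g : A -> V)
    (x y z w : A) :
  {morph g : x y / x + y} -> {morph g : x y / x * y} ->
  (forall c x, g (scal c * x) = scal (c 0%N) * g x) ->
  g (x * y - scal (qexp 1) * (z * w)) = g x * g y - g z * g w.
Proof.
move=> gD gM gZ; rewrite -mulNr -scalN gD gZ !gM fps_coefN /= expr0 fact0 invr1 mulr1.
by rewrite scalN scal1 mulN1r.
Qed.

Section MhIdentification.
Variables (R : realType) (cq : cg_family {fps R}).
Local Notation C := R[i].
Local Notation K := {fps C}.
Local Notation V := (X0 R : pzAlgType C).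
Local Notation H := (Mh R : pzAlgType K).
Variable T : forall n : nat, 'I_n.+1 -> 'I_n.+1 -> Mh R.
Variables (phi : Mh R -> {fps X0 R}) (hphi : is_identification T phi).
Local Notation q := (qcg cq).

Definition det_T (k n : nat) (i i' : 'I_n.+1) : X0 R := det_0 R ^+ k * T_lim T i i'.

Definition det_T_tagged (t : {n : nat & (nat * 'I_n.+1 * 'I_n.+1)%type}) : X0 R :=
  det_T (tagged t).1.1 (tagged t).1.2 (tagged t).2.

Lemma X0_scaleE (a : C) (x : X0 R) : a *: x = scal a * x.
Proof. exact: esym (mpoly.mul_mpolyC _ _). Qed.

Lemma phi_slin : slin (phi : H -> {fps V}).
Proof.
move=> a x y; apply: etrans (phi_linear hphi a x y) _; congr (_ + _).
by apply: fpsP => n; apply: eq_bigr => k _; rewrite X0_scaleE.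
Qed.

Lemma det_T_basis : is_basis det_T_tagged.
Proof.
have := phi_basis hphi; congr is_basis; apply: funext => -[n [[k i] i']].
by [].
Qed.

Lemma det_T_free (s : seq {n : nat & (nat * 'I_n.+1 * 'I_n.+1)%type})
    (a : {n : nat & (nat * 'I_n.+1 * 'I_n.+1)%type} -> C) : uniq s ->
  \sum_(t <- s) (scal (a t) : V) * det_T_tagged t = 0 -> forall t, t \in s -> a t = 0.
Proof.
move=> us e; apply: (proj1 det_T_basis s a us); apply: etrans e.
by apply: eq_bigr => t _; exact: X0_scaleE.
Qed.

Lemma det_T_span (v : V) : exists (s : seq {n : nat & (nat * 'I_n.+1 * 'I_n.+1)%type})
  (a : {n : nat & (nat * 'I_n.+1 * 'I_n.+1)%type} -> C),
  v = \sum_(t <- s) scal (a t) * det_T_tagged t.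
Proof.
have [s [a ->]] := proj2 det_T_basis v; exists s, a.
by apply: eq_bigr => t _; exact: X0_scaleE.
Qed.

Lemma det_T_taggedP t : exists k n (a a' : 'I_n.+1), det_T_tagged t = det_T k a a'.
Proof. by case: t => n [[k a] a']; exists k, n, a, a'. Qed.

Definition phi_inv : {fps X0 R} -> Mh R := inverse_map phi.

Lemma phi_invK : cancel phi_inv phi.
Proof.
move=> y; have [psi _ psiK] := phi_bij hphi.
exact: (@xgetPex _ 0 [set x | phi x = y]%classic (ex_intro _ (psi y) (psiK y))).
Qed.

Lemma phiK : cancel phi phi_inv.
Proof. by move=> x; apply: (bij_inj (phi_bij hphi)); rewrite phi_invK. Qed.

(** Transported from X[[hbar]] along the linear bijection [phi]. Comparisons of linear maps into
    [Mh] on pure tensors rely on it. *)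
Lemma Mh_separated : separated H.
Proof.
move=> w wP; apply: (bij_inj (phi_bij hphi)); rewrite (slin0 phi_slin).
apply: (separated_fps (A := V)) => N; have [w' ->] := wP N.
by exists (phi w'); exact: (slinZ phi_slin).
Qed.

Lemma exists_left_mult : exists L : 'I_2 * 'I_2 -> {fps V} -> {fps V},
  (forall g, slin (L g)) /\ forall (i i' : 'I_2) k n (a a' : 'I_n.+1),
    L (i, i') (fps_cst (det_T k a a')) = cgprod q det_T i i' k a a'.
Proof.
have /choice[L LP] : forall g : 'I_2 * 'I_2, exists G : {fps V} -> {fps V},
    slin G /\ forall k n (a a' : 'I_n.+1),
    G (fps_cst (det_T k a a')) = cgprod q det_T (g.1 : 'I_2) (g.2 : 'I_2) k a a'.
  move=> g; have [G Gl Ge] := basis_fps_extend det_T_free det_T_span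
    (fun t => cgprod q det_T (g.1 : 'I_2) (g.2 : 'I_2) (tagged t).1.1 (tagged t).1.2 (tagged t).2).
  exists G; split=> // k n a a'.
  exact: (Ge (Tagged (fun n => nat * 'I_n.+1 * 'I_n.+1)%type (k, a, a'))).
exists L; split=> [g|i i' k n a a']; first exact: proj1 (LP g).
exact: (proj2 (LP (i, i'))).
Qed.

Lemma Mh_relE r : Mh_rel r ->
  Mh_relation (fun i j : 'I_2 => fps_cst (letter C (i, j))) r.
Proof.
have e0 : 0 = ord0 :> 'I_2 by apply: val_inj.
have e1 : 1 = ord_max :> 'I_2 by apply: val_inj.
by rewrite /Mh_rel e0 e1.
Qed.

End MhIdentification.

Section MhProduct.
Variables (R : realType) (c : cg_family R) (cq : cg_family {fps R}).
Hypotheses (hc : is_CG c) (hcq : is_qCG c cq).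
Local Notation C := R[i].
Local Notation K := {fps C}.
Local Notation V := (X0 R : pzAlgType C).
Local Notation H := (Mh R : pzAlgType K).
Variables (acth : so4h R -> Mh R -> Mh R) (hacth : is_Mh_action acth).
Variables (T : forall n : nat, 'I_n.+1 -> 'I_n.+1 -> Mh R) (hT : is_T acth T).
Variables (phi : Mh R -> {fps X0 R}) (hphi : is_identification T phi).
Local Notation q := (qcg cq).
Local Notation e := (det_T T).

Let f n i := qdn R n i.
Let kap n i := qkap R n i.
Let f_reg n i x : (0 < i <= n)%N -> f n i * x = 0 -> x = 0.
Proof. exact: qdn_reg. Qed.
Let q_orth : cg_orthogonal q := qcg_orth hcq.
Let q_weight a b n (i1 : 'I_a.+1) (i2 : 'I_b.+1) (i : 'I_n.+1) :
  cg_range a b n -> ((i1 + i2).*2 + n != i.*2 + (a + b))%N -> q i1 i2 i = 0.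
Proof. exact: (qcg_weight hcq). Qed.
Let q_F a b n (i1 : 'I_a.+1) (i2 : 'I_b.+1) (i : 'I_n.+1) : cg_range a b n ->
  \sum_k @ladder_down K a (f a) i1 k * q k i2 i
    + kap a i1 * \sum_k @ladder_down K b (f b) i2 k * q i1 k i
  = \sum_k q i1 i2 k * @ladder_down K n (f n) k i.
Proof. exact: (qcg_F hcq). Qed.
Let kapM a b n i1 i2 i :
  ((i1 + i2).*2 + n = i.*2 + (a + b))%N -> kap a i1 * kap b i2 = kap n i.
Proof. exact: qkapM. Qed.
Let q_unit_l n (z : 'I_1) (k i : 'I_n.+1) : q z k i = (k == i)%:R.
Proof. exact: (qcg_unit_l hc hcq). Qed.
Let q_unit_r n (z : 'I_1) (k i : 'I_n.+1) : q k z i = (k == i)%:R.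
Proof. exact: (qcg_unit_r hc hcq). Qed.

Section LeftMultiplication.
Variable L : 'I_2 * 'I_2 -> {fps V} -> {fps V}.
Hypothesis L_slin : forall g, slin (L g).
Hypothesis L_e : forall (i i' : 'I_2) k n (a a' : 'I_n.+1),
  L (i, i') (fps_cst (e k a a')) = cgprod q e i i' k a a'.

Lemma free_act_Mh_rel r y : @Mh_rel R r -> free_act L r y = 0.
Proof.
move=> /Mh_relE hr; move: y.
apply: (slin_fps_basis_eq (det_T_span hphi) (separated_fps (A := V)) (f := free_act L r)
  (g := fun=> 0)) => [||t].
- exact: free_act_slinr.
- by move=> a x y; rewrite mulr0 addr0.
have [k [n [a [a' ->]]]] := det_T_taggedP T t.
exact: (Mh_relations_e f_reg q_orth q_weight q_F kapM q_unit_l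
  (qcg_half_triplet hcq) (qcg_half_singlet hcq) L_slin L_e k a a' hr).
Qed.

Definition Mh_act (z : H) (y : {fps V}) : {fps V} := @pres_act _ _ _ L (@Mh_rel R) z y.

Lemma Mh_act_slinl y : slin (Mh_act^~ y).
Proof. exact: (pres_act_slinl L_slin free_act_Mh_rel). Qed.
Lemma Mh_act_slinr z : slin (Mh_act z).
Proof. exact: (pres_act_slinr L_slin). Qed.
Lemma Mh_actM z z' y : Mh_act (z * z') y = Mh_act z (Mh_act z' y).
Proof. exact: (pres_actM L_slin free_act_Mh_rel). Qed.
Lemma Mh_act1 y : Mh_act 1 y = y.
Proof. exact: (pres_act1 L_slin free_act_Mh_rel). Qed.
Lemma Mh_act_X i j y : Mh_act (Mh_X R i j) y = L (i, j) y.
Proof. exact: (pres_act_letter L_slin free_act_Mh_rel). Qed.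

Lemma Mh_act_T1 (i i' : 'I_2) k n (a a' : 'I_n.+1) :
  Mh_act (T i i') (fps_cst (e k a a')) = cgprod q e i i' k a a'.
Proof. by rewrite -(Mh_X_T hacth hT) Mh_act_X L_e. Qed.

Lemma Mh_act_det k n (a a' : 'I_n.+1) :
  Mh_act (det_q R) (fps_cst (e k a a')) = fps_cst (e k.+1 a a').
Proof.
have e0 : 0 = ord0 :> 'I_2 by apply: val_inj.
have e1 : 1 = ord_max :> 'I_2 by apply: val_inj.
rewrite /det_q e0 e1.
apply: etrans (slinBZ _ _ _ (Mh_act_slinl _)) _.
have XX i i' j j' y : Mh_act (Mh_X R i i' * Mh_X R j j') y = L (i, i') (L (j, j') y).
  by rewrite Mh_actM !Mh_act_X.
apply: etrans (f_equal2 (fun u v => u - scal (qexp 1) * v) (XX _ _ _ _ _) (XX _ _ _ _ _)) _.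
exact: (det_e f_reg q_orth q_weight q_F kapM q_unit_l
  (qcg_half_triplet hcq) (qcg_half_singlet hcq) (qcg_half_norm hcq) L_slin L_e).
Qed.

End LeftMultiplication.

Let v (g : 'I_2 * 'I_2) : V := X0_X R g.1 g.2.

Lemma Mh_lim_rel r : @Mh_rel R r -> word_lim v r = 0.
Proof.
move=> /Mh_relE; apply: (@Mh_relation_lim _ _ (X0 R) (word_lim v)).
- exact: word_limB.
- exact: word_limM.
by move=> a; rewrite word_lim_scal /qexp /= expr0 mulr1 invr1 scal1.
Qed.

Lemma Mh_limD : {morph @Mh_lim R : x y / x + y}.
Proof. exact: (hpres_limD Mh_lim_rel). Qed.
Lemma Mh_limM : {morph @Mh_lim R : x y / x * y}.
Proof. exact: (hpres_limM Mh_lim_rel). Qed.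
Lemma Mh_lim1 : @Mh_lim R 1 = 1.
Proof. exact: (hpres_lim1 Mh_lim_rel). Qed.
Lemma Mh_limZ (a : K) (x : Mh R) : Mh_lim (scal a * x) = scal (a 0%N) * Mh_lim x.
Proof. exact: (hpres_limZ Mh_lim_rel). Qed.
Lemma Mh_lim_X i j : Mh_lim (Mh_X R i j) = X0_X R i j.
Proof. exact: (hpres_lim_letter Mh_lim_rel (i, j)). Qed.

Lemma Mh_lim_det : Mh_lim (det_q R) = det_0 R.
Proof.
apply: etrans (Mh_det_lim (A := H) (V := V) (g := @Mh_lim R) _ _ _ _ Mh_limD Mh_limM Mh_limZ) _.
exact: (f_equal2 (fun u v => u - v)
  (f_equal2 *%R (Mh_lim_X _ _) (Mh_lim_X _ _)) (f_equal2 *%R (Mh_lim_X _ _) (Mh_lim_X _ _))).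
Qed.

Lemma Mh_lim_T k n (i i' : 'I_n.+1) : Mh_lim (det_q R ^+ k * T i i') = e k i i'.
Proof.
rewrite Mh_limM; congr (_ * _); elim: k => [|k IHk]; first by rewrite !expr0 Mh_lim1.
by rewrite !exprS Mh_limM IHk Mh_lim_det.
Qed.

Let T_succ_scal n (i i' : 'I_n.+2) : T i i'
  = \sum_(p : 'I_2 * 'I_n.+1) \sum_(p' : 'I_2 * 'I_n.+1)
      (scal (q p.1 p.2 i * q p'.1 p'.2 i') : H) * (T p.1 p'.1 * T p.2 p'.2).
Proof. exact: (T_succ hc hcq hacth hT (Mh_separated hphi)). Qed.

Theorem Mh_product k1 n1 (i i' : 'I_n1.+1) k2 n2 (a a' : 'I_n2.+1) :
  phi (det_q R ^+ k1 * T i i' * (det_q R ^+ k2 * T a a')) = cgprod q e i i' (k1 + k2) a a'.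
Proof.
have [L [L_slin L_e]] := exists_left_mult cq hphi.
exact: (product_formula f_reg q_orth q_weight q_F kapM q_unit_l q_unit_r (T0 hT)
  T_succ_scal (Mh_act_slinl L_slin L_e) (Mh_act_slinr L_slin) (Mh_actM L_slin L_e)
  (Mh_act1 L_slin L_e) (Mh_act_T1 L_slin L_e) (Mh_act_det L_slin L_e)
  (det_T_span hphi) (det_T_taggedP T) (phi_slin hphi) (phiK hphi) (phi_invK hphi) (phi_T hphi)).
Qed.

Theorem X0_product k1 n1 (i i' : 'I_n1.+1) k2 n2 (a a' : 'I_n2.+1) :
  e k1 i i' * e k2 a a'
  = \sum_(n < (n1 + n2).+1 | cg_range n1 n2 n) \sum_(m < n.+1) \sum_(m' < n.+1)
      scal (real_complex R (c i a m * c i' a' m')) * e (k1 + k2 + (n1 + n2 - n)./2)%N m m'.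
Proof.
have [L [L_slin L_e]] := exists_left_mult cq hphi.
apply: etrans (product_formula_lim f_reg q_orth q_weight q_F kapM q_unit_l q_unit_r (T0 hT)
  T_succ_scal (Mh_act_slinl L_slin L_e) (Mh_act_slinr L_slin) (Mh_actM L_slin L_e)
  (Mh_act1 L_slin L_e) (Mh_act_T1 L_slin L_e) (Mh_act_det L_slin L_e)
  (det_T_span hphi) (det_T_taggedP T) (phi_slin hphi) (phiK hphi) (phi_invK hphi) (phi_T hphi)
  Mh_limD Mh_limM Mh_limZ Mh_lim_T k1 i i' k2 a a') _.
apply: eq_bigr => n r; apply: eq_bigr => m _; apply: eq_bigr => m' _.
by rewrite !(qcg_lim hcq) // rmorphM.
Qed.

End MhProduct.

(** * The twisted product *)

Section TwistLegs.
Variables (F : comNzRingType) (A : pzAlgType F) (I J : finType).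
Variables (f : A -> fmx F I) (g : A -> fmx F J).
Hypotheses (fh : ahom f) (gh : ahom g).
Local Notation AA := (tens A A).

Lemma tensl_pure (a : A) : tensl A a = tpure a (1 : A).
Proof. by have [_ _ r1] := @tensr_ahom F A A; rewrite /tpure r1 mulr1. Qed.
Lemma tensr_pure (a : A) : tensr A a = tpure (1 : A) a.
Proof. by have [_ _ l1] := @tensl_ahom F A A; rewrite /tpure l1 mul1r. Qed.

Definition rep4 : tens AA AA -> fmx F ((I * I) * (J * J))%type :=
  tens_rep (tens_rep f f) (tens_rep g g).

Lemma rep4_ahom : ahom rep4.
Proof. exact: tens_rep_ahom (tens_rep_ahom fh fh) (tens_rep_ahom gh gh). Qed.

Lemma rep4_l t : rep4 (tmap (@tensl _ A A) (@tensl _ A A) t) = leg13 (tens_rep f g t).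
Proof.
have [ll _ _] := @tensl_ahom F A A; have [rl _ _] := rep4_ahom.
have [pl _ _] := tens_rep_ahom fh gh; have [l13 _ _] := @leg13_ahom F I J.
have [_ _ f1] := fh; have [_ _ g1] := gh.
move: t; apply: tens_slin_eq => [||a b].
- exact: slin_comp (tmap_slin ll ll) rl.
- exact: slin_comp pl l13.
rewrite tmap_pure // tens_rep_pure //.
rewrite /rep4 (tens_rep_pure (tens_rep_ahom fh fh) (tens_rep_ahom gh gh)) !tensl_pure.
by rewrite !tens_rep_pure // f1 g1 leg13_kron.
Qed.

Lemma rep4_r t : rep4 (tmap (@tensr _ A A) (@tensr _ A A) t) = leg24 (tens_rep f g t).
Proof.
have [ll _ _] := @tensr_ahom F A A; have [rl _ _] := rep4_ahom.
have [pl _ _] := tens_rep_ahom fh gh; have [l24 _ _] := @leg24_ahom F I J.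
have [_ _ f1] := fh; have [_ _ g1] := gh.
move: t; apply: tens_slin_eq => [||a b].
- exact: slin_comp (tmap_slin ll ll) rl.
- exact: slin_comp pl l24.
rewrite tmap_pure // tens_rep_pure //.
rewrite /rep4 (tens_rep_pure (tens_rep_ahom fh fh) (tens_rep_ahom gh gh)) !tensr_pure.
by rewrite !tens_rep_pure // f1 g1 leg24_kron.
Qed.

Lemma fps_mulr_bool (x : {fps F}) (b : bool) n : x n * b%:R = (x * b%:R) n.
Proof. by case: b; rewrite ?mulr1 ?mulr0. Qed.

Lemma fps_fmx_leg13 (x : {fps fmx F (I * J)%type}) :
  fps_fmx (fps_map (@leg13 F I J) x) = leg13 (fps_fmx x).
Proof.
apply: fmxP => i k; apply: fpsP => n.
exact: (fps_mulr_bool (fps_fmx x (mswap i).1 (mswap k).1) ((mswap i).2 == (mswap k).2) n).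
Qed.
Lemma fps_fmx_leg24 (x : {fps fmx F (I * J)%type}) :
  fps_fmx (fps_map (@leg24 F I J) x) = leg24 (fps_fmx x).
Proof.
apply: fmxP => i k; apply: fpsP => n; apply: etrans (mulrC _ _) _.
apply: etrans (fps_mulr_bool (fps_fmx x (mswap i).2 (mswap k).2)
  ((mswap i).1 == (mswap k).1) n) _.
exact: (congr1 (fun z : {fps F} => z n) (mulrC _ _)).
Qed.

Definition fps_rep (B : pzAlgType F) (L : finType) (r : B -> fmx F L) (x : {fps B}) :
  fmx {fps F} L := fps_fmx (fps_map r x).

Lemma fps_rep_ahom (B : pzAlgType F) (L : finType) (r : B -> fmx F L) :
  ahom r -> ahom (fps_rep r).
Proof. by move=> rh; exact: ahom_comp (ahom_fps_map rh) (@fps_fmx_ahom F L). Qed.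

Definition twist4 (x : {fps AA}) : {fps tens AA AA} :=
  fps_map (tmap (@tensl _ A A) (@tensl _ A A)) x * fps_map (tmap (@tensr _ A A) (@tensr _ A A)) x.

Lemma ahom_invertible (K : pzRingType) (B B' : pzAlgType K) (h : B -> B') x :
  ahom h -> invertible x -> invertible (h x).
Proof. by move=> [_ hM h1] [y [xy yx]]; exists (h y); rewrite -!hM xy yx h1. Qed.

Lemma invertibleM (B : pzRingType) (x y : B) :
  invertible x -> invertible y -> invertible (x * y).
Proof.
move=> [x' [xx' x'x]] [y' [yy' y'y]]; exists (y' * x').
by rewrite -mulrA (mulrA y) yy' mul1r xx' -mulrA (mulrA x') x'x mul1r y'y.
Qed.

Lemma twist4_invertible x : invertible x -> invertible (twist4 x).
Proof.
have lh := @tensl_ahom F A A; have rh := @tensr_ahom F A A.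
by move=> xi; apply: invertibleM; apply: ahom_invertible xi; apply: ahom_fps_map;
  exact: tmap_ahom.
Qed.

(** The image of the chosen inverse is a left inverse of [h x], hence equal to any right inverse. *)
Lemma inverse_ahom (K : pzRingType) (B B' : pzAlgType K) (h : B -> B') x z :
  ahom h -> invertible x -> h x * z = 1 -> h (inverse x) = z.
Proof.
move=> [_ hM h1] [y xyP] xz.
have [_ e] := @xgetPex _ 0 [set y | x * y = 1 /\ y * x = 1]%classic (ex_intro _ y xyP).
by rewrite -[LHS]mulr1 -xz mulrA -hM e h1 mul1r.
Qed.

Lemma fps_rep_twist4 x :
  fps_rep rep4 (twist4 x)
  = leg13 (fps_rep (tens_rep f g) x) * leg24 (fps_rep (tens_rep f g) x).
Proof.
have [_ M _] := fps_rep_ahom rep4_ahom; rewrite M -fps_fmx_leg13 -fps_fmx_leg24.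
congr (_ * _); congr fps_fmx; apply: fpsP => n; [exact: rep4_l | exact: rep4_r].
Qed.

(** Elements in the legs 13 and 24 commute, so the inverse may be formed in each pair of legs
    separately. *)
Lemma fps_rep_twist4_inverse x (z : fmx {fps F} (I * J)%type) : invertible x ->
  fps_rep (tens_rep f g) x * z = 1 ->
  fps_rep rep4 (inverse (twist4 x)) = leg13 z * leg24 z.
Proof.
move=> /twist4_invertible xi xz; apply: inverse_ahom (fps_rep_ahom rep4_ahom) xi _.
have [_ M13 h13] := @leg13_ahom {fps F} I J; have [_ M24 h24] := @leg24_ahom {fps F} I J.
by rewrite fps_rep_twist4 mulr_comm4 ?legs_comm // -M13 -M24 xz h13 h24 mulr1.
Qed.

End TwistLegs.

Section FpsBilinear.
Variables (F : comNzRingType) (A B V : pzAlgType F) (g : A -> B -> V).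

Lemma fps_bil_slinl (y : {fps B}) : (forall b, slin (g^~ b)) ->
  slin (fun x => fps_bil g x y).
Proof.
move=> gl; apply: slinP => [x x'|a x]; apply: fpsP => n.
  by rewrite fps_coefD -big_split; apply: eq_bigr => k _; rewrite fps_coefD (slinD (gl _)).
rewrite fps_scalE.
transitivity (\sum_(k < n.+1) \sum_(i < k.+1) scal (a i) * g (x (k - i)%N) (y (n - k)%N)).
  apply: eq_bigr => k _; rewrite fps_scalE (slin_sum (gl _)).
  by apply: eq_bigr => i _; rewrite (slinZ (gl _)).
rewrite (convolA (fun i j k => scal (a i) * g (x j) (y k))).
by apply: eq_bigr => i _; rewrite mulr_sumr.
Qed.

Lemma fps_bil_slinr (x : {fps A}) : (forall a, slin (g a)) -> slin (fps_bil g x).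
Proof.
move=> gr; apply: slinP => [y y'|a y]; apply: fpsP => n.
  by rewrite fps_coefD -big_split; apply: eq_bigr => k _; rewrite fps_coefD (slinD (gr _)).
rewrite fps_scalE.
transitivity (\sum_(k < n.+1) \sum_(i < (n - k).+1)
    scal (a i) * g (x k) (y (n - k - i)%N)).
  apply: eq_bigr => k _; rewrite fps_scalE (slin_sum (gr _)).
  by apply: eq_bigr => i _; rewrite (slinZ (gr _)).
(* The scalar stands between the two arguments in the triple convolution; regrouping, exchanging the
   first two indices and regrouping again brings it to the front. *)
rewrite -(convolA (fun k i j => scal (a i) * g (x k) (y j))).
transitivity (\sum_(k < n.+1) \sum_(i < (n - k).+1)
    scal (a k) * g (x i) (y (n - k - i)%N)); last first.
  by apply: eq_bigr => k _; rewrite mulr_sumr.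
rewrite -(convolA (fun i k j => scal (a i) * g (x k) (y j))).
by apply: eq_bigr => s _; rewrite (convolC (fun k i => scal (a i) * g (x k) (y (n - s)%N))).
Qed.

Lemma fps_bil_cst a b : (forall b, slin (g^~ b)) -> (forall a, slin (g a)) ->
  fps_bil g (fps_cst a) (fps_cst b) = fps_cst (g a b).
Proof.
move=> gl gr; apply: fpsP => n; rewrite [LHS]big_ord_recl big1 => [|k _].
  by case: n => [|n]; rewrite addr0 //; exact: slin0 (gr a).
exact: slin0 (gl _).
Qed.

Lemma fps_bil_cstr (x : {fps A}) b : (forall a, slin (g a)) ->
  fps_bil g x (fps_cst b) = fps_map (g^~ b) x.
Proof.
move=> gr; apply: fpsP => n; rewrite [LHS](convolC (fun i j => g (x i) (fps_cst b j))).
rewrite big_ord_recl big1 => [|k _]; first by rewrite subn0 addr0.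
exact: slin0 (gr _).
Qed.

End FpsBilinear.

Section TensorLift.
Variables (F : comNzRingType) (A B V W : pzAlgType F).

Lemma slin_tlift (h : V -> W) (f : A -> B -> V) p : slin h ->
  h (tlift f p) = tlift (fun a b => h (f a b)) p.
Proof.
by move=> hl; rewrite /tlift /wsum slin_sum //; apply: eq_bigr => w _; rewrite slinZ.
Qed.

Lemma tlift_param_slin (f : A -> B -> V -> W) p : (forall a b, slin (f a b)) ->
  slin (fun v => tlift (fun a b => f a b v) p).
Proof.
move=> fl c x y; rewrite /tlift /wsum mulr_sumr -big_split; apply: eq_bigr => w _.
rewrite (fl _ _ c) mulrDr !mulrA; congr (_ * _ + _); exact: esym (scal_central _ _).
Qed.

End TensorLift.

Section TwistedProduct.
Variables (F : comNzRingType) (S V : pzAlgType F) (act : S -> V -> V).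
Hypotheses (act_slinl : forall v, slin (act^~ v)) (act_slinr : forall s, slin (act s)).

Definition tens_mul : tens V V -> V := tlift (fun x y : V => x * y).
Definition tens_act (p : tens S S) (t : tens V V) : tens V V :=
  tlift (fun s s' => tmap (act s) (act s') t) p.
(** The right-hand side of the theorem for a general acting algebra [S] and a general element [G];
    the theorem's expression unfolds to this one. *)
Definition twisted_product (G : {fps tens S S}) (x y : {fps V}) : {fps V} :=
  fps_map tens_mul (fps_bil tens_act G (fps_bil (@tpure _ V V) x y)).

Lemma tens_mul_slin : slin tens_mul.
Proof. by apply: tlift_slin => v; [exact: slin_mulr | exact: slin_mull]. Qed.

Lemma tens_mul_pure x y : tens_mul (tpure x y) = x * y.
Proof. by apply: tlift_pure => v; [exact: slin_mulr | exact: slin_mull]. Qed.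

Lemma tens_act_slin p : slin (tens_act p).
Proof. by apply: tlift_param_slin => s s'; exact: tmap_slin. Qed.

Lemma twisted_product_slinl G y : slin (fun x => twisted_product G x y).
Proof.
apply: slin_comp (slin_comp (fps_bil_slinl y (@slin_tpurel F V V))
  (fps_bil_slinr G tens_act_slin)) (slin_fps_map tens_mul_slin).
Qed.

Lemma twisted_product_slinr G x : slin (twisted_product G x).
Proof.
apply: slin_comp (slin_comp (fps_bil_slinr x (@slin_tpurer F V V))
  (fps_bil_slinr G tens_act_slin)) (slin_fps_map tens_mul_slin).
Qed.

Lemma tens_act_pure p v w :
  tens_mul (tens_act p (tpure v w)) = tlift (fun s s' => act s v * act s' w) p.
Proof.
rewrite (slin_tlift _ _ tens_mul_slin); congr (tlift _ p).
apply: funext => s; apply: funext => s'.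
by rewrite tmap_pure // tens_mul_pure.
Qed.

Lemma tlift_act_slin v w : slin (tlift (fun s s' => act s v * act s' w)).
Proof.
apply: tlift_slin => s; first exact: slin_comp (act_slinl v) (slin_mulr _).
exact: slin_comp (act_slinl w) (slin_mull _).
Qed.

Variables (I J : finType) (f : S -> fmx F I) (g : S -> fmx F J).
Hypotheses (fh : ahom f) (gh : ahom g).
Variables (v : I -> V) (w : J -> V).
Hypothesis act_v : forall s i, act s (v i) = \sum_k scal (f s k i) * v k.
Hypothesis act_w : forall s j, act s (w j) = \sum_k scal (g s k j) * w k.

Lemma tens_act_rep p i j :
  tens_mul (tens_act p (tpure (v i) (w j)))
  = \sum_kl scal (tens_rep f g p kl (i, j)) * (v kl.1 * w kl.2).
Proof.
rewrite tens_act_pure; have [rl _ _] := tens_rep_ahom fh gh.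
move: p; apply: tens_slin_eq => [||a b].
- exact: tlift_act_slin.
- exact: (slin_rep_comb (fun kl => v kl.1 * w kl.2) (i, j) rl).
rewrite tlift_pure => [|s|s]; last 2 first.
- exact: slin_comp (act_slinl _) (slin_mulr _).
- exact: slin_comp (act_slinl _) (slin_mull _).
rewrite act_v act_w tens_rep_pure // mulr_suml.
rewrite -(pair_bigA _ (fun k l => scal (kron (f a) (g b) (k, l) (i, j)) * (v k * w l))) /=.
apply: eq_bigr => k _; rewrite mulr_sumr; apply: eq_bigr => l _; rewrite /kron /= scalM.
by apply: esym; apply: mulr_comm4; exact: esym (scal_central _ _).
Qed.

Lemma twisted_product_rep G i j :
  twisted_product G (fps_cst (v i)) (fps_cst (w j))
  = \sum_kl scal (fps_rep (tens_rep f g) G kl (i, j)) * fps_cst (v kl.1 * w kl.2).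
Proof.
rewrite /twisted_product (fps_bil_cst _ _ (@slin_tpurel F V V) (@slin_tpurer F V V)).
rewrite (fps_bil_cstr _ _ tens_act_slin); apply: fpsP => n.
rewrite fps_coef_sum [LHS]tens_act_rep; apply: eq_bigr => kl _.
by rewrite fps_coefM_cst.
Qed.

End TwistedProduct.

Section CGInverse.
Variables (K : comPzRingType) (q c : cg_family K).
Hypotheses (q_orth : cg_orthogonal q) (c_orth : cg_orthogonal c).
Variables n1 n2 : nat.
Local Notation P := ('I_n1.+1 * 'I_n2.+1)%type.

Lemma cg_column_sum n (i : 'I_n.+1) (g : forall n, 'I_n.+1 -> K) : cg_range n1 n2 n ->
  \sum_(p : P) c p.1 p.2 i
     * (\sum_(n' < (n1 + n2).+1 | cg_range n1 n2 n') \sum_(j < n'.+1) c p.1 p.2 j * g n' j)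
  = g n i.
Proof.
move=> r; have [_ orth] := c_orth n1 n2.
transitivity (\sum_(n' < (n1 + n2).+1 | cg_range n1 n2 n') \sum_(j < n'.+1)
    ((n == n') && (i == j :> nat))%:R * g n' j).
  transitivity (\sum_(p : P) \sum_(n' < (n1 + n2).+1 | cg_range n1 n2 n')
      \sum_(j < n'.+1) (c p.1 p.2 i * c p.1 p.2 j) * g n' j).
    apply: eq_bigr => p _; rewrite mulr_sumr; apply: eq_bigr => n' _.
    by rewrite mulr_sumr; apply: eq_bigr => j _; rewrite mulrA.
  rewrite exchange_big; apply: eq_bigr => n' r'; rewrite exchange_big.
  apply: eq_bigr => j _; rewrite -mulr_suml -(orth _ _ i j r r').
  by rewrite -(pair_bigA _ (fun a b => c a b i * c a b j)).
have nN : (n < (n1 + n2).+1)%N by rewrite ltnS (cg_range_le r).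
rewrite (bigD1 (Ordinal nN)) //= [X in _ + X]big1 ?addr0; last first.
  move=> j /andP[_ /negPf jn]; rewrite big1 // => m _.
  by rewrite eq_sym -[j == n :> nat]/(j == Ordinal nN) jn mul0r.
rewrite (bigD1 i) //= !eqxx mul1r big1 ?addr0 // => j ji.
have /negPf -> : i != j :> nat by rewrite eq_sym.
by rewrite mul0r.
Qed.

Definition cg_change : fmx K P := fun x y =>
  \sum_(n < (n1 + n2).+1 | cg_range n1 n2 n) \sum_(i < n.+1) q x.1 x.2 i * c y.1 y.2 i.
Definition cg_change_inv : fmx K P := fun x y =>
  \sum_(n < (n1 + n2).+1 | cg_range n1 n2 n) \sum_(i < n.+1) c x.1 x.2 i * q y.1 y.2 i.

(** In matrix form (C_q C^T)(C C_q^T) = 1: the columns of C are orthonormal, and so are the rows of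
    C_q. *)
Lemma cg_changeK : cg_change * cg_change_inv = 1.
Proof.
apply: fmxP => -[x1 x2] [y1 y2]; rewrite fmxME fmx1E xpair_eqE.
have [orth _] := q_orth n1 n2; rewrite -(orth x1 y1 x2 y2).
transitivity (\sum_(n < (n1 + n2).+1 | cg_range n1 n2 n) \sum_(i < n.+1)
    q x1 x2 i * \sum_(p : P) c p.1 p.2 i * cg_change_inv p (y1, y2)); last first.
  apply: eq_bigr => n r; apply: eq_bigr => i _; congr (_ * _).
  exact: (cg_column_sum i (fun n j => q y1 y2 j) r).
under [RHS]eq_bigr => n r do under eq_bigr => i _ do rewrite mulr_sumr.
under [RHS]eq_bigr => n r do rewrite exchange_big.
rewrite [RHS]exchange_big; apply: eq_bigr => p _; rewrite mulr_suml; apply: eq_bigr => n _.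
by rewrite mulr_suml; apply: eq_bigr => i _; rewrite mulrA.
Qed.

(** In matrix form C^T (C C_q^T) = C_q^T: this is the step at which the inverse twist replaces
    undeformed coefficients by deformed ones. *)
Lemma cg_change_inv_sum y n (i : 'I_n.+1) : cg_range n1 n2 n ->
  \sum_(p : P) cg_change_inv p y * c p.1 p.2 i = q y.1 y.2 i.
Proof.
move=> r; rewrite -(cg_column_sum i (fun n j => q y.1 y.2 j) r).
by apply: eq_bigr => p _; rewrite mulrC.
Qed.

End CGInverse.

Section TwistedX0.
Variables (R : realType) (c : cg_family R) (cq : cg_family {fps R}).
Hypotheses (hc : is_CG c) (hcq : is_qCG c cq).
Local Notation C := R[i].
Local Notation K := {fps C}.
Local Notation V := (X0 R : pzAlgType C).
Local Notation S := (UU R : pzAlgType C).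
Variables (alpha : Uh R -> {fps U R}) (Fs : {fps UU R}).
Hypothesis hFs : is_standard_twist alpha c cq Fs.
Variables (acth : so4h R -> Mh R -> Mh R) (hacth : is_Mh_action acth).
Variables (T : forall n : nat, 'I_n.+1 -> 'I_n.+1 -> Mh R) (hT : is_T acth T).
Variables (act : so4 R -> X0 R -> X0 R) (hact : is_so4_action T act).
Variables (phi : Mh R -> {fps X0 R}) (hphi : is_identification T phi).
Local Notation q := (qcg cq).
Local Notation e := (det_T T).
Local Notation real := (real_complex R).

Definition ccg : cg_family K := fun n1 n2 n i1 i2 i => fps_cst (real (c i1 i2 i)).

Lemma ccg_orth : cg_orthogonal ccg.
Proof.
have cst_nat (b : nat) : fps_cst (real b%:R) = b%:R :> K.
  elim: b => [|b IHb]; first by rewrite rmorph0 fps_cst0.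
  by rewrite mulrSr rmorphD rmorph1 fps_cstD IHb mulrSr.
move=> n1 n2; have [h1 h2] := CG_orthogonal hc n1 n2; split.
  move=> i1 k1 i2 k2; rewrite -cst_nat -(h1 i1 k1 i2 k2) rmorph_sum fps_cst_sum.
  apply: eq_bigr => n _; rewrite rmorph_sum fps_cst_sum; apply: eq_bigr => i _.
  by rewrite rmorphM fps_cstM.
move=> n n' i i' r r'; rewrite -cst_nat -(h2 _ _ i i' r r') rmorph_sum fps_cst_sum.
apply: eq_bigr => i1 _; rewrite rmorph_sum fps_cst_sum; apply: eq_bigr => i2 _.
by rewrite rmorphM fps_cstM.
Qed.

Lemma act_slinl (v : V) : slin (act^~ v : S -> V).
Proof.
have am := so4_module hact; move=> a s t.
by rewrite (act_add am) (act_mul am) (act_scal am) X0_scaleE.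
Qed.

Lemma act_slinr (s : S) : slin (act s : V -> V).
Proof.
have am := so4_module hact; move=> a v w.
by rewrite -!X0_scaleE; exact: (act_linear am).
Qed.

Lemma act_det_T k n (s : S) (i : 'I_n.+1 * 'I_n.+1) :
  act s (e k i.1 i.2)
  = \sum_l (scal (tens_rep (@Rr R n) (@Rr R n) s l i) : V) * e k l.1 l.2.
Proof.
have [rl _ _] := tens_rep_ahom (@Rr_ahom R n) (@Rr_ahom R n).
move: s; apply: tens_slin_eq => [||a b].
- exact: act_slinl.
- exact: (slin_rep_comb (fun l => e k l.1 l.2) i rl).
apply: etrans (so4_act_T hact a b k i.1 i.2) _.
rewrite (tens_rep_pure (@Rr_ahom R n) (@Rr_ahom R n)).
rewrite pair_bigA; apply: eq_bigr => -[l l'] _.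
exact: X0_scaleE.
Qed.

Section Spins.
Variables n1 n2 : nat.
Local Notation f := (@Rr R n1).
Local Notation g := (@Rr R n2).

Lemma standard_twist_rep : fps_rep (tens_rep f g) Fs = @cg_change K q ccg n1 n2.
Proof.
apply: fmxP => -[i1 i2] [k1 k2]; apply: etrans (standard_coef hFs i1 k1 i2 k2) _.
apply: eq_bigr => n _; apply: eq_bigr => i _; rewrite fps_map_rmorphM; congr (_ * _).
by apply: fps_map_cst; exact: rmorph0.
Qed.

Lemma standard_twist_inverse_rep :
  fps_rep (rep4 f g) (inverse (twist4 Fs))
  = leg13 (@cg_change_inv K q ccg n1 n2) * leg24 (@cg_change_inv K q ccg n1 n2).
Proof.
apply: (fps_rep_twist4_inverse (@Rr_ahom R n1) (@Rr_ahom R n2)).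
  exact: twist_inv (standard_twist hFs).
by rewrite standard_twist_rep; exact: cg_changeK (qcg_orth hcq) ccg_orth n1 n2.
Qed.

(** Both the matrix of the inverse twist and the coefficients of the undeformed product factor into
    an unprimed and a primed part. [couple_sum] separates the two sums, and [cg_change_inv_sum]
    evaluates each. *)
Lemma twisted_det_T (i i' : 'I_n1.+1) k1 (a a' : 'I_n2.+1) k2 :
  twisted_product (act : S -> V -> V) (inverse (twist4 Fs))
    (fps_cst (e k1 i i')) (fps_cst (e k2 a a'))
  = cgprod q e i i' (k1 + k2) a a'.
Proof.
pose M := @cg_change_inv K q ccg n1 n2.
have TP := twisted_product_rep act_slinl act_slinr
  (tens_rep_ahom (@Rr_ahom R n1) (@Rr_ahom R n1))
  (tens_rep_ahom (@Rr_ahom R n2) (@Rr_ahom R n2)) (@act_det_T k1 n1) (@act_det_T k2 n2)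
  (inverse (twist4 Fs)) (i, i') (a, a').
apply: etrans TP _; rewrite -/(rep4 f g) standard_twist_inverse_rep -/M.
(* Regrouping the summation from the factors (1,2),(3,4) to the legs (1,3),(2,4) in which the twist
   sits. *)
rewrite (reindex (@mswap 'I_n1.+1 'I_n2.+1 'I_n1.+1 'I_n2.+1)) /=; last first.
  by exists (@mswap _ _ _ _) => p _; exact: mswapK.
transitivity (\sum_p \sum_p' scal (M p (i, a) * M p' (i', a')) *
    \sum_(n < (n1 + n2).+1 | cg_range n1 n2 n) \sum_(m < n.+1) \sum_(m' < n.+1)
      scal (ccg p.1 p.2 m * ccg p'.1 p'.2 m')
      * fps_cst (e (k1 + k2 + (n1 + n2 - n)./2)%N m m') : {fps V}).
  rewrite pair_bigA; apply: eq_bigr => -[[l b] [l' b']] _; rewrite leg13_24.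
  congr (_ * _); rewrite /= (X0_product hc hcq hacth hT hphi) fps_cst_sum.
  apply: eq_bigr => n r; rewrite fps_cst_sum; apply: eq_bigr => m _.
  rewrite fps_cst_sum; apply: eq_bigr => m' _.
  by rewrite fps_cstM -fps_scal_cst rmorphM fps_cstM.
have CS := @couple_sum C {fps V} _ (n1 + n2) (cg_range n1 n2)
  (fun p => M p (i, a)) (fun p => M p (i', a'))
  (fun p n m => ccg p.1 p.2 m) (fun p n m => ccg p.1 p.2 m)
  (fun n m m' => fps_cst (e (k1 + k2 + (n1 + n2 - n)./2)%N m m')).
apply: etrans CS _; apply: eq_bigr => n r; apply: eq_bigr => m _; apply: eq_bigr => m' _.
by rewrite /M !(cg_change_inv_sum q ccg_orth _ _ r).
Qed.

End Spins.

Lemma mu_h_det_T n1 (i i' : 'I_n1.+1) k1 n2 (a a' : 'I_n2.+1) k2 :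
  mu_h phi (fps_cst (e k1 i i')) (fps_cst (e k2 a a')) = cgprod q e i i' (k1 + k2) a a'.
Proof.
have E k n (j j' : 'I_n.+1) : phi_inv phi (fps_cst (e k j j')) = det_q R ^+ k * T j j'.
  by apply: (can_inj (phiK hphi)); rewrite (phi_invK hphi) (phi_T hphi).
apply: etrans _ (Mh_product hc hcq hacth hT hphi k1 i i' k2 a a').
exact: (congr1 phi (f_equal2 *%R (E k1 n1 i i') (E k2 n2 a a'))).
Qed.

Lemma mu_h_slinl (y : {fps V}) : slin (fun x : {fps V} => mu_h phi x y).
Proof.
have pl := psi_slin (phi_slin hphi) (phiK hphi) (phi_invK hphi).
exact: slin_comp (slin_comp pl (slin_mulr _)) (phi_slin hphi).
Qed.

Lemma mu_h_slinr (x : {fps V}) : slin (mu_h phi x : {fps V} -> {fps V}).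
Proof.
have pl := psi_slin (phi_slin hphi) (phiK hphi) (phi_invK hphi).
exact: slin_comp (slin_comp pl (slin_mull _)) (phi_slin hphi).
Qed.

Lemma mu_h_twisted (x y : {fps V}) :
  mu_h phi x y = twisted_product (act : S -> V -> V) (inverse (twist4 Fs)) x y.
Proof.
set G := inverse _.
have bas : forall t, exists k n (a a' : 'I_n.+1), det_T_tagged T t = e k a a' := det_T_taggedP T.
move: x; apply: (slin_fps_basis_eq (det_T_span hphi) (separated_fps (A := V))
  (mu_h_slinl y) (twisted_product_slinl act_slinr G y)) => t.
have [k1 [n1 [i [i' ->]]]] := bas t; move: y.
apply: (slin_fps_basis_eq (det_T_span hphi) (separated_fps (A := V))
  (mu_h_slinr _) (twisted_product_slinr act_slinr G _)) => u.
have [k2 [n2 [a [a' ->]]]] := bas u.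
by rewrite mu_h_det_T twisted_det_T.
Qed.

End TwistedX0.

Theorem proposition9 (R : realType)
  (alpha : Uh R -> {fps U R}) (halpha : is_alpha alpha)
  (c : cg_family R) (hc : is_CG c)
  (cq : cg_family {fps R}) (hcq : is_qCG c cq)
  (Fs : {fps UU R}) (hFs : is_standard_twist alpha c cq Fs)
  (acth : so4h R -> Mh R -> Mh R) (hacth : is_Mh_action acth)
  (T : forall n : nat, 'I_n.+1 -> 'I_n.+1 -> Mh R) (hT : is_T acth T)
  (act : so4 R -> X0 R -> X0 R) (hact : is_so4_action T act)
  (phi : Mh R -> {fps X0 R}) (hphi : is_identification T phi) :
  forall x y : {fps X0 R},
    mu_h phi x y
    = mu_0 (act_tens act (inverse (so4_twist Fs))
                     (fps_bil (@tpure _ (X0 R) (X0 R)) x y)).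
Proof. exact: (mu_h_twisted hc hcq hFs hacth hT hact hphi). Qed.
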